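(* For every real $p\ge 4$ there is a constant $C(p)>0$, depending only on $p$, such that, for every $n,d\in\mathbb N$ and every $f\in\mathcal P_d(\mathbb R^n)$, one has \[ \|\nabla f\|_{L^p(\gamma^n)}\le C(p)\,d^{\frac12+\theta_p}\,\|f\|_{L^p(\gamma^n)}, \] where \[ \theta_p:=\frac1\pi\arctan\biggl(\frac{p-2\lfloor p/2\rfloor}{2\sqrt{\lfloor p/2\rfloor\,(p-\lfloor p/2\rfloor)}}\biggr)\le\frac{2}{3p}. \] In particular, if $p$ is an even integer, then $\theta_p=0$ and one may take $C(p)=3\sqrt p$.
   Context: $\mathbb N=\{1,2,\dots\}$. $\mathcal P_d(\mathbb R^n)$ is the space of all real algebraic polynomials in $n$ variables of (total) degree at most $d$. $\gamma$ is the standard Gaussian probability measure on $\mathbb R$ and $\gamma^n$ is its $n$-fold product on $\mathbb R^n$. $\|\nabla f\|_{L^p(\gamma^n)}$ is the $L^p(\gamma^n)$ norm of the Euclidean length $|\nabla f|$ of the gradient. $\lfloor\cdot\rfloor$ is the integer part. *)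

(* Defs.v *)
From HB Require Import structures.
From mathcomp Require Import all_boot all_order all_algebra.
From mathcomp Require Import all_classical all_reals all_analysis.
(* The notations of mpoly clash with those of the analysis library. *)
From mathcomp Require Import -(notations) mpoly.
Import Order.TTheory GRing.Theory Num.Theory.
Import numFieldNormedType.Exports.

Set Implicit Arguments.
Unset Strict Implicit.
Unset Printing Implicit Defensive.

Local Open Scope classical_set_scope.
Local Open Scope ring_scope.

Section power_probability.
Context d (T : measurableType d) (R : realType).

Definition tuple_cons n (z : T * n.-tuple T) : n.+1.-tuple T :=
  [the n.+1.-tuple T of z.1 :: z.2].

Lemma measurable_tuple_cons n :
  measurable_fun [set: T * n.-tuple T] (@tuple_cons n).
Proof. exact: measurable_cons. Qed.

HB.instance Definition _ n :=
  isMeasurableFun.Build _ _ _ _ (@tuple_cons n) (@measurable_tuple_cons n).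

Variable P : probability T R.

(* n-fold product of P, carried by the product sigma-algebra of n.-tuple T;
   power_prob_box below gives its defining values on measurable boxes. *)
Fixpoint power_prob n : probability (n.-tuple T) R :=
  if n is m.+1 then distribution (P \x power_prob m)%E (@tuple_cons m)
  else \d_([tuple] : 0.-tuple T).

Lemma measurable_box n (A : 'I_n -> set T) : (forall i, measurable (A i)) ->
  measurable [set x : n.-tuple T | forall i, A i (tnth x i)].
Proof.
move=> mA; rewrite (_ : [set x | _] =
  \bigcap_(i : 'I_n) ((@tnth _ T ^~ i) @^-1` A i)).
  apply: fin_bigcap_measurable => // i _.
  by rewrite -[X in measurable X]setTI; exact: measurable_tnth.
by apply/seteqP; split=> [x Ax i _|x Ax i]; exact: Ax.
Qed.

Lemma power_prob_box n (A : 'I_n -> set T) : (forall i, measurable (A i)) ->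
  power_prob n [set x | forall i, A i (tnth x i)] = (\prod_(i < n) P (A i))%E.
Proof.
elim: n A => [|n IH] A mA.
  by rewrite big_ord0 /= diracE mem_set// => -[].
rewrite big_ord_recl -IH//= /distribution /pushforward.
set B := [set t | forall i, A (lift ord0 i) (tnth t i)].
rewrite (_ : _ @^-1` _ = A ord0 `*` B); last first.
  apply/seteqP; split=> -[x t] /=.
    move=> xtA; split; first exact: (xtA ord0).
    by move=> i; move: (xtA (lift ord0 i)); rewrite tnthS.
  move=> [Ax At] i; have [j ->|->//] := unliftP ord0 i.
  by rewrite tnthS; exact: At.
rewrite product_measure1E//.
by apply: (@measurable_box n (fun i => A (lift ord0 i))) => i; exact: mA.
Qed.

End power_probability.

Section gauss.
Context (R : realType).

Definition gauss_prob : probability (measurableTypeR R) R := normal_prob 0 1.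

Definition gauss_prod n : probability (n.-tuple (measurableTypeR R)) R :=
  power_prob gauss_prob n.

(* msize is 1 + the total degree, and 0 for the zero polynomial. *)
Definition total_degree_le n (d : nat) (f : mpoly n R) : bool :=
  (msize f <= d.+1)%N.

Definition poly_eval n (f : mpoly n R) (x : n.-tuple R) : R :=
  meval (tnth x) f.

Definition grad_norm n (f : mpoly n R) (x : n.-tuple R) : R :=
  Num.sqrt (\sum_(i < n) (poly_eval (mderiv i f) x) ^+ 2).

Definition gauss_norm n (p : R) (g : n.-tuple R -> R) : \bar R :=
  'N[gauss_prod n]_p%:E [EFin \o g]%E.

Definition theta (p : R) : R :=
  let m := (Num.floor (p / 2))%:~R in
  pi^-1 * atan ((p - 2 * m) / (2 * Num.sqrt (m * (p - m)))).

End gauss.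

(* Main.v *)
Require Import Defs.
From mathcomp Require Import all_boot all_order all_algebra.
From mathcomp Require Import all_classical all_reals all_analysis.
From mathcomp Require Import -(notations) mpoly.
From mathcomp Require Import ring lra complex measurable_realfun.
Import Order.TTheory GRing.Theory Num.Theory.
Import numFieldNormedType.Exports.
Import ComplexField.Normc.

(** The gradient of f is controlled by the moments of f at complex points.
    Let X be the standard Gaussian vector, zeta an independent standard complex
    Gaussian vector (real and imaginary parts of variance 1), and W = X + s zeta.
    Since f is a polynomial, zeta |-> f (X + s zeta) is holomorphic, and Bessel's
    inequality for its Taylor polynomial of degree one gives
      E_zeta |f(W)|^2 >= 2 s^2 |grad f(X)|^2,
    so that E |grad f|^p <= (2 s^2)^(- p/2) E |f(W)|^p  ([bessel],
    [gradient_le]). It remains to bound E |f(W)|^p by a constant times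
    E |f(X)|^p for s as large as possible.

    Write p = m q with m the integer part of p / 2, so that 2 <= q < 3, and let
    g = f^m, of degree at most D = m d; then |f|^p = |g|^q. Expand g in Hermite
    polynomials and let T_z multiply the part of degree k by e^(- k z). The main
    estimate is that T_z followed by evaluation at W is a contraction:
      E |T_z g (W)|^q <= E |g(X)|^q  when  s^2 + ((q - 2) / q) |z| <= Re z
    ([hermite_flow]). It is proved in one variable along the path
    t |-> T_{t^2 z} g (X + t s zeta): the time derivative of the q-th moment is
    integrated by parts in the Gaussian variables, after which the integrand is
    pointwise nonpositive. [tensorization] gives the case of n variables.

    The wanted bound is the one at z = 0, outside the contraction region. As
    T_z g is a polynomial of degree D in e^(- z), it is reached by
    extrapolation, for which a maximum principle holds for seminorms of
    holomorphic functions ([max_principle]). If p is an even integer, then q = 2,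
    the region is a half-plane, and the Bernstein-Walsh inequality loses a factor
    e^(s^2 D), which is harmless for s^2 of order 1 / d. This gives the power
    d^(1/2). In general the region contains a sector of half-angle pi/2 - psi with
    sin psi = (q - 2) / q, that is psi = pi theta, whose vertex lies at
    distance dl, of order s^2, from 0. A Phragmen-Lindelof argument on the
    complementary sector loses only e^(10 D dl^al) with al = 1 / (1 + 2 theta)
    ([extrapolate_wedge]). So dl may be taken as D^(- (1 + 2 theta)), and 1 / s
    is then of order d^(1/2 + theta).

    The estimate theta <= 2 / (3 p) is elementary: pi theta has sine
    (p - 2 m) / p, to be compared with the sine of 2 pi / (3 p)
    ([theta_le]). *)

Set Implicit Arguments.
Unset Strict Implicit.
Unset Printing Implicit Defensive.

Local Open Scope classical_set_scope.
Local Open Scope ring_scope.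

Local Notation Re := complex.Re.
Local Notation Im := complex.Im.

(** * Modulus and exponential of complex numbers *)

Section complex_basics.
Context {R : realType}.
Implicit Types (z w : R[i]) (a b : R).
Local Open Scope complex_scope.

Definition sqn z : R := Re z ^+ 2 + Im z ^+ 2.

Lemma sqn_ge0 z : 0 <= sqn z.
Proof. by rewrite addr_ge0 ?sqr_ge0. Qed.

Lemma normc_ge0 z : 0 <= normc z.
Proof. by case: z => a b; exact: sqrtr_ge0. Qed.

Lemma normc_sqr z : normc z ^+ 2 = sqn z.
Proof. by case: z => a b; rewrite sqr_sqrtr// addr_ge0 ?sqr_ge0. Qed.

Lemma normcE2 z : normc z = Num.sqrt (sqn z).
Proof. by case: z. Qed.

Lemma sqnM z w : sqn (z * w) = sqn z * sqn w.
Proof. by rewrite -!normc_sqr normcM exprMn. Qed.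

Lemma ReD z w : Re (z + w) = Re z + Re w. Proof. by case: z w => a b []. Qed.
Lemma ImD z w : Im (z + w) = Im z + Im w. Proof. by case: z w => a b []. Qed.
Lemma ReN z : Re (- z) = - Re z. Proof. by case: z. Qed.
Lemma ImN z : Im (- z) = - Im z. Proof. by case: z. Qed.
Lemma ReM z w : Re (z * w) = Re z * Re w - Im z * Im w.
Proof. by case: z w => a b []. Qed.
Lemma ImM z w : Im (z * w) = Re z * Im w + Im z * Re w.
Proof. by case: z w => a b []. Qed.
Lemma ReJ z : Re z^* = Re z. Proof. by case: z. Qed.
Lemma ImJ z : Im z^* = - Im z. Proof. by case: z. Qed.
Lemma ReC a : Re a%:C = a. Proof. by []. Qed.
Lemma ImC a : Im a%:C = 0. Proof. by []. Qed.

Definition reimE := (ReD, ImD, ReN, ImN, ReM, ImM, ReJ, ImJ, ReC, ImC).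

Lemma reim_eq z w : Re z = Re w -> Im z = Im w -> z = w.
Proof. by case: z w => a b [c d] /= -> ->. Qed.

Lemma ler_Re_normc z : `|Re z| <= normc z.
Proof.
by rewrite normcE2 -sqrtr_sqr ler_wsqrtr// lerDl sqr_ge0.
Qed.

Lemma ler_Im_normc z : `|Im z| <= normc z.
Proof.
by rewrite normcE2 -sqrtr_sqr ler_wsqrtr// lerDr sqr_ge0.
Qed.

Lemma normc_le_reim z : normc z <= `|Re z| + `|Im z|.
Proof.
rewrite -[leRHS]ger0_norm ?addr_ge0// -sqrtr_sqr normcE2 ler_wsqrtr//.
rewrite /sqn -(real_normK (num_real (Re z))) -(real_normK (num_real (Im z))).
by rewrite sqrrD lerD2r lerDl mulrn_wge0// mulr_ge0.
Qed.

Lemma normcJ z : normc z^* = normc z.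
Proof. by rewrite !normcE2 /sqn !reimE sqrrN. Qed.

Lemma normcC a : normc a%:C = `|a|.
Proof. by rewrite /= expr0n addr0 sqrtr_sqr. Qed.

Lemma normc_X z n : normc (z ^+ n) = normc z ^+ n.
Proof. by elim: n => [|n IH]; rewrite ?normc1// !exprS normcM IH. Qed.

Lemma normc_sum (I : Type) (r : seq I) (P : pred I) (F : I -> R[i]) :
  normc (\sum_(i <- r | P i) F i) <= \sum_(i <- r | P i) normc (F i).
Proof.
elim/big_ind2: _ => [|x1 x2 y1 y2 h1 h2|//]; first by rewrite normc0.
by rewrite (le_trans (le_normcD _ _))// lerD.
Qed.

Definition cexp z : R[i] := (expR (Re z) * cos (Im z)) +i* (expR (Re z) * sin (Im z)).

Lemma cexpD z w : cexp (z + w) = cexp z * cexp w.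
Proof.
rewrite /cexp ReD ImD expRD cosD sinD; apply: reim_eq; rewrite /= ; [ring|ring].
Qed.

Lemma cexp0 : cexp 0 = 1.
Proof. by rewrite /cexp /= expR0 cos0 sin0 mulr0 mulr1. Qed.

Lemma normc_cexp z : normc (cexp z) = expR (Re z).
Proof.
rewrite normcE2 /sqn /= !exprMn -mulrDr cos2Dsin2 mulr1.
by rewrite sqrtr_sqr ger0_norm ?expR_ge0.
Qed.

Lemma cexpMn z n : cexp (n%:R * z) = cexp z ^+ n.
Proof.
by elim: n => [|n IH]; rewrite ?mul0r ?cexp0 ?expr0// exprS -IH -cexpD -natr1 mulrDl mul1r addrC.
Qed.

End complex_basics.

(** * Differentiable paths in the complex plane *)

Section cder.
Context {R : realType}.
Local Open Scope complex_scope.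
Implicit Types (k l : R -> R[i]) (t : R) (z : R[i]).

(** The two parts are differentiated separately, which reduces the
calculus of complex paths to that of real functions. *)
Definition is_cder k t z :=
  is_derive t (1 : R) (fun x => Re (k x)) (Re z) /\
  is_derive t (1 : R) (fun x => Im (k x)) (Im z).

Lemma is_cder_eq k t z z' : is_cder k t z -> z = z' -> is_cder k t z'.
Proof. by move=> ? <-. Qed.

Lemma is_cder_cst z t : is_cder (fun=> z) t 0.
Proof. by split; exact: is_derive_cst. Qed.

Lemma is_cderD k l t z z' : is_cder k t z -> is_cder l t z' ->
  is_cder (fun x => k x + l x) t (z + z').
Proof.
move=> [k1 k2] [l1 l2]; split.
  by under eq_fun do rewrite ReD; rewrite ReD; exact: is_deriveD.
by under eq_fun do rewrite ImD; rewrite ImD; exact: is_deriveD.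
Qed.

Lemma is_cderN k t z : is_cder k t z -> is_cder (fun x => - k x) t (- z).
Proof.
move=> [k1 k2]; split.
  by under eq_fun do rewrite ReN; rewrite ReN; exact: is_deriveN.
by under eq_fun do rewrite ImN; rewrite ImN; exact: is_deriveN.
Qed.

Lemma is_cderJ k t z : is_cder k t z -> is_cder (fun x => (k x)^*) t (z^*).
Proof.
move=> [k1 k2]; split.
  by under eq_fun do rewrite ReJ; rewrite ReJ.
by under eq_fun do rewrite ImJ; rewrite ImJ; exact: is_deriveN.
Qed.

Lemma is_cderM k l t z z' : is_cder k t z -> is_cder l t z' ->
  is_cder (fun x => k x * l x) t (z * l t + k t * z').
Proof.
move=> [k1 k2] [l1 l2]; split.
  under eq_fun do rewrite ReM; rewrite !reimE.
  apply: is_derive_eq.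
  by rewrite /GRing.scale /= ?mulr1; ring.
under eq_fun do rewrite ImM; rewrite !reimE.
apply: is_derive_eq.
by rewrite /GRing.scale /= ?mulr1; ring.
Qed.

Lemma is_cder_sum (I : Type) (r : seq I) (k : I -> R -> R[i]) t (z : I -> R[i]) :
  (forall i, is_cder (k i) t (z i)) ->
  is_cder (fun x => \sum_(i <- r) k i x) t (\sum_(i <- r) z i).
Proof.
move=> kz; elim: r => [|i r IH].
  by under eq_fun do rewrite big_nil; rewrite big_nil; exact: is_cder_cst.
under eq_fun do rewrite big_cons; rewrite big_cons.
by apply: is_cderD.
Qed.

Lemma is_cder_real (a : R -> R) t a' : is_derive t (1 : R) a a' ->
  is_cder (fun x => (a x)%:C) t (a'%:C).
Proof. by move=> aa'; split => //; exact: is_derive_cst. Qed.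

Lemma is_cder_poly (p : {poly R[i]}) k t z : is_cder k t z ->
  is_cder (fun x => p.[k x]) t (p^`().[k t] * z).
Proof.
move=> kz; elim/poly_ind: p => [|p c IH].
  rewrite deriv0 horner0 mul0r; under eq_fun do rewrite horner0.
  exact: is_cder_cst.
under eq_fun do rewrite hornerD hornerM hornerX hornerC.
apply: is_cder_eq; first by apply: is_cderD; [apply: is_cderM; [exact: IH|exact: kz]|exact: is_cder_cst].
by rewrite derivMXaddC !hornerE; ring.
Qed.

Lemma Re_cexp z : Re (cexp z) = expR (Re z) * cos (Im z). Proof. by []. Qed.
Lemma Im_cexp z : Im (cexp z) = expR (Re z) * sin (Im z). Proof. by []. Qed.
Lemma scaleRE (a b : R) : a *: b = a * b. Proof. by []. Qed.

Lemma is_cder_cexp k t z : is_cder k t z ->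
  is_cder (fun x => cexp (k x)) t (z * cexp (k t)).
Proof.
move=> [k1 k2]; split.
  under eq_fun do rewrite Re_cexp; rewrite ReM Re_cexp Im_cexp.
  by apply: is_derive_eq; rewrite !scaleRE; ring.
under eq_fun do rewrite Im_cexp; rewrite ImM Re_cexp Im_cexp.
by apply: is_derive_eq; rewrite !scaleRE; ring.
Qed.

Lemma is_derive_sqn k t z : is_cder k t z ->
  is_derive t (1 : R) (fun x => sqn (k x)) (2 * Re ((k t)^* * z)).
Proof.
move=> [k1 k2]; rewrite /sqn; apply: is_derive_eq.
by rewrite !reimE /GRing.scale /=; ring.
Qed.

End cder.

(** * The Gaussian measure on the line *)

Section gauss1.
Context {R : realType}.
Local Notation mu := (@lebesgue_measure R).
Local Notation gam := (normal_prob (0 : R) 1).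
Local Notation phi := (normal_pdf (0 : R) 1).

(** A Radon-Nikodym derivative is determined almost everywhere by its
integrals. *)
Lemma gauss_dens :
  ae_eq mu setT (Radon_Nikodym_SigmaFinite.f gam mu) (fun x => (phi x)%:E).
Proof.
have dom := normal_prob_dominates (0 : R) 1.
apply: integral_ae_eq => //.
- exact: Radon_Nikodym_SigmaFinite.f_integrable.
- by apply/measurable_EFinP; exact: measurable_normal_pdf.
- by move=> E _ mE; rewrite -Radon_Nikodym_SigmaFinite.f_integral.
Qed.

Lemma ge0_gauss_integral (f : R -> \bar R) : (forall x, 0 <= f x)%E ->
  measurable_fun setT f ->
  (\int[gam]_x f x = \int[mu]_x (f x * (phi x)%:E))%E.
Proof.
have dom := normal_prob_dominates (0 : R) 1.
move=> f0 mf; rewrite -(Radon_Nikodym_SigmaFinite.change_of_variables dom)//.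
apply: ae_eq_integral => //.
- apply: emeasurable_funM => //.
  exact: measurable_int (Radon_Nikodym_SigmaFinite.f_integrable dom).
- apply: emeasurable_funM => //.
  by apply/measurable_EFinP; exact: measurable_normal_pdf.
- by apply: ae_eqe_mul2l; exact: gauss_dens.
Qed.

Lemma gauss_integral (f : R -> \bar R) : gam.-integrable setT f ->
  (\int[gam]_x f x = \int[mu]_x (f x * (phi x)%:E))%E.
Proof.
have dom := normal_prob_dominates (0 : R) 1.
move=> intf; rewrite -(Radon_Nikodym_change_of_variables dom)//.
have mf := measurable_int _ intf.
apply: ae_eq_integral => //.
- apply: emeasurable_funM => //.
- apply: emeasurable_funM => //.
  by apply/measurable_EFinP; exact: measurable_normal_pdf.
- apply: ae_eqe_mul2l; apply: ae_eq_trans gauss_dens.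
  by apply: ae_eq_sym; exact: ae_eq_Radon_Nikodym_SigmaFinite.
Qed.

Lemma gauss_pdfE (x : R) : phi x = normal_peak 1 * expR (- x ^+ 2 / 2).
Proof.
by rewrite normal_pdfE// /normal_fun subr0 expr1n.
Qed.

(** A polynomial weight costs a doubling of the variance: with y = x^2 and
M = 4 (N + 1), convexity of the exponential gives 1 + y <= M e^(y/M), whose
N-th power is absorbed by half of the exponent. *)
Lemma gauss_decay (N : nat) : exists2 C : R, 0 < C &
  forall x : R, (1 + x ^+ 2) ^+ N * phi x <= C * normal_pdf 0 (Num.sqrt 2) x.
Proof.
have s2 : (Num.sqrt 2 : R) != 0 by rewrite gt_eqF// sqrtr_gt0.
pose M : R := (4 * N.+1)%:R.
have M0 : 0 < M by rewrite ltr0n.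
have p2 : 0 < normal_peak (Num.sqrt 2 : R) by exact: normal_peak_gt0.
have p1 : 0 < normal_peak (1 : R) by apply: normal_peak_gt0; rewrite oner_eq0.
exists (M ^+ N * normal_peak 1 / normal_peak (Num.sqrt 2)).
  by rewrite divr_gt0// mulr_gt0// exprn_gt0.
move=> x; rewrite gauss_pdfE normal_pdfE//.
set y := x ^+ 2; have y0 : 0 <= y by exact: sqr_ge0.
rewrite -[leRHS]mulrA mulKf ?gt_eqF// mulrCA [M ^+ N * _]mulrC -[leRHS]mulrA.
rewrite ler_pM2l// /normal_fun subr0 sqr_sqrtr// -/y.
have -> : - y / (2 *+ 2) = y / 4 - y / 2 by field.
rewrite expRD mulNr mulrA ler_pM2r ?expR_gt0//.
apply: (@le_trans _ _ ((M * expR (y / M)) ^+ N)).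
  apply: lerXn2r; rewrite ?nnegrE.
  - by rewrite addr_ge0.
  - by rewrite mulr_ge0 ?expR_ge0// ltW.
  apply: (@le_trans _ _ (M * (1 + y / M))); last by rewrite ler_pM2l// expR_ge1Dx.
  rewrite mulrDr mulr1 mulrCA divff ?gt_eqF// mulr1 lerD2r /M.
  by rewrite ler1n muln_gt0.
rewrite exprMn -expRM_natl ler_pM2l ?exprn_gt0// ler_expR.
rewrite mulrCA ler_wpM2l// /M natrM invfM mulrA mulrAC ler_pdivrMr ?ltr0n//.
by rewrite mulVf// ler_pdivrMr ?ltr0n// mul1r ler_nat.
Qed.

Lemma gauss_moment (N : nat) :
  gam.-integrable setT (fun x : R => ((1 + x ^+ 2) ^+ N)%:E).
Proof.
have mX : measurable_fun [set: R] (fun x : R => ((1 + x ^+ 2) ^+ N)%:E).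
  by apply/measurable_EFinP; apply: measurable_funX; apply: measurable_funD.
have X0 (x : R) : 0 <= (1 + x ^+ 2) ^+ N by rewrite exprn_ge0// addr_ge0 ?sqr_ge0.
apply/integrableP; split => //.
under eq_integral do rewrite gee0_abs ?lee_fin//.
rewrite ge0_gauss_integral//.
have [C C0 HC] := gauss_decay N.
apply: (@le_lt_trans _ _ (\int[mu]_x (C%:E * (normal_pdf 0 (Num.sqrt 2) x)%:E))%E).
  apply: ge0_le_integral => //=.
  - by move=> x _; rewrite lee_fin mulr_ge0// normal_pdf_ge0.
  - apply: emeasurable_funM => //; apply/measurable_EFinP; exact: measurable_normal_pdf.
  - by apply: emeasurable_funM => //; apply/measurable_EFinP; exact: measurable_normal_pdf.
  - by move=> x _; rewrite -!EFinM lee_fin.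
rewrite integralZl//; last exact: integrable_normal_pdf.
by rewrite integral_normal_pdf mule1 ltry.
Qed.

Lemma gauss_integrable_dom (f : R -> R) (C : R) N : measurable_fun setT f ->
  (forall x, `|f x| <= C * (1 + x ^+ 2) ^+ N) -> gam.-integrable setT (EFin \o f).
Proof.
move=> mf fC.
apply: (@le_integrable _ _ _ gam _ measurableT _ (fun x => C%:E * ((1 + x ^+ 2) ^+ N)%:E)%E).
- exact/measurable_EFinP.
- move=> x _; by rewrite /= lee_fin (le_trans (fC x))//= ler_norm.
- by apply: integrableZl => //; exact: gauss_moment.
Qed.

(** The function (f' - x f) phi is the derivative of f phi, so its integral
over [- n, n] is a boundary term, which tends to 0 by [gauss_decay]. *)
Lemma gauss_ibp (f f' : R -> R) (C : R) N :
  (forall x, is_derive x (1 : R) f (f' x)) -> continuous f' ->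
  (forall x, `|f x| <= C * (1 + x ^+ 2) ^+ N) ->
  (forall x, `|f' x| <= C * (1 + x ^+ 2) ^+ N) ->
  (\int[gam]_x (x * f x)%:E = \int[gam]_x (f' x)%:E)%E.
Proof.
move=> df cf' fC f'C.
have cf : continuous f.
  by move=> x; apply: differentiable_continuous; apply/derivable1_diffP; case: (df x).
have C0 : 0 <= C by move: (fC 0); rewrite expr0n addr0 expr1n mulr1; apply: le_trans.
have mf : measurable_fun setT f by exact: continuous_measurable_fun.
have mf' : measurable_fun setT f' by exact: continuous_measurable_fun.
have xfC x : `|x * f x| <= C * (1 + x ^+ 2) ^+ N.+1.
  rewrite normrM exprS mulrCA ler_pM//.
  by rewrite -real_normK ?num_real//; have := normr_ge0 x; nra.
have i1 : gam.-integrable setT (fun x : R => (f' x)%:E).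
  exact: (gauss_integrable_dom mf' f'C).
have i2 : gam.-integrable setT (fun x : R => (x * f x)%:E).
  by apply: (gauss_integrable_dom _ xfC); exact: measurable_funM.
have dphi x : is_derive x (1 : R) phi (- x * phi x).
  have -> : phi = (fun x : R => normal_peak 1 * expR (- x ^+ 2 / 2)).
    by apply/funext => y; exact: gauss_pdfE.
  by apply: is_derive_eq; rewrite !scaleRE; field.
pose F x := f x * phi x.
pose G x := (f' x - x * f x) * phi x.
have dF x : is_derive x (1 : R) F (G x).
  by apply: is_derive_eq; rewrite !scaleRE /G; ring.
have cF : continuous F.
  by move=> x; apply: differentiable_continuous; apply/derivable1_diffP; case: (dF x).
have cphi : continuous phi by apply: continuous_normal_pdf; rewrite oner_eq0.
have cG : continuous G.
  move=> x; apply: cvgM; last exact: cphi.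
  by apply: cvgB; [exact: cf'|apply: cvgM => //; exact: cf].
have mG : measurable_fun setT G by exact: continuous_measurable_fun.
have mphi : measurable_fun setT phi by exact: continuous_measurable_fun.
have GC x : `|G x| <= (C + C) * (1 + x ^+ 2) ^+ N.+1 * phi x.
  rewrite normrM (ger0_norm (normal_pdf_ge0 _ _ _)) ler_wpM2r ?normal_pdf_ge0//.
  rewrite (le_trans (ler_normB _ _))// mulrDl lerD//.
  rewrite (le_trans (f'C x))// ler_wpM2l// ler_weXn2l// lerDl.
  exact: sqr_ge0.
have [D D0 HD] := gauss_decay N.+1.
have iG : mu.-integrable setT (EFin \o G).
  apply: (@le_integrable _ _ _ mu _ measurableT _
    (fun x => ((C + C) * D)%:E * (normal_pdf 0 (Num.sqrt 2) x)%:E)%E).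
  - exact/measurable_EFinP.
  - move=> x _; rewrite /= lee_fin (le_trans (GC x))// (le_trans _ (ler_norm _))//.
    by rewrite -!mulrA ler_wpM2l ?addr_ge0.
  - by apply: integrableZl => //; exact: integrable_normal_pdf.
suff : (\int[mu]_x (G x)%:E = 0)%E.
  have -> : (fun x => (G x)%:E) = (fun x : R => ((f' x)%:E - (x * f x)%:E) * (phi x)%:E)%E.
    by apply/funext => x; rewrite -EFinB -EFinM.
  rewrite -gauss_integral; last exact: integrableB.
  rewrite integralB//= => /eqP.
  have fin1 := integral_fune_fin_num measurableT i1.
  have fin2 := integral_fune_fin_num measurableT i2.
  by rewrite sube_eq ?add0e ?fin_num_adde_defl// => /eqP ->.
pose I (n : nat) : set R := `[(- (n.+1%:R : R)), n.+1%:R]%classic.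
have cvgG : ((\int[mu]_(x in I n) (G x)%:E) @[n --> \oo] --> \int[mu]_x (G x)%:E)%E.
  under eq_fun do rewrite integral_mkcond.
  have := @dominated_convergence _ _ R mu setT measurableT
    (fun n => ((EFin \o G) \_ (I n))) (EFin \o G) (abse \o (EFin \o G)).
  case=> //.
  - move=> n; apply/(measurable_restrictT _ _).1; first exact: measurable_itv.
    by apply: measurable_funTS; exact/measurable_EFinP.
  - exact/measurable_EFinP.
  - apply: aeW => x _; apply: cvg_near_cst; near=> n.
    rewrite /patch ifT// inE /I /= in_itv /= -ler_norml.
    apply: (@le_trans _ _ n%:R); last by rewrite ler_nat.
    by near: n; exact: nbhs_infty_ger.
  - exact: integrable_abse.
  - apply: aeW => x n _; rewrite /patch; case: ifPn => //= _.
    by rewrite normr0 lee_fin.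
have FTC n : (\int[mu]_(x in I n) (G x)%:E =
   (F n.+1%:R - F (- n.+1%:R))%:E)%E.
  rewrite (@continuous_FTC2 _ G F)//.
  - by rewrite gtrN// ltr0n.
  - by apply: continuous_subspaceT.
  - split.
    + by move=> x _; case: (dF x).
    + by apply: cvg_at_right_filter; exact: cF.
    + by apply: cvg_at_left_filter; exact: cF.
  - by move=> x _; rewrite derive1E; apply: (@derive_val _ _ _ _ _ _ _ (dF x)).
have cvg0 : ((\int[mu]_(x in I n) (G x)%:E) @[n --> \oo] --> 0)%E.
  under eq_fun do rewrite FTC.
  pose K := C * (D * normal_peak (Num.sqrt 2)).
  have FK (n : nat) y : `|y| = n.+1%:R -> `|F y| <= K / n.+1%:R.
    move=> yn; rewrite ler_pdivlMr ?ltr0n// normrM (ger0_norm (normal_pdf_ge0 _ _ _)).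
    have n1 : n.+1%:R <= 1 + y ^+ 2.
      rewrite -real_normK ?num_real// yn; have : (1 : R) <= n.+1%:R by rewrite ler1n.
      by nra.
    apply: (@le_trans _ _ (C * (1 + y ^+ 2) ^+ N * phi y * (1 + y ^+ 2))).
      by apply: ler_pM => //; rewrite ?mulr_ge0 ?normal_pdf_ge0// ler_wpM2r ?normal_pdf_ge0.
    rewrite -!mulrA ler_wpM2l// [phi y * _]mulrC mulrA -exprSr (le_trans (HD y))//.
    rewrite ler_pM2l// normal_pdf_ub// gt_eqF// sqrtr_gt0//.
  rewrite -(_ : 0%:E = 0%E)//; apply: cvg_EFin; first exact: nearW.
  apply/cvgr0Pnorm_le => e e0 /=; near=> n.
  rewrite (le_trans (ler_normB _ _))//.
  apply: (@le_trans _ _ (K / n.+1%:R + K / n.+1%:R)).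
    by apply: lerD; apply: FK; rewrite ?normrN ger0_norm.
  rewrite -mulrDl ler_pdivrMr ?ltr0n// -ler_pdivrMl//.
  apply: (@le_trans _ _ n%:R); last by rewrite ler_nat.
  by near: n; exact: nbhs_infty_ger.
exact: (cvg_unique _ cvgG cvg0).
Unshelve. all: end_near. Qed.

End gauss1.

(** * The Gaussian measure in three variables *)

Section product_tools.
Context d1 d2 (T1 : measurableType d1) (T2 : measurableType d2) (R : realType).
Variables (m1 : {sigma_finite_measure set T1 -> \bar R})
  (m2 : {sigma_finite_measure set T2 -> \bar R}).

Lemma integral_prodM (f : T1 -> \bar R) (g : T2 -> \bar R) :
  (forall x, 0 <= f x)%E -> (forall y, 0 <= g y)%E ->
  measurable_fun setT f -> measurable_fun setT g ->
  (\int[m1 \x m2]_z (f z.1 * g z.2) = (\int[m1]_x f x) * (\int[m2]_y g y))%E.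
Proof.
move=> f0 g0 mf mg.
rewrite fubini_tonelli1//; last 2 first.
- by apply: emeasurable_funM; apply: measurableT_comp.
- by move=> z; exact: mule_ge0.
rewrite /fubini_F /=.
under eq_integral do rewrite ge0_integralZl//.
by rewrite ge0_integralZr// integral_ge0.
Qed.

End product_tools.

Section gauss3.
Context {R : realType}.
Local Notation MR := (measurableTypeR R).
Local Notation gam := (@gauss_prob R).

Definition gauss2 : probability (MR * MR)%type R := (gam \x gam)%E.
(** The first coordinate is the real Gaussian point, the other two are the
real and imaginary parts of the complex Gaussian that will be added to it. *)
Definition gauss3 : probability (MR * (MR * MR))%type R := (gam \x gauss2)%E.

(** A weight that dominates all three coordinates and has finite moments of
every order. *)
Definition rho (w : MR * (MR * MR)) : R :=
  (1 + w.1 ^+ 2) * ((1 + w.2.1 ^+ 2) * (1 + w.2.2 ^+ 2)).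

Let one_sqr_ge1 (x : R) : 1 <= 1 + x ^+ 2.
Proof. by rewrite lerDl sqr_ge0. Qed.

Let one_sqr_ge0 (x : R) : 0 <= 1 + x ^+ 2.
Proof. exact: le_trans ler01 (one_sqr_ge1 x). Qed.

Lemma rho_ge1 w : 1 <= rho w.
Proof. by rewrite /rho; apply: mulr_ege1 => //; apply: mulr_ege1. Qed.

Let mX N : measurable_fun [set: MR] (fun x : MR => ((1 + x ^+ 2) ^+ N)%:E).
Proof. by apply/measurable_EFinP; apply: measurable_funX; apply: measurable_funD. Qed.

Lemma gauss2_moment N :
  gauss2.-integrable setT (fun w => (((1 + w.1 ^+ 2) * (1 + w.2 ^+ 2)) ^+ N)%:E).
Proof.
apply/integrableP; split.
  apply/measurable_EFinP; apply: measurable_funX; apply: measurable_funM;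
  by apply: measurable_funD => //; apply: measurable_funX.
under eq_integral do rewrite gee0_abs ?lee_fin ?exprn_ge0 ?mulr_ge0// exprMn EFinM.
pose g := fun x : MR => ((1 + x ^+ 2) ^+ N)%:E.
have g0 x : (0 <= g x)%E by rewrite lee_fin exprn_ge0.
rewrite [ltLHS](_ : _ = (\int[gam]_x g x * \int[gam]_x g x)%E); last first.
  exact: (integral_prodM gam gam g0 g0 (mX N) (mX N)).
have h : (\int[gam]_x g x < +oo)%E := integrable_lty measurableT (gauss_moment N).
have h0 : (0 <= \int[gam]_x g x)%E by exact: integral_ge0.
by rewrite lte_mul_pinfty// ge0_fin_numE.
Qed.

Lemma gauss3_moment N : gauss3.-integrable setT (fun w => (rho w ^+ N)%:E).
Proof.
have m2 : measurable_fun [set: MR * MR] (fun w : MR * MR =>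
    (((1 + w.1 ^+ 2) * (1 + w.2 ^+ 2)) ^+ N)%:E).
  exact: measurable_int (gauss2_moment N).
apply/integrableP; split.
  apply/measurable_EFinP; apply: measurable_funX; apply: measurable_funM.
    by apply: measurable_funD => //; apply: measurable_funX.
  apply: measurable_funM; apply: measurable_funD => //; apply: measurable_funX.
    by apply: (measurableT_comp measurable_fst); exact: measurable_snd.
  by apply: (measurableT_comp measurable_snd); exact: measurable_snd.
under eq_integral do rewrite gee0_abs ?lee_fin ?exprn_ge0 ?mulr_ge0// /rho exprMn EFinM.
pose g := fun x : MR => ((1 + x ^+ 2) ^+ N)%:E.
pose g2 := fun w : MR * MR => (((1 + w.1 ^+ 2) * (1 + w.2 ^+ 2)) ^+ N)%:E.
have g0 x : (0 <= g x)%E by rewrite lee_fin exprn_ge0.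
have g20 w : (0 <= g2 w)%E by rewrite lee_fin exprn_ge0// mulr_ge0.
rewrite [ltLHS](_ : _ = (\int[gam]_x g x * \int[gauss2]_w g2 w)%E); last first.
  exact: (integral_prodM gam gauss2 g0 g20 (mX N) m2).
have h : (\int[gam]_x g x < +oo)%E := integrable_lty measurableT (gauss_moment N).
have h2 : (\int[gauss2]_x g2 x < +oo)%E := integrable_lty measurableT (gauss2_moment N).
have h0 : (0 <= \int[gam]_x g x)%E by exact: integral_ge0.
by rewrite lte_mul_pinfty// ge0_fin_numE.
Qed.

Lemma gauss3_integrable_dom (f : MR * (MR * MR) -> R) (C : R) N :
  measurable_fun setT f -> (forall w, `|f w| <= C * rho w ^+ N) ->
  gauss3.-integrable setT (EFin \o f).
Proof.
move=> mf fC.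
apply: (@le_integrable _ _ _ gauss3 _ measurableT _ (fun w => C%:E * (rho w ^+ N)%:E)%E).
- exact/measurable_EFinP.
- by move=> x _; rewrite /= lee_fin (le_trans (fC x))//= ler_norm.
- by apply: integrableZl => //; exact: gauss3_moment.
Qed.

Lemma gauss2_integrable_dom (f : MR * MR -> R) (C : R) N :
  measurable_fun setT f ->
  (forall w, `|f w| <= C * ((1 + w.1 ^+ 2) * (1 + w.2 ^+ 2)) ^+ N) ->
  gauss2.-integrable setT (EFin \o f).
Proof.
move=> mf fC.
apply: (@le_integrable _ _ _ gauss2 _ measurableT _
  (fun w => C%:E * (((1 + w.1 ^+ 2) * (1 + w.2 ^+ 2)) ^+ N)%:E)%E).
- exact/measurable_EFinP.
- by move=> x _; rewrite /= lee_fin (le_trans (fC x))//= ler_norm.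
- by apply: integrableZl => //; exact: gauss2_moment.
Qed.

(** Fubini: the other coordinate is a parameter, on which the growth constant
C may depend. *)
Lemma gauss_ibp_fst d (T : measurableType d) (Q : probability T R)
    (u v : MR * T -> R) (C : T -> R) N :
  (forall x y, is_derive x (1 : R) (fun x => u (x, y)) (v (x, y))) ->
  (forall y, continuous (fun x : R => v (x, y))) ->
  (forall x y, `|u (x, y)| <= C y * (1 + x ^+ 2) ^+ N) ->
  (forall x y, `|v (x, y)| <= C y * (1 + x ^+ 2) ^+ N) ->
  (gam \x Q)%E.-integrable setT (fun w => (w.1 * u w)%:E) ->
  (gam \x Q)%E.-integrable setT (fun w => (v w)%:E) ->
  (\int[gam \x Q]_w (w.1 * u w)%:E = \int[gam \x Q]_w (v w)%:E)%E.
Proof.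
move=> duv cv uC vC iu iv.
rewrite -(integral21_prod_meas1 iu) -(integral21_prod_meas1 iv).
apply: eq_integral => y _ /=.
exact: (gauss_ibp (f := fun x => u (x, y)) (f' := fun x => v (x, y)) (C := C y) (N := N)).
Qed.

Lemma gauss_ibp_snd d (T : measurableType d) (Q : probability T R)
    (u v : T * MR -> R) (C : T -> R) N :
  (forall x y, is_derive x (1 : R) (fun x => u (y, x)) (v (y, x))) ->
  (forall y, continuous (fun x : R => v (y, x))) ->
  (forall x y, `|u (y, x)| <= C y * (1 + x ^+ 2) ^+ N) ->
  (forall x y, `|v (y, x)| <= C y * (1 + x ^+ 2) ^+ N) ->
  (Q \x gam)%E.-integrable setT (fun w => (w.2 * u w)%:E) ->
  (Q \x gam)%E.-integrable setT (fun w => (v w)%:E) ->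
  (\int[Q \x gam]_w (w.2 * u w)%:E = \int[Q \x gam]_w (v w)%:E)%E.
Proof.
move=> duv cv uC vC iu iv.
rewrite -(integral12_prod_meas1 iu) -(integral12_prod_meas1 iv).
apply: eq_integral => y _ /=.
exact: (gauss_ibp (f := fun x => u (y, x)) (f' := fun x => v (y, x)) (C := C y) (N := N)).
Qed.

Lemma rho_coord (w : MR * (MR * MR)) :
  [/\ `|w.1| <= rho w, `|w.2.1| <= rho w & `|w.2.2| <= rho w].
Proof.
have h (x : R) : `|x| <= 1 + x ^+ 2.
  by rewrite -real_normK ?num_real//; have := normr_ge0 x; nra.
have h1 (x y : R) : 1 <= x -> 1 <= y -> x <= x * y.
  by move=> x1 y1; rewrite ler_peMr// (le_trans ler01).
rewrite /rho; split; rewrite (le_trans (h _))//.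
- by rewrite h1// mulr_ege1.
- by rewrite mulrCA h1// mulr_ege1.
- by rewrite mulrA mulrC h1// mulr_ege1.
Qed.

Section ibp3.
Variables (u v : MR * (MR * MR) -> R) (C : R) (N : nat).
Hypotheses (mu : measurable_fun setT u) (mv : measurable_fun setT v).
Hypotheses (uC : forall w, `|u w| <= C * rho w ^+ N)
  (vC : forall w, `|v w| <= C * rho w ^+ N).

Let C0 : 0 <= C.
Proof.
have := uC (0, (0, 0)); rewrite /rho /= expr0n addr0 !mulr1 expr1n mulr1.
exact: le_trans.
Qed.

Let dom (g : MR * (MR * MR) -> R) : measurable_fun setT g ->
  (forall w, `|g w| <= rho w) -> gauss3.-integrable setT (fun w => (g w * u w)%:E).
Proof.
move=> mg gr; apply: (@gauss3_integrable_dom _ C N.+1).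
  exact: measurable_funM.
by move=> w; rewrite normrM exprS mulrCA ler_pM.
Qed.

Lemma gauss3_ibp1 :
  (forall x y, is_derive x (1 : R) (fun x => u (x, y)) (v (x, y))) ->
  (forall y, continuous (fun x : R => v (x, y))) ->
  (\int[gauss3]_w (w.1 * u w)%:E = \int[gauss3]_w (v w)%:E)%E.
Proof.
move=> duv cv.
apply: (@gauss_ibp_fst _ _ gauss2 u v
  (fun y => C * ((1 + y.1 ^+ 2) * (1 + y.2 ^+ 2)) ^+ N) N) => //.
- by move=> x y; rewrite -mulrA -exprMn [X in X ^+ N]mulrC; exact: uC.
- by move=> x y; rewrite -mulrA -exprMn [X in X ^+ N]mulrC; exact: vC.
- by apply: dom => // w; case: (rho_coord w).
- exact: (gauss3_integrable_dom mv vC).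
Qed.

Lemma gauss3_ibp2 :
  (forall x a b, is_derive a (1 : R) (fun a => u (x, (a, b))) (v (x, (a, b)))) ->
  (forall x b, continuous (fun a : R => v (x, (a, b)))) ->
  (\int[gauss3]_w (w.2.1 * u w)%:E = \int[gauss3]_w (v w)%:E)%E.
Proof.
move=> duv cv.
have iu : gauss3.-integrable setT (fun w => (w.2.1 * u w)%:E).
  apply: dom => //; last by move=> w; case: (rho_coord w).
  by apply: (measurableT_comp measurable_fst); exact: measurable_snd.
have iv := gauss3_integrable_dom mv vC.
have m2 x : measurable_fun [set: MR * MR] (fun w => u (x, w)).
  exact: (measurableT_comp mu).
have m2' x : measurable_fun [set: MR * MR] (fun w => v (x, w)).
  exact: (measurableT_comp mv).
rewrite -[LHS](integral12_prod_meas1 iu) -[RHS](integral12_prod_meas1 iv).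
apply: eq_integral => x _; rewrite /fubini_F /=.
apply: (@gauss_ibp_fst _ _ gam (fun w => u (x, w)) (fun w => v (x, w))
  (fun b => C * (1 + x ^+ 2) ^+ N * (1 + b ^+ 2) ^+ N) N) => //.
- move=> a b; rewrite (le_trans (uC _))// /rho/= -!mulrA -!exprMn.
  by rewrite [X in _ * (_ * X) ^+ N]mulrC.
- move=> a b; rewrite (le_trans (vC _))// /rho/= -!mulrA -!exprMn.
  by rewrite [X in _ * (_ * X) ^+ N]mulrC.
- apply: (@gauss2_integrable_dom _ (C * (1 + x ^+ 2) ^+ N.+1) N.+1).
    by apply: measurable_funM => //; exact: measurable_fst.
  move=> w; have [_ /= h _] := rho_coord (x, w).
  rewrite normrM -mulrA -exprMn exprS mulrCA; exact: ler_pM.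
- apply: (@gauss2_integrable_dom _ (C * (1 + x ^+ 2) ^+ N) N) => //.
  by move=> w; rewrite -mulrA -exprMn; exact: vC (x, w).
Qed.

Lemma gauss3_ibp3 :
  (forall x a b, is_derive b (1 : R) (fun b => u (x, (a, b))) (v (x, (a, b)))) ->
  (forall x a, continuous (fun b : R => v (x, (a, b)))) ->
  (\int[gauss3]_w (w.2.2 * u w)%:E = \int[gauss3]_w (v w)%:E)%E.
Proof.
move=> duv cv.
have iu : gauss3.-integrable setT (fun w => (w.2.2 * u w)%:E).
  apply: dom => //; last by move=> w; case: (rho_coord w).
  by apply: (measurableT_comp measurable_snd); exact: measurable_snd.
have iv := gauss3_integrable_dom mv vC.
have m2 x : measurable_fun [set: MR * MR] (fun w => u (x, w)).
  exact: (measurableT_comp mu).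
have m2' x : measurable_fun [set: MR * MR] (fun w => v (x, w)).
  exact: (measurableT_comp mv).
rewrite -[LHS](integral12_prod_meas1 iu) -[RHS](integral12_prod_meas1 iv).
apply: eq_integral => x _; rewrite /fubini_F /=.
apply: (@gauss_ibp_snd _ _ gam (fun w => u (x, w)) (fun w => v (x, w))
  (fun b => C * (1 + x ^+ 2) ^+ N * (1 + b ^+ 2) ^+ N) N) => //.
- by move=> a b; rewrite (le_trans (uC _))// /rho/= -!mulrA -!exprMn.
- by move=> a b; rewrite (le_trans (vC _))// /rho/= -!mulrA -!exprMn.
- apply: (@gauss2_integrable_dom _ (C * (1 + x ^+ 2) ^+ N.+1) N.+1).
    by apply: measurable_funM => //; exact: measurable_snd.
  move=> w; have [_ _ /= h] := rho_coord (x, w).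
  rewrite normrM -mulrA -exprMn exprS mulrCA; exact: ler_pM.
- apply: (@gauss2_integrable_dom _ (C * (1 + x ^+ 2) ^+ N) N) => //.
  by move=> w; rewrite -mulrA -exprMn; exact: vC (x, w).
Qed.

End ibp3.

End gauss3.

(** * Measurable complex functions *)

Section cmeas.
Context {R : realType} d {T : measurableType d}.
Local Open Scope complex_scope.
Implicit Types (f g : T -> R[i]).

Definition cmeas f := measurable_fun setT (fun w => Re (f w)) /\
  measurable_fun setT (fun w => Im (f w)).

Lemma cmeas_cst z : cmeas (fun=> z). Proof. by []. Qed.

Lemma cmeasD f g : cmeas f -> cmeas g -> cmeas (fun w => f w + g w).
Proof.
move=> [f1 f2] [g1 g2]; split.
  by under eq_fun do rewrite ReD; exact: measurable_funD.
by under eq_fun do rewrite ImD; exact: measurable_funD.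
Qed.

Lemma cmeasN f : cmeas f -> cmeas (fun w => - f w).
Proof.
move=> [f1 f2]; split.
  by under eq_fun do rewrite ReN; exact: measurableT_comp.
by under eq_fun do rewrite ImN; exact: measurableT_comp.
Qed.

Lemma cmeasM f g : cmeas f -> cmeas g -> cmeas (fun w => f w * g w).
Proof.
move=> [f1 f2] [g1 g2]; split.
  by under eq_fun do rewrite ReM; apply: measurable_funB; exact: measurable_funM.
by under eq_fun do rewrite ImM; apply: measurable_funD; exact: measurable_funM.
Qed.

Lemma cmeasJ f : cmeas f -> cmeas (fun w => (f w)^*).
Proof.
move=> [f1 f2]; split; first by under eq_fun do rewrite ReJ.
by under eq_fun do rewrite ImJ; exact: measurableT_comp.
Qed.

Lemma cmeas_real (a : T -> R) : measurable_fun setT a -> cmeas (fun w => (a w)%:C).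
Proof. by move=> ma; split. Qed.

Lemma cmeas_sum (I : Type) (r : seq I) (f : I -> T -> R[i]) :
  (forall i, cmeas (f i)) -> cmeas (fun w => \sum_(i <- r) f i w).
Proof.
move=> mf; elim: r => [|i r IH].
  by under eq_fun do rewrite big_nil; exact: cmeas_cst.
by under eq_fun do rewrite big_cons; exact: cmeasD.
Qed.

Lemma cmeas_prod (I : Type) (r : seq I) (f : I -> T -> R[i]) :
  (forall i, cmeas (f i)) -> cmeas (fun w => \prod_(i <- r) f i w).
Proof.
move=> mf; elim: r => [|i r IH].
  by under eq_fun do rewrite big_nil; exact: cmeas_cst.
by under eq_fun do rewrite big_cons; exact: cmeasM.
Qed.

Lemma cmeas_poly (p : {poly R[i]}) f : cmeas f -> cmeas (fun w => p.[f w]).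
Proof.
move=> mf; elim/poly_ind: p => [|p c IH].
  by under eq_fun do rewrite horner0; exact: cmeas_cst.
under eq_fun do rewrite hornerD hornerM hornerX hornerC.
by apply: cmeasD; [exact: cmeasM|exact: cmeas_cst].
Qed.

Lemma measurable_sqn f : cmeas f -> measurable_fun setT (fun w => sqn (f w)).
Proof.
by move=> [f1 f2]; apply: measurable_funD; exact: measurable_funX.
Qed.

End cmeas.

(** * Hermite polynomials *)

Section hermite.
Context {R : realType}.
Local Open Scope complex_scope.

(** The probabilists' Hermite polynomials. *)
Fixpoint He (k : nat) : {poly R[i]} :=
  if k is k'.+1 then 'X * He k' - (He k')^`() else 1.

Lemma HeS k : He k.+1 = 'X * He k - (He k)^`(). Proof. by []. Qed.

Lemma deriv_He k : (He k.+1)^`() = k.+1%:R *: He k.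
Proof.
elim: k => [|k IH].
  by rewrite HeS derivB derivM derivX derivC deriv0 mulr0 mul1r addr0 subr0 scale1r.
rewrite HeS derivB derivM derivX mul1r IH derivZ HeS -[in RHS]natr1.
rewrite -scalerAr scalerDl scale1r scalerBr.
ring.
Qed.

(** The Hermite polynomials are the eigenfunctions of the Ornstein-Uhlenbeck
generator. Along the path studied below, differentiating the multiplier
e^(- k z) brings down a factor k, which this identity turns into a
differential operator. *)
Lemma He_eigen k : 'X * (He k)^`() - (He k)^`()^`() = k%:R *: He k.
Proof.
case: k => [|k]; first by rewrite derivC deriv0 mulr0 subr0 scale0r.
by rewrite deriv_He derivZ -scalerAr -scalerBr.
Qed.

Lemma poly_growth (p : {poly R[i]}) (K : R) : 0 <= K ->
  exists C, exists N, 0 <= C /\ forall z (r : R), 1 <= r -> normc z <= K * r ->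
    normc p.[z] <= C * r ^+ N.
Proof.
move=> K0; elim/poly_ind: p => [|p c [C [N [C0 IH]]]].
  by exists 0, 0%N; split=> // z r _ _; rewrite horner0 normc0 mul0r.
exists (C * K + normc c), N.+1; split=> [|z r r1 zr].
  by rewrite addr_ge0 ?mulr_ge0 ?normc_ge0.
have r0 : 0 <= r := le_trans ler01 r1.
rewrite hornerD hornerM hornerX hornerC (le_trans (le_normcD _ _))// mulrDl.
apply: lerD.
  by rewrite normcM exprSr mulrACA; apply: ler_pM; rewrite ?normc_ge0// IH.
by rewrite ler_peMr ?normc_ge0// exprn_ege1.
Qed.

End hermite.

(** * A smooth power of the modulus and its complex gradient *)

Section phi_eps.
Context {R : realType}.
Variables (a eps : R).
Hypotheses (a1 : 1 <= a) (a2 : a <= 2) (e0 : 0 < eps) (e1 : eps <= 1).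
Implicit Types (r : R) (z : R[i]) (h : {poly R[i]}).
Local Open Scope complex_scope.

(** A substitute for r^a that is smooth at r = 0; with a = q / 2 and eps = 0
its value at |y|^2 is |y|^q. *)
Definition Fe r := (r + eps) `^ a.
Definition Fe1 r := a * (r + eps) `^ (a - 1).
Definition Fe2 r := a * (a - 1) * (r + eps) `^ (a - 2).

Let re0 r : 0 <= r -> 0 < r + eps.
Proof. by move=> r0; rewrite ltr_wpDl. Qed.

Let is_derive_shift_powR b r : 0 <= r ->
  is_derive r (1 : R) (fun r => (r + eps) `^ b) (b * (r + eps) `^ (b - 1)).
Proof.
move=> r0; have h := is_derive1_powR b (re0 r0).
apply: is_derive_eq.
  apply: (@is_derive1_comp _ (@powR R ^~ b) (fun r => r + eps)).
by rewrite addr0 mulr1.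
Qed.

Lemma is_derive_Fe r : 0 <= r -> is_derive r (1 : R) Fe (Fe1 r).
Proof. exact: is_derive_shift_powR. Qed.

Lemma is_derive_Fe1 r : 0 <= r -> is_derive r (1 : R) Fe1 (Fe2 r).
Proof.
move=> r0; have h := is_derive_shift_powR (a - 1) r0.
have -> : Fe1 = (fun r => a *: (r + eps) `^ (a - 1)) by [].
apply: is_derive_eq.
rewrite scaleRE /Fe2 mulrA; congr (_ * _ `^ _); ring.
Qed.

Lemma is_derive_Fe2 r : 0 <= r ->
  is_derive r (1 : R) Fe2 (a * (a - 1) * ((a - 2) * (r + eps) `^ (a - 2 - 1))).
Proof.
move=> r0; have h := is_derive_shift_powR (a - 2) r0.
have -> : Fe2 = (fun r => (a * (a - 1)) *: (r + eps) `^ (a - 2)) by [].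
exact: is_derive_eq.
Qed.

Lemma Fe_ge0 r : 0 <= Fe r. Proof. exact: powR_ge0. Qed.
Lemma Fe1_ge0 r : 0 <= Fe1 r.
Proof. by rewrite mulr_ge0 ?powR_ge0// (le_trans ler01). Qed.
Lemma Fe2_ge0 r : 0 <= Fe2 r.
Proof. by rewrite !mulr_ge0 ?powR_ge0 ?subr_ge0// (le_trans ler01). Qed.

Lemma Fe_le r : 0 <= r -> Fe r <= (r + 1) ^+ 2.
Proof.
move=> r0; have r1 : 1 <= r + 1 by rewrite lerDr.
apply: (@le_trans _ _ ((r + 1) `^ a)).
  by apply: ge0_ler_powR; rewrite ?nnegrE ?lerD2l ?addr_ge0 ?(ltW e0)// (le_trans ler01).
by rewrite -powR_mulrn ?(le_trans ler01)// ler_powR.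
Qed.

Lemma Fe1_le r : 0 <= r -> Fe1 r <= 2 * (r + 1).
Proof.
move=> r0; have r1 : 1 <= r + 1 by rewrite lerDr.
apply: ler_pM; rewrite ?powR_ge0 ?(le_trans ler01)//.
apply: (@le_trans _ _ ((r + 1) `^ (a - 1))).
  by apply: ge0_ler_powR; rewrite ?nnegrE ?lerD2l ?subr_ge0 ?addr_ge0 ?(ltW e0).
by rewrite -[leRHS]powRr1 ?(le_trans ler01)// ler_powR// lerBlDr.
Qed.

Lemma Fe2_le r : 0 <= r -> Fe2 r <= 2 * eps `^ (a - 2).
Proof.
move=> r0; apply: ler_pM; rewrite ?powR_ge0//.
- by rewrite mulr_ge0 ?subr_ge0 ?(le_trans ler01).
- have : 0 <= (2 - a) * (a + 1) by rewrite mulr_ge0 ?subr_ge0// addr_ge0// (le_trans ler01).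
  by lra.
rewrite -[a - 2]opprB !powRN lef_pV2 ?posrE ?powR_gt0 ?re0//.
by apply: ge0_ler_powR; rewrite ?nnegrE ?subr_ge0 ?(ltW e0) ?lerDr ?addr_ge0// ltW.
Qed.

(** The exponent enters the estimates only through this comparison of the
second derivative of F with the first; it fixes the opening of the region
of multipliers for which contraction holds. *)
Lemma Fe2_Fe1 r : 0 <= r -> Fe2 r * r <= (a - 1) * Fe1 r.
Proof.
move=> r0; rewrite /Fe2 /Fe1 -!mulrA [leRHS]mulrCA ler_wpM2l ?(le_trans ler01)//.
rewrite ler_wpM2l ?subr_ge0//.
have -> : a - 1 = (a - 2) + 1 by ring.
rewrite [leRHS]powRD; last by apply/implyP => _; rewrite gt_eqF// re0.
rewrite powRr1 ?(ltW (re0 r0))// ler_wpM2l ?powR_ge0//.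
by rewrite lerDl ltW.
Qed.

(** Half the gradient of z |-> F(|h z|^2): the derivative in the direction e
is 2 Re (grad_Fe h z * e). *)
Definition grad_Fe h z : R[i] := (Fe1 (sqn h.[z]))%:C * ((h.[z])^* * h^`().[z]).

(** The derivative of [grad_Fe] in the direction e. It is real-linear but not
complex-linear in e, hence e is a parameter. *)
Definition dgrad_Fe h (e : R[i]) z : R[i] :=
  (Fe2 (sqn h.[z]) * (2 * Re ((h.[z])^* * (h^`().[z] * e))))%:C *
    ((h.[z])^* * h^`().[z]) +
  (Fe1 (sqn h.[z]))%:C *
    ((h^`().[z] * e)^* * h^`().[z] + (h.[z])^* * (h^`()^`().[z] * e)).

Let cder_comp_sqn (G : R -> R) g h (k : R -> R[i]) t e :
  is_derive (sqn h.[k t]) (1 : R) G g -> is_cder k t e ->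
  is_cder (fun x => (G (sqn h.[k x]))%:C) t
    (g * (2 * Re ((h.[k t])^* * (h^`().[k t] * e))))%:C.
Proof.
move=> dG ke; apply: is_cder_real.
have h1 := is_derive_sqn (is_cder_poly h ke).
exact: (is_derive1_comp (f := G) (g := fun x => sqn h.[k x])).
Qed.

Lemma is_cder_grad_Fe h (k : R -> R[i]) t e : is_cder k t e ->
  is_cder (fun x => grad_Fe h (k x)) t (dgrad_Fe h e (k t)).
Proof.
move=> ke; have s0 : 0 <= sqn h.[k t] by exact: sqn_ge0.
apply: is_cder_eq.
  apply: is_cderM; first exact: (cder_comp_sqn (is_derive_Fe1 s0) ke).
  apply: is_cderM; last exact: is_cder_poly ke.
  by apply: is_cderJ; exact: is_cder_poly ke.
by [].
Qed.

Lemma is_cder_dgrad_Fe h e (k : R -> R[i]) t e' : is_cder k t e' ->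
  exists d, is_cder (fun x => dgrad_Fe h e (k x)) t d.
Proof.
move=> ke; have s0 : 0 <= sqn h.[k t] by exact: sqn_ge0.
have h0 := is_cder_poly h ke.
have h1 := is_cder_poly h^`() ke.
have h2 := is_cder_poly h^`()^`() ke.
have he := is_cder_cst e t.
have hJ := is_cderJ h0.
eexists; apply: is_cderD; apply: is_cderM.
- have F2 := proj1 (cder_comp_sqn (is_derive_Fe2 s0) ke).
  have hr := is_deriveZ 2 (proj1 (is_cderM hJ (is_cderM h1 he))).
  exact: is_cder_real (is_deriveM F2 hr).
- exact: is_cderM hJ h1.
- exact: (cder_comp_sqn (is_derive_Fe1 s0) ke).
- apply: is_cderD; first exact: is_cderM (is_cderJ (is_cderM h1 he)) h1.
  exact: is_cderM hJ (is_cderM h2 he).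
Qed.

End phi_eps.

(** * Gaussian integration by parts for the complex gradient *)

Section flow.
Context {R : realType}.
Local Open Scope complex_scope.
Local Notation MR := (measurableTypeR R).

Section growth.
Variable K : R.
Hypothesis K0 : 0 <= K.

(** Polynomial growth. The majorant r of |z| / K is kept as a variable, since
it will be the weight [rho] of a random point. *)
Definition cgrowth (f : R[i] -> R[i]) := exists C, exists N, 0 <= C /\
  forall z (r : R), 1 <= r -> normc z <= K * r -> normc (f z) <= C * r ^+ N.

Lemma cgrowth_poly (p : {poly R[i]}) : cgrowth (horner p).
Proof. exact: poly_growth. Qed.

Lemma cgrowth_cst e : cgrowth (fun=> e).
Proof.
by exists (normc e), 0%N; split=> [|z r _ _]; rewrite ?normc_ge0// expr0 mulr1.
Qed.

Lemma cgrowthD f g : cgrowth f -> cgrowth g -> cgrowth (fun z => f z + g z).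
Proof.
move=> [C [N [C0 fC]]] [D [M [D0 gD]]]; exists (C + D), (N + M)%N.
split=> [|z r r1 zr]; first exact: addr_ge0.
rewrite (le_trans (le_normcD _ _))// mulrDl lerD//.
  by rewrite (le_trans (fC _ _ r1 zr))// ler_wpM2l// ler_weXn2l// leq_addr.
by rewrite (le_trans (gD _ _ r1 zr))// ler_wpM2l// ler_weXn2l// leq_addl.
Qed.

Lemma cgrowthM f g : cgrowth f -> cgrowth g -> cgrowth (fun z => f z * g z).
Proof.
move=> [C [N [C0 fC]]] [D [M [D0 gD]]]; exists (C * D), (N + M)%N.
split=> [|z r r1 zr]; first exact: mulr_ge0.
by rewrite normcM exprD mulrACA ler_pM ?normc_ge0 ?fC ?gD.
Qed.

Lemma cgrowthJ f : cgrowth f -> cgrowth (fun z => (f z)^*).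
Proof. by move=> [C [N [C0 fC]]]; exists C, N; split=> // z r *; rewrite normcJ fC. Qed.

Lemma cgrowth_Re f : cgrowth f -> cgrowth (fun z => (Re (f z))%:C).
Proof.
move=> [C [N [C0 fC]]]; exists C, N; split=> // z r r1 zr.
by rewrite normcC (le_trans (ler_Re_normc _))// fC.
Qed.

Lemma cgrowth_le f g : cgrowth g -> (forall z, normc (f z) <= normc (g z)) -> cgrowth f.
Proof.
move=> [C [N [C0 gC]]] fg; exists C, N; split=> // z r r1 zr.
by rewrite (le_trans (fg _))// gC.
Qed.

End growth.

(** The point X + s (Y' + i Y): a real Gaussian perturbed by a complex one. *)
Definition Wz (s : R) (w : MR * (MR * MR)) : R[i] :=
  (w.1 + s * w.2.1) +i* (s * w.2.2).

Lemma normc_Wz s w : normc (Wz s w) <= (1 + 2 * `|s|) * rho w.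
Proof.
have [h1 h2 h3] := rho_coord w.
rewrite (le_trans (normc_le_reim _))//= (le_trans (lerD (ler_normD _ _) (lexx _)))//.
rewrite !normrM mulrDl mul1r -addrA lerD// (_ : 2 * `|s| * rho w = `|s| * rho w + `|s| * rho w); last by ring.
by rewrite lerD// ler_wpM2l.
Qed.

Lemma cmeas_Wz s : cmeas (Wz s).
Proof.
have m1 : measurable_fun setT (fun w : MR * (MR * MR) => w.2.1).
  by apply: (measurableT_comp measurable_fst); exact: measurable_snd.
have m2 : measurable_fun setT (fun w : MR * (MR * MR) => w.2.2).
  by apply: (measurableT_comp measurable_snd); exact: measurable_snd.
split => /=; last exact: measurable_funM.
by apply: measurable_funD => //; exact: measurable_funM.
Qed.

Section fixed_poly.
Variables (a eps : R).
Hypotheses (a1 : 1 <= a) (a2 : a <= 2) (e0 : 0 < eps) (e1 : eps <= 1).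
Variable (h : {poly R[i]}).
Variable (s : R).
Notation grad_Fe := (grad_Fe a eps).
Notation dgrad_Fe := (dgrad_Fe a eps).
Let K := 1 + 2 * `|s|.
Let K0 : 0 <= K. Proof. by rewrite addr_ge0 ?mulr_ge0. Qed.

Lemma cgrowth_sqn (p : {poly R[i]}) : cgrowth K (fun z => (sqn p.[z])%:C).
Proof.
apply: (@cgrowth_le _ _ (fun z => p.[z] * (p.[z])^*)).
  by apply: cgrowthM; [exact: cgrowth_poly|apply: cgrowthJ; exact: cgrowth_poly].
by move=> z; rewrite normcM normcJ normcC -expr2 normc_sqr ger0_norm ?sqn_ge0.
Qed.

Lemma cgrowth_Fe1 : cgrowth K (fun z => (Fe1 a eps (sqn h.[z]))%:C).
Proof.
apply: (@cgrowth_le _ _ (fun z => (2%:C * ((sqn h.[z])%:C + 1%:C)))).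
  apply: cgrowthM; first exact: cgrowth_cst.
  by apply: cgrowthD; [exact: cgrowth_sqn|exact: cgrowth_cst].
move=> z; rewrite -rmorphD -rmorphM !normcC ger0_norm ?Fe1_ge0//.
by rewrite (le_trans _ (ler_norm _))// Fe1_le// sqn_ge0.
Qed.

Lemma cgrowth_Fe2 : cgrowth K (fun z => (Fe2 a eps (sqn h.[z]))%:C).
Proof.
apply: (@cgrowth_le _ _ (fun z => (2 * eps `^ (a - 2))%:C)).
  exact: cgrowth_cst.
move=> z; rewrite !normcC ger0_norm ?Fe2_ge0//.
by rewrite (le_trans _ (ler_norm _))// Fe2_le// sqn_ge0.
Qed.

Lemma cgrowth_grad_Fe : cgrowth K (grad_Fe h).
Proof.
apply: cgrowthM; first exact: cgrowth_Fe1.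
by apply: cgrowthM; [apply: cgrowthJ|]; exact: cgrowth_poly.
Qed.

Lemma cgrowth_dgrad_Fe e : cgrowth K (dgrad_Fe h e).
Proof.
have gh := cgrowth_poly K0 h.
have gh1 := cgrowth_poly K0 h^`().
have gh2 := cgrowth_poly K0 h^`()^`().
have ge := cgrowth_cst K e.
apply: cgrowthD.
  apply: cgrowthM.
    have -> : (fun z => (Fe2 a eps (sqn h.[z]) * (2 * Re ((h.[z])^* * (h^`().[z] * e))))%:C)
      = (fun z => (Fe2 a eps (sqn h.[z]))%:C * (2%:C * (Re ((h.[z])^* * (h^`().[z] * e)))%:C)).
      by apply/funext => z; rewrite !rmorphM.
    apply: cgrowthM; first exact: cgrowth_Fe2.
    apply: cgrowthM; first exact: cgrowth_cst.
    apply: cgrowth_Re; apply: cgrowthM; first exact: cgrowthJ.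
    exact: cgrowthM.
  by apply: cgrowthM => //; exact: cgrowthJ.
apply: cgrowthM; first exact: cgrowth_Fe1.
apply: cgrowthD.
  by apply: cgrowthM => //; apply: cgrowthJ; exact: cgrowthM.
by apply: cgrowthM; [exact: cgrowthJ|exact: cgrowthM].
Qed.

Lemma measurable_Fe b : measurable_fun setT (fun r : R => (r + eps) `^ b).
Proof.
apply: (measurableT_comp (measurable_powR b)) => //.
by apply: measurable_funD.
Qed.

Lemma cmeas_grad_Fe : cmeas (fun w => grad_Fe h (Wz s w)).
Proof.
have mh := cmeas_poly h (cmeas_Wz s).
have mh1 := cmeas_poly h^`() (cmeas_Wz s).
apply: cmeasM; last by apply: cmeasM => //; exact: cmeasJ.
apply: cmeas_real; apply: measurable_funM => //.
apply: (measurableT_comp (measurable_Fe (a - 1))).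
exact: measurable_sqn.
Qed.

Lemma cmeas_dgrad_Fe e : cmeas (fun w => dgrad_Fe h e (Wz s w)).
Proof.
have mh := cmeas_poly h (cmeas_Wz s).
have mh1 := cmeas_poly h^`() (cmeas_Wz s).
have mh2 := cmeas_poly h^`()^`() (cmeas_Wz s).
have me := @cmeas_cst _ _ (MR * (MR * MR))%type e.
have mJ := cmeasJ mh.
apply: cmeasD; apply: cmeasM.
- apply: cmeas_real; apply: measurable_funM.
    apply: measurable_funM => //.
    by apply: (measurableT_comp (measurable_Fe (a - 2))); exact: measurable_sqn.
  apply: measurable_funM => //.
  by have [] := cmeasM mJ (cmeasM mh1 me).
- exact: cmeasM.
- apply: cmeas_real; apply: measurable_funM => //.
  by apply: (measurableT_comp (measurable_Fe (a - 1))); exact: measurable_sqn.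
- exact: cmeasD (cmeasM (cmeasJ (cmeasM mh1 me)) mh1) (cmeasM mJ (cmeasM mh2 me)).
Qed.

Section ibp.
Variable al : R[i].
Let u (w : MR * (MR * MR)) := Re (al * grad_Fe h (Wz s w)).
Let v e (w : MR * (MR * MR)) := Re (al * dgrad_Fe h e (Wz s w)).

Let mu : measurable_fun setT u.
Proof. by have [] := cmeasM (cmeas_cst al) cmeas_grad_Fe. Qed.

Let mv e : measurable_fun setT (v e).
Proof. by have [] := cmeasM (cmeas_cst al) (cmeas_dgrad_Fe e). Qed.

Let bounds e : exists C, exists N, (forall w, `|u w| <= C * rho w ^+ N) /\
  (forall w, `|v e w| <= C * rho w ^+ N).
Proof.
have [C [N [C0 hC]]] := cgrowthM (cgrowth_cst K al) cgrowth_grad_Fe.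
have [D [M [D0 hD]]] := cgrowthM (cgrowth_cst K al) (cgrowth_dgrad_Fe e).
have le k l w : (k <= l)%N -> rho w ^+ k <= rho w ^+ l.
  by move=> kl; rewrite ler_weXn2l// rho_ge1.
exists (C + D), (N + M)%N; split=> w; rewrite (le_trans (ler_Re_normc _))//.
  rewrite (le_trans (hC _ _ (rho_ge1 w) (normc_Wz s w)))//.
  rewrite ler_pM// ?lerDl// ?exprn_ge0 ?(le_trans ler01 (rho_ge1 w))//.
  by rewrite le// leq_addr.
rewrite (le_trans (hD _ _ (rho_ge1 w) (normc_Wz s w)))//.
rewrite ler_pM// ?lerDr// ?exprn_ge0 ?(le_trans ler01 (rho_ge1 w))//.
by rewrite le// leq_addl.
Qed.

Let line e (k : R -> R[i]) t : is_cder k t e ->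
  is_derive t (1 : R) (fun x => Re (al * grad_Fe h (k x))) (Re (al * dgrad_Fe h e (k t))).
Proof.
move=> ke; have [+ _] := is_cderM (is_cder_cst al t) (is_cder_grad_Fe a e0 h ke).
by rewrite mul0r add0r.
Qed.

Let cline e e' (k : R -> R[i]) : (forall t, is_cder k t e') ->
  continuous (fun x => Re (al * dgrad_Fe h e (k x))).
Proof.
move=> ke t; have [d hd] := is_cder_dgrad_Fe a e0 h e (ke t).
have [[hh _] _] := is_cderM (is_cder_cst al t) hd.
by apply: differentiable_continuous; apply/derivable1_diffP.
Qed.

Let cW1 y t : is_cder (fun x => Wz s (x, y)) t 1.
Proof.
split; rewrite /Wz /=.
  by apply: is_derive_eq; rewrite addr0.
exact: is_derive_cst.
Qed.

Let cW2 x b t : is_cder (fun a => Wz s (x, (a, b))) t s%:C.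
Proof.
split; rewrite /Wz /=; last exact: is_derive_cst.
by apply: is_derive_eq; rewrite !scaleRE; ring.
Qed.

Let cW3 x c t : is_cder (fun b => Wz s (x, (c, b))) t (0 +i* s).
Proof.
split; rewrite /Wz /=; first exact: is_derive_cst.
apply: is_derive_eq; rewrite !scaleRE; ring.
Qed.

Lemma grad_Fe_ibp1 : (\int[gauss3]_w (w.1 * u w)%:E = \int[gauss3]_w (v 1 w)%:E)%E.
Proof.
have [C [N [uC vC]]] := bounds 1.
apply: (gauss3_ibp1 mu (mv 1) uC vC) => [x y|y].
  exact: line.
exact: cline.
Qed.

Lemma grad_Fe_ibp2 :
  (\int[gauss3]_w (w.2.1 * u w)%:E = \int[gauss3]_w (v s%:C w)%:E)%E.
Proof.
have [C [N [uC vC]]] := bounds s%:C.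
apply: (gauss3_ibp2 mu (mv s%:C) uC vC) => [x y b|x b].
  exact: line.
exact: cline.
Qed.

Lemma grad_Fe_ibp3 :
  (\int[gauss3]_w (w.2.2 * u w)%:E = \int[gauss3]_w (v (0 +i* s) w)%:E)%E.
Proof.
have [C [N [uC vC]]] := bounds (0 +i* s).
apply: (gauss3_ibp3 mu (mv (0 +i* s)) uC vC) => [x y b|x b].
  exact: line.
exact: cline.
Qed.

End ibp.

End fixed_poly.
End flow.

(** * The path joining a Hermite sum to its multiplier transform *)

Section flow_ineq.
Context {R : realType}.
Local Open Scope complex_scope.
Local Notation MR := (measurableTypeR R).
Variables (a eps : R).
Hypotheses (a1 : 1 <= a) (a2 : a <= 2) (e0 : 0 < eps) (e1 : eps <= 1).

Lemma dgrad_FeE (h : {poly R[i]}) e Z : dgrad_Fe a eps h e Z =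
  (2 * Fe2 a eps (sqn h.[Z]) * Re ((h.[Z])^* * h^`().[Z] * e))%:C * ((h.[Z])^* * h^`().[Z]) +
  (Fe1 a eps (sqn h.[Z]))%:C * (e^* * (sqn h^`().[Z])%:C + (h.[Z])^* * h^`()^`().[Z] * e).
Proof.
rewrite /dgrad_Fe !(mulrA (h.[Z])^*) [2 * Fe2 _ _ _]mulrC -(mulrA _ 2).
congr (_ + _ * (_ + _)); rewrite rmorphM /= mulrAC mulrC; congr (_ * _).
by case: (h^`().[Z]) => x y; apply: reim_eq; rewrite !reimE /sqn /=; ring.
Qed.

(** Here A is conj h * h', B is conj h * h'', f1 and f2 are the derivatives
of F, and G = |h'|^2. The terms that contain the second derivative B of h
cancel, which is the reason for the choice of the path. *)
Lemma flow_algebra (A B z : R[i]) (f1 f2 G s t : R) :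
  let D e := (2 * f2 * Re (A * e))%:C * A + f1%:C * (e^* * G%:C + B * e) in
  let Q := f2 * sqn A + f1 * G in
  Re ((- 2 * t)%:C * z * D 1) +
  Re ((s%:C - (2 * t ^+ 2 * s)%:C * z) * D (t * s)%:C) +
  Re ('i * (s%:C - (2 * t ^+ 2 * s)%:C * z) * D (0 +i* (t * s))) +
  2 * t * f1 * Re (z * B) =
  2 * t * (f2 * Re (- (z * A ^+ 2)) - Re z * Q + s ^+ 2 * Q
   - 2 * t ^+ 2 * s ^+ 2 * (Re z * Q)).
Proof.
case: A B z => x y [u v] [z1 z2] /=.
rewrite /sqn /=; ring.
Qed.

(** After integration by parts, the left-hand side is the integrand of the
time derivative of the expectation of F(|h_t(W_t)|^2). In the
form given by [flow_algebra] it is 2 t times Re (- z A^2) F'' - (Re z - s^2) Q,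
up to a nonpositive term, where Q = F'' |A|^2 + F' |h'|^2. Now [Fe2_Fe1] yields
F'' |A|^2 <= ((a - 1) / a) Q, and the hypothesis on z gives the sign. *)
Lemma flow_pointwise (h : {poly R[i]}) (z Z : R[i]) (s t : R) :
  0 <= t -> a * s ^+ 2 + (a - 1) * normc z <= a * Re z ->
  Re ((- 2 * t)%:C * z * dgrad_Fe a eps h 1 Z) +
  Re ((s%:C - (2 * t ^+ 2 * s)%:C * z) * dgrad_Fe a eps h (t * s)%:C Z) +
  Re ('i * (s%:C - (2 * t ^+ 2 * s)%:C * z) * dgrad_Fe a eps h (0 +i* (t * s)) Z) +
  2 * t * Fe1 a eps (sqn h.[Z]) * Re (z * ((h.[Z])^* * h^`()^`().[Z])) <= 0.
Proof.
move=> t0 hz; rewrite !dgrad_FeE.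
set f2 := Fe2 a eps (sqn h.[Z]); set f1 := Fe1 a eps (sqn h.[Z]).
have r0 := sqn_ge0 h.[Z].
have f10 : 0 <= f1 by exact: Fe1_ge0.
have f20 : 0 <= f2 by exact: Fe2_ge0.
have f21 : f2 * sqn h.[Z] <= (a - 1) * f1 by exact: Fe2_Fe1.
set A := (h.[Z])^* * h^`().[Z].
set G := sqn h^`().[Z].
rewrite (flow_algebra A _ z f1 f2 G s t).
have G0 : 0 <= G by exact: sqn_ge0.
have sA : sqn A = sqn h.[Z] * G by rewrite sqnM {1}/sqn ReJ ImJ sqrrN.
set Q := f2 * sqn A + f1 * G.
have key : Re (- (z * A ^+ 2)) <= normc z * sqn A.
  have -> : normc z * sqn A = normc (- (z * A ^+ 2)).
    by rewrite normcN normcM normc_X normc_sqr.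
  by rewrite (le_trans (ler_norm _))// ler_Re_normc.
have Q0 : 0 <= Q by apply: addr_ge0; apply: mulr_ge0 => //; exact: sqn_ge0.
have a0 : 0 < a := lt_le_trans ltr01 a1.
have z0 : 0 <= Re z.
  have : 0 <= a * Re z.
    by rewrite (le_trans _ hz)// addr_ge0// mulr_ge0 ?sqr_ge0 ?subr_ge0 ?normc_ge0 ?(ltW a0).
  by rewrite pmulr_rge0.
rewrite mulr_ge0_le0 ?mulr_ge0//.
have h3 : 0 <= 2 * t ^+ 2 * s ^+ 2 * (Re z * Q) by rewrite (mulr_ge0 _ (mulr_ge0 z0 Q0))// mulr_ge0 ?sqr_ge0// mulr_ge0 ?sqr_ge0.
have h1 : f2 * Re (- (z * A ^+ 2)) <= normc z * (f2 * sqn A).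
  by rewrite [leRHS]mulrCA ler_wpM2l.
have h2 : a * (f2 * sqn A) <= (a - 1) * Q.
  rewrite /Q sA; have := ler_wpM2r G0 f21; nra.
have h4 := ler_wpM2l (normc_ge0 z) h2.
have h5 := ler_wpM2r Q0 hz.
rewrite -(pmulr_rle0 _ a0).
have h6 := ler_wpM2l (ltW a0) h1; have h7 := mulr_ge0 (ltW a0) h3.
lra.
Qed.

Lemma deriv_sum (I : Type) (r : seq I) (F : I -> {poly R[i]}) :
  (\sum_(i <- r) F i)^`() = \sum_(i <- r) (F i)^`().
Proof. by apply: (big_morph _ (@derivD _)); exact: deriv0. Qed.

Section path.
Variables (z : R[i]) (s : R) (K : nat) (c : nat -> R[i]).

(** The path multiplies H_k by e^(- k z t^2) and evaluates at X + t s zeta. It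
runs from the real Hermite sum at t = 0 to its multiplier transform at t = 1.
The multiplier must be quadratic in t to match the variance t^2 s^2 of the
added Gaussian. *)
Definition pcoef (k : nat) (t : R) : R[i] := c k * cexp (- (k%:R * z) * (t ^+ 2)%:C).

Definition hpath (t : R) : {poly R[i]} := \sum_(k < K) pcoef k t *: He k.

Lemma is_cder_pcoef k t :
  is_cder (pcoef k) t ((- 2 * t)%:C * z * (k%:R * pcoef k t)).
Proof.
have d2 : is_derive t (1 : R) (fun t : R => t ^+ 2) (2 * t).
  by apply: is_derive_eq; rewrite !scaleRE; ring.
have h1 := is_cderM (is_cder_cst (- (k%:R * z)) t) (is_cder_real d2).
have h2 := is_cderM (is_cder_cst (c k) t) (is_cder_cexp h1).
apply: is_cder_eq; first exact: h2.
rewrite /pcoef mul0r !add0r mulNr rmorphM /= rmorphN /=; ring.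
Qed.

Lemma hpath_eigen t Z : Z * (hpath t)^`().[Z] - (hpath t)^`()^`().[Z] =
  \sum_(k < K) (k%:R * pcoef k t) * (He k).[Z].
Proof.
rewrite -[X in X * _](hornerX Z) -hornerM -hornerN -hornerD.
rewrite /hpath !deriv_sum mulr_sumr -sumrB horner_sum; apply: eq_bigr => k _.
rewrite !derivZ -scalerAr -scalerBr He_eigen scalerA hornerZ; congr (_ * _).
exact: mulrC.
Qed.

Definition kpath (w : MR * (MR * MR)) (t : R) : R[i] := (hpath t).[Wz (t * s) w].

Definition dkpath (w : MR * (MR * MR)) (t : R) : R[i] :=
  let Z := Wz (t * s) w in
  (- 2 * t)%:C * z * (Z * (hpath t)^`().[Z] - (hpath t)^`()^`().[Z]) +
  (hpath t)^`().[Z] * ((s * w.2.1) +i* (s * w.2.2)).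

Lemma is_cder_Wz w t : is_cder (fun t => Wz (t * s) w) t ((s * w.2.1) +i* (s * w.2.2)).
Proof.
split; rewrite /Wz /=; apply: is_derive_eq; rewrite !scaleRE; ring.
Qed.

Lemma is_cder_kpath w t : is_cder (kpath w) t (dkpath w t).
Proof.
have -> : kpath w = (fun t => \sum_(k < K) pcoef k t * (He k).[Wz (t * s) w]).
  apply/funext => x; rewrite /kpath /hpath horner_sum.
  by apply: eq_bigr => k _; rewrite hornerZ.
apply: is_cder_eq.
  apply: is_cder_sum => k; apply: is_cderM; first exact: is_cder_pcoef.
  by apply: is_cder_poly; exact: is_cder_Wz.
rewrite /dkpath hpath_eigen big_split mulr_sumr /=; congr (_ + _).
  by apply: eq_bigr => k _; rewrite !mulrA.
rewrite /hpath deriv_sum horner_sum mulr_suml; apply: eq_bigr => k _.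
by rewrite derivZ hornerZ mulrA.
Qed.

Lemma hpath_growth (D : {poly R[i]} -> {poly R[i]}) :
  (forall t, D (hpath t) = \sum_(k < K) pcoef k t *: D (He k)) -> 0 <= Re z ->
  exists C, exists N, 0 <= C /\ forall w t, -1 <= t <= 2 ->
    normc (D (hpath t)).[Wz (t * s) w] <= C * rho w ^+ N.
Proof.
move=> DE z0; pose B := 1 + 4 * `|s|.
have B0 : 0 <= B by rewrite addr_ge0 ?mulr_ge0.
have [f hf] : exists f : nat -> R * nat, forall k,
    0 <= (f k).1 /\ forall Z r, 1 <= r -> normc Z <= B * r -> normc (D (He k)).[Z] <= (f k).1 * r ^+ (f k).2.
  have /choice[f hf] : forall k, exists CN : R * nat,
    0 <= CN.1 /\ forall Z r, 1 <= r -> normc Z <= B * r -> normc (D (He k)).[Z] <= CN.1 * r ^+ CN.2.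
    by move=> k; have [C [N ?]] := poly_growth (D (He k)) B0; exists (C, N).
  by exists f.
exists (\sum_(k < K) normc (c k) * (f k).1), (\sum_(k < K) (f k).2)%N.
split=> [|w t /andP[t1 t2]].
  by apply: sumr_ge0 => k _; rewrite mulr_ge0 ?normc_ge0//; case: (hf k).
have tabs : `|t| <= 2 by rewrite ler_norml t2 andbT (le_trans _ t1)// lerN2 ler1n.
rewrite DE horner_sum (le_trans (normc_sum _ _ _))// mulr_suml.
apply: ler_sum => k _; rewrite hornerZ normcM.
have [f0 hfk] := hf k.
apply: (@le_trans _ _ (normc (c k) * ((f k).1 * rho w ^+ (f k).2))).
  apply: ler_pM; rewrite ?normc_ge0//.
    rewrite /pcoef normcM normc_cexp ler_piMr ?normc_ge0// expR_le1.
    rewrite !reimE !mulr0 subr0 mulNr oppr_le0 mulr_ge0 ?sqr_ge0//.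
    have -> : (k%:R : R[i]) = (k%:R)%:C by rewrite rmorph_nat.
    by rewrite !reimE mul0r subr0 mulr_ge0.
  apply: hfk; first exact: rho_ge1.
  rewrite (le_trans (normc_Wz _ _))// ler_wpM2r ?(le_trans ler01 (rho_ge1 w))//.
  rewrite /B lerD2l normrM mulrA ler_wpM2r//.
  by rewrite (_ : 4 = 2 * 2) ?ler_pM2l//; ring.
rewrite -mulrA ler_wpM2l ?normc_ge0// ler_wpM2l//.
by rewrite ler_weXn2l ?rho_ge1// (bigD1 k)//= leq_addr.
Qed.

End path.

End flow_ineq.

(** * Monotonicity along the path *)

Section real_in_complex.
Context {R : realType}.
Local Open Scope complex_scope.

Lemma rcD (x y : R) : x%:C + y%:C = (x + y)%:C. Proof. by rewrite rmorphD. Qed.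
Lemma rcM (x y : R) : x%:C * y%:C = (x * y)%:C. Proof. by rewrite rmorphM. Qed.

Lemma ReCM (x : R) (w : R[i]) : Re (x%:C * w) = x * Re w.
Proof. by case: w => a b /=; rewrite mul0r subr0. Qed.

End real_in_complex.

Section flow_mono.
Context {R : realType}.
Local Open Scope complex_scope.
Local Notation MR := (measurableTypeR R).
Local Notation Om := (MR * (MR * MR))%type.

(** Growth in w, uniform for the times in A: the domination needed to
differentiate under the integral sign. *)
Definition ugrowth (A : set R) (g : Om -> R -> R[i]) := exists C, exists N, 0 <= C /\
  forall w t, A t -> normc (g w t) <= C * rho w ^+ N.

Section ugrowth_lemmas.
Variable A : set R.
Notation ugrowth := (ugrowth A).

Lemma ugrowth_cst e : ugrowth (fun _ _ => e).
Proof.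
by exists (normc e), 0%N; split=> [|w t _]; rewrite ?normc_ge0// expr0 mulr1.
Qed.

Lemma ugrowth_time (B : R) (f : R -> R[i]) : (forall t, A t -> normc (f t) <= B) ->
  ugrowth (fun _ t => f t).
Proof.
move=> fB; exists `|B|, 0%N; split=> // w t At.
by rewrite expr0 mulr1 (le_trans (fB t At))// ler_norm.
Qed.

Lemma ugrowthD f g : ugrowth f -> ugrowth g -> ugrowth (fun w t => f w t + g w t).
Proof.
move=> [C [N [C0 fC]]] [D [M [D0 gD]]]; exists (C + D), (N + M)%N.
split=> [|w t At]; first exact: addr_ge0.
rewrite (le_trans (le_normcD _ _))// mulrDl lerD//.
  by rewrite (le_trans (fC _ _ At))// ler_wpM2l// ler_weXn2l ?rho_ge1// leq_addr.
by rewrite (le_trans (gD _ _ At))// ler_wpM2l// ler_weXn2l ?rho_ge1// leq_addl.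
Qed.

Lemma ugrowthM f g : ugrowth f -> ugrowth g -> ugrowth (fun w t => f w t * g w t).
Proof.
move=> [C [N [C0 fC]]] [D [M [D0 gD]]]; exists (C * D), (N + M)%N.
split=> [|w t At]; first exact: mulr_ge0.
by rewrite normcM exprD mulrACA ler_pM ?normc_ge0 ?fC ?gD.
Qed.

Lemma ugrowth_le f g : ugrowth g ->
  (forall w t, A t -> normc (f w t) <= normc (g w t)) -> ugrowth f.
Proof.
move=> [C [N [C0 gC]]] fg; exists C, N; split=> // w t At.
by rewrite (le_trans (fg _ _ At))// gC.
Qed.

Lemma ugrowthN f : ugrowth f -> ugrowth (fun w t => - f w t).
Proof. by move=> gf; apply: ugrowth_le gf _ => w t _; rewrite normcN. Qed.

Lemma ugrowthJ f : ugrowth f -> ugrowth (fun w t => (f w t)^*).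
Proof. by move=> gf; apply: ugrowth_le gf _ => w t _; rewrite normcJ. Qed.

Lemma ugrowth_Re f : ugrowth f -> ugrowth (fun w t => (Re (f w t))%:C).
Proof. by move=> gf; apply: ugrowth_le gf _ => w t _; rewrite normcC ler_Re_normc. Qed.

Lemma ugrowth_sqn f : ugrowth f -> ugrowth (fun w t => (sqn (f w t))%:C).
Proof.
move=> gf; apply: ugrowth_le (ugrowthM gf gf) _ => w t _.
by rewrite normcC normcM -expr2 normc_sqr ger0_norm ?sqn_ge0.
Qed.

Lemma ugrowth_coord :
  [/\ ugrowth (fun w _ => (w.1)%:C), ugrowth (fun w _ => (w.2.1)%:C)
    & ugrowth (fun w _ => (w.2.2)%:C)].
Proof.
by split; exists 1, 1%N; split=> // w t _; rewrite expr1 mul1r normcC;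
  case: (rho_coord w).
Qed.

Lemma ugrowth_Wz (B s : R) : (forall t, A t -> `|t| <= B) ->
  ugrowth (fun w t => Wz (t * s) w).
Proof.
move=> tB; have [g1 g2 g3] := ugrowth_coord.
have gt : ugrowth (fun _ t => (t * s)%:C).
  apply: (ugrowth_time (B := B * `|s|)) => t At.
  by rewrite normcC normrM ler_wpM2r// tB.
apply: ugrowth_le (ugrowthD g1 (ugrowthM gt (ugrowthD g2 (ugrowthM (ugrowth_cst 'i) g3)))) _.
move=> w t _; rewrite le_eqVlt; apply/orP; left; apply/eqP; congr normc.
by apply: reim_eq; rewrite /Wz /=; ring.
Qed.

Lemma ugrowth_integrable f t : A t -> ugrowth f -> cmeas (f ^~ t) ->
  gauss3.-integrable setT (fun w => (Re (f w t))%:E).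
Proof.
move=> At [C [N [C0 fC]]] [mf _].
apply: (gauss3_integrable_dom mf (C := C) (N := N)) => w.
by rewrite (le_trans (ler_Re_normc _))// fC.
Qed.

Lemma ugrowth_cgrowth S f : cgrowth (1 + 2 * `|S|) f ->
  ugrowth (fun w _ => f (Wz S w)).
Proof.
by move=> [C [N [C0 fC]]]; exists C, N; split=> // w t _; rewrite fC ?rho_ge1// normc_Wz.
Qed.

End ugrowth_lemmas.

Variables (a eps : R).
Hypotheses (a1 : 1 <= a) (a2 : a <= 2) (e0 : 0 < eps) (e1 : eps <= 1).
Variables (z : R[i]) (s : R) (K : nat) (c : nat -> R[i]).
Hypothesis hz : a * s ^+ 2 + (a - 1) * normc z <= a * Re z.

Notation hpath := (hpath z K c).
Notation kpath := (kpath z s K c).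
Notation dkpath := (dkpath z s K c).
(* Differentiation under the integral takes place on an open neighbourhood of
   [0, 1]. *)
Let A : set R := [set t | -1 <= t <= 2].

Let z0 : 0 <= Re z.
Proof.
have a0 : 0 < a := lt_le_trans ltr01 a1.
have : 0 <= a * Re z.
  by rewrite (le_trans _ hz)// addr_ge0// mulr_ge0 ?sqr_ge0 ?subr_ge0 ?normc_ge0 ?(ltW a0).
by rewrite pmulr_rge0.
Qed.

Let tA t : A t -> `|t| <= 2.
Proof. by move=> /andP[t1 t2]; rewrite ler_norml t2 andbT (le_trans _ t1)// lerN2 ler1n. Qed.

Let gh : ugrowth A (fun w t => (hpath t).[Wz (t * s) w]).
Proof. exact: (hpath_growth s (D := id) _ z0). Qed.

Let gh1 : ugrowth A (fun w t => (hpath t)^`().[Wz (t * s) w]).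
Proof.
apply: (hpath_growth s (D := @deriv _) _ z0) => t.
by rewrite deriv_sum; apply: eq_bigr => k _; rewrite derivZ.
Qed.

Let gh2 : ugrowth A (fun w t => (hpath t)^`()^`().[Wz (t * s) w]).
Proof.
apply: (hpath_growth s (D := fun p => p^`()^`()) _ z0) => t.
by rewrite !deriv_sum; apply: eq_bigr => k _; rewrite !derivZ.
Qed.

Let gW : ugrowth A (fun w t => Wz (t * s) w) := ugrowth_Wz s tA.

Let gk : ugrowth A kpath := gh.

Let gdk : ugrowth A dkpath.
Proof.
have [g1 g2 g3] := ugrowth_coord A.
have gt : ugrowth A (fun _ t => (- 2 * t)%:C * z).
  apply: (ugrowth_time (B := 4 * normc z)) => t At.
  rewrite normcM normcC ler_wpM2r ?normc_ge0// normrM normrN (ger0_norm (ler0n _ 2)).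
  by have := tA At; lra.
apply: ugrowthD.
  apply: ugrowthM gt _; apply: ugrowthD; first exact: ugrowthM.
  exact: ugrowthN.
apply: ugrowthM; first exact: gh1.
apply: ugrowth_le (ugrowthM (ugrowth_cst A s%:C) (ugrowthD g2 (ugrowthM (ugrowth_cst A 'i) g3))) _.
move=> w t _; rewrite le_eqVlt; apply/orP; left; apply/eqP; congr normc.
by apply: reim_eq => /=; ring.
Qed.

Let f (t : R) (w : Om) : R := Fe a eps (sqn (kpath w t)).
Let df (t : R) (w : Om) : R :=
  2 * (Fe1 a eps (sqn (kpath w t)) * Re ((kpath w t)^* * dkpath w t)).

Let f_derive w t : is_derive t (1 : R) (f ^~ w) (df t w).
Proof.
have h1 := is_derive_sqn (is_cder_kpath z s K c w t).
have h2 := is_derive_Fe a e0 (sqn_ge0 (kpath w t)).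
by apply: is_derive_eq; rewrite /df; ring.
Qed.

Let ms t : cmeas (fun w => kpath w t).
Proof. by apply: cmeas_poly; exact: cmeas_Wz. Qed.

Let mdk t : cmeas (fun w => dkpath w t).
Proof.
have mW := @cmeas_Wz R (t * s).
have m1 : measurable_fun setT (fun w : Om => w.2.1).
  by apply: (measurableT_comp measurable_fst); exact: measurable_snd.
have m2 : measurable_fun setT (fun w : Om => w.2.2).
  by apply: (measurableT_comp measurable_snd); exact: measurable_snd.
apply: cmeasD.
  apply: cmeasM; first exact: cmeas_cst.
  by apply: cmeasD; [apply: cmeasM => //|apply: cmeasN]; exact: cmeas_poly.
apply: cmeasM; first exact: cmeas_poly.
by split; apply: measurable_funM.
Qed.

Let gf : ugrowth A (fun w t => (f t w)%:C).
Proof.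
have g1 := ugrowthD (ugrowth_sqn gk) (ugrowth_cst A 1%:C).
apply: ugrowth_le (ugrowthM g1 g1) _ => w t At.
rewrite rcD rcM !normcC ger0_norm ?Fe_ge0// -expr2.
by rewrite (le_trans (Fe_le a1 a2 e0 e1 (sqn_ge0 _)))// ler_norm.
Qed.

Let gdf : ugrowth A (fun w t => (df t w)%:C).
Proof.
have g1 := ugrowthD (ugrowth_sqn gk) (ugrowth_cst A 1%:C).
have g2 := ugrowth_Re (ugrowthM (ugrowthJ gk) gdk).
apply: ugrowth_le (ugrowthM (ugrowth_cst A 4%:C) (ugrowthM g1 g2)) _ => w t At.
rewrite rcD !rcM !normcC /df; set Q := Re _; set q := sqn _.
rewrite !(normrM 2) !(normrM 4) normrM (normrM (q + 1)) mulrA mulrA ler_wpM2r//.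
have q0 : 0 <= q by exact: sqn_ge0.
rewrite (ger0_norm (Fe1_ge0 _ _ _))// (ger0_norm (addr_ge0 q0 ler01)).
rewrite (ger0_norm (ler0n _ 2)) (ger0_norm (ler0n _ 4)).
by have := Fe1_le a1 a2 e0 e1 q0; lra.
Qed.

Let mf t : measurable_fun setT (f t).
Proof.
apply: (measurableT_comp (measurable_Fe eps a)).
exact: measurable_sqn.
Qed.

Let int_f t : A t -> gauss3.-integrable setT (EFin \o f t).
Proof.
move=> At; apply: (ugrowth_integrable At gf).
exact: cmeas_real.
Qed.

(** The time derivative of the multiplier is rewritten by the eigenvalue
equation, each Gaussian coordinate is integrated by parts, and
[flow_pointwise] bounds the resulting integrand. *)
Let int_df_le0 t : 0 <= t -> A t -> \int[gauss3]_w (df t w) <= 0.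
Proof.
move=> t0 At.
set h := hpath t; set S := t * s.
pose al1 := (- 2 * t)%:C * z.
pose al2 := s%:C - (2 * t ^+ 2 * s)%:C * z.
pose P (w : Om) := grad_Fe a eps h (Wz S w).
pose E1 (w : Om) := w.1 * Re (al1 * P w).
pose E2 (w : Om) := w.2.1 * Re (al2 * P w).
pose E3 (w : Om) := w.2.2 * Re ('i * al2 * P w).
pose E4 (w : Om) := Re ((2 * t)%:C * z *
  ((Fe1 a eps (sqn h.[Wz S w]))%:C * ((h.[Wz S w])^* * h^`()^`().[Wz S w]))).
pose V1 (w : Om) := Re (al1 * dgrad_Fe a eps h 1 (Wz S w)).
pose V2 (w : Om) := Re (al2 * dgrad_Fe a eps h S%:C (Wz S w)).
pose V3 (w : Om) := Re ('i * al2 * dgrad_Fe a eps h (0 +i* S) (Wz S w)).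
have dfE w : df t w = 2 * (E1 w + E2 w + E3 w + E4 w).
  rewrite /df /E1 /E2 /E3 /E4 /P /grad_Fe /al1 /al2 /dkpath /kpath -/h -/S; congr (2 * _).
  set f1 := Fe1 _ _ _.
  move: (h.[_]) (h^`().[_]) (h^`()^`().[_]) f1 => A0 A1 A2 f1.
  rewrite /Wz /S; case: w => x [b d] /=.
  move: A0 A1 A2 z => [? ?] [? ?] [? ?] [? ?] /=; ring.
have [g1 g2 g3] := ugrowth_coord A.
have gP : ugrowth A (fun w _ => P w).
  by apply: ugrowth_cgrowth; exact: cgrowth_grad_Fe.
have mP : cmeas P by exact: cmeas_grad_Fe.
have mD e : cmeas (fun w => dgrad_Fe a eps h e (Wz S w)) by exact: cmeas_dgrad_Fe.
have m1 : measurable_fun setT (fun w : Om => w.2.1).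
  by apply: (measurableT_comp measurable_fst); exact: measurable_snd.
have m2 : measurable_fun setT (fun w : Om => w.2.2).
  by apply: (measurableT_comp measurable_snd); exact: measurable_snd.
have iE (k : Om -> R) (al : R[i]) : measurable_fun setT k -> ugrowth A (fun w _ => (k w)%:C) ->
    gauss3.-integrable setT (fun w => (k w * Re (al * P w))%:E).
  move=> mk gk'.
  have g := ugrowthM gk' (ugrowthM (ugrowth_cst A al) gP).
  have m := cmeasM (cmeas_real mk) (cmeasM (cmeas_cst al) mP).
  have := ugrowth_integrable At g m.
  by rewrite (_ : (fun w => _) = (fun w => (k w * Re (al * P w))%:E))//; apply/funext => w; rewrite ReCM.
have iV (al e : R[i]) :
    gauss3.-integrable setT (fun w => (Re (al * dgrad_Fe a eps h e (Wz S w)))%:E).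
  apply: (@ugrowth_integrable A (fun w _ => al * dgrad_Fe a eps h e (Wz S w)) t) => //.
    apply: ugrowthM; first exact: ugrowth_cst.
    by apply: ugrowth_cgrowth; exact: cgrowth_dgrad_Fe.
  by apply: cmeasM => //; exact: cmeas_cst.
have i4 : gauss3.-integrable setT (fun w => (E4 w)%:E).
  have gg (p : {poly R[i]}) : ugrowth A (fun w _ => p.[Wz S w]).
    by apply: (@ugrowth_cgrowth A S (horner p)); apply: cgrowth_poly; rewrite addr_ge0 ?mulr_ge0.
  apply: (@ugrowth_integrable A (fun w _ => (2 * t)%:C * z *
    ((Fe1 a eps (sqn h.[Wz S w]))%:C * ((h.[Wz S w])^* * h^`()^`().[Wz S w]))) t) => //.
    apply: ugrowthM; first exact: ugrowth_cst.
    apply: ugrowthM.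
      by apply: (@ugrowth_cgrowth A S (fun Z => (Fe1 a eps (sqn h.[Z]))%:C)); exact: cgrowth_Fe1.
    by apply: ugrowthM => //; exact: ugrowthJ.
  have mh (p : {poly R[i]}) : cmeas (fun w => p.[Wz S w]).
    by apply: cmeas_poly; exact: cmeas_Wz.
  apply: cmeasM; first exact: cmeas_cst.
  apply: cmeasM; last by apply: cmeasM => //; exact: cmeasJ.
  apply: cmeas_real; apply: measurable_funM => //.
  by apply: (measurableT_comp (measurable_Fe eps (a - 1))); exact: measurable_sqn.
have i1 := iE _ al1 measurable_fst g1.
have i2 := iE _ al2 m1 g2.
have i3 := iE _ ('i * al2) m2 g3.
have h1 : \int[gauss3]_w (E1 w) = \int[gauss3]_w (V1 w).
  by congr fine; exact: (grad_Fe_ibp1 a1 a2 e0 e1 h S al1).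
have h2 : \int[gauss3]_w (E2 w) = \int[gauss3]_w (V2 w).
  by congr fine; exact: (grad_Fe_ibp2 a1 a2 e0 e1 h S al2).
have h3 : \int[gauss3]_w (E3 w) = \int[gauss3]_w (V3 w).
  by congr fine; exact: (grad_Fe_ibp3 a1 a2 e0 e1 h S ('i * al2)).
rewrite (_ : df t = fun w => 2 * (E1 w + E2 w + E3 w + E4 w)); last exact/funext.
have j1 := iV al1 1.
have j2 := iV al2 S%:C.
have j3 := iV ('i * al2) (0 +i* S).
have k12 := integrableD measurableT i1 i2.
have k123 := integrableD measurableT k12 i3.
have k1234 := integrableD measurableT k123 i4.
have l12 := integrableD measurableT j1 j2.
have l123 := integrableD measurableT l12 j3.
rewrite RintegralZl// pmulr_rle0//.
rewrite RintegralD// RintegralD// RintegralD// h1 h2 h3.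
rewrite -RintegralD// -RintegralD// -RintegralD//.
have l1234 := integrableD measurableT l123 i4.
rewrite -oppr_ge0 -mulN1r -RintegralZl//.
apply: Rintegral_ge0 => w _; rewrite mulN1r oppr_ge0.
have := flow_pointwise a1 e0 h (Wz S w) t0 hz.
have -> // : E4 w = 2 * t * Fe1 a eps (sqn h.[Wz S w]) *
  Re (z * ((h.[Wz S w])^* * h^`()^`().[Wz S w])).
by rewrite /E4 -mulrA ReCM mulrCA ReCM mulrA.
Qed.

Lemma flow_eps : (\int[gauss3]_w (f 1 w)%:E <= \int[gauss3]_w (f 0 w)%:E)%E.
Proof.
pose u t := \int[gauss3]_w (f t w).
have oA (t : R) : t \in `](-1), 2[ -> A t.
  by rewrite in_itv /= => /andP[? ?]; rewrite /A /= !ltW.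
have [C [N [C0 HC]]] := gdf.
have p1d t w : partial1of2 f t w = df t w.
  by rewrite partial1of2E; apply: (@derive_val _ _ _ _ _ _ _ (f_derive w t)).
have du (t : R) : t \in `](-1), 2[ -> derivable u t 1 /\ derive1 u t = \int[gauss3]_w (df t w).
  move=> ht.
  have I1 : forall x, `](-1), 2[%classic x -> gauss3.-integrable setT (EFin \o f x).
    by move=> x /oA; exact: int_f.
  have I2 : forall x y, `](-1), 2[%classic x -> setT y -> derivable (f ^~ y) x 1.
    by move=> x y _ _; case: (f_derive y x).
  have G0 : forall w : Om, 0 <= C * rho w ^+ N.
    by move=> w; rewrite mulr_ge0// exprn_ge0// (le_trans ler01 (rho_ge1 w)).
  have IG : gauss3.-integrable setT (EFin \o (fun w : Om => C * rho w ^+ N)).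
    by apply: (integrableZl measurableT _ (gauss3_moment (R := R) N)).
  have I3 : forall x y, `](-1), 2[%classic x -> setT y -> `|partial1of2 f x y| <= C * rho y ^+ N.
    by move=> x y /oA Ax _; rewrite p1d; have := HC y x Ax; rewrite normcC.
  split; first exact: (derivable_under_integral measurableT ht I1 I2 G0 IG I3).
  rewrite (differentiation_under_integral measurableT ht I1 I2 G0 IG I3).
  by apply: eq_Rintegral => w _; exact: p1d.
have sub01 (t : R) : t \in `[0, 1] -> t \in `](-1), 2[.
  by rewrite !in_itv /= => /andP[? ?]; apply/andP; split; [apply: lt_le_trans; last eassumption|apply: le_lt_trans; first eassumption]; rewrite ?ltrN10 ?ltr1n.
have : u 1 <= u 0.
  apply: (@ler0_derive1_nincr _ u 0 1) => //.
  - by move=> x /subset_itv_oo_cc /sub01 /du [].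
  - move=> x x01; have x01' := subset_itv_oo_cc x01.
    have [_ ->] := du x (sub01 _ x01').
    apply: int_df_le0; last exact/oA/sub01.
    by move: x01; rewrite in_itv /= => /andP[/ltW].
  - by apply: derivable_within_continuous => x /sub01 /du [].
move=> u10.
have A1 : A 1 by rewrite /A /= (le_trans (lerN10 _) ler01) ler1n.
have A0 : A 0 by rewrite /A /= lerN10 ler0n.
rewrite -(fineK (integral_fune_fin_num measurableT (int_f A1))).
by rewrite -(fineK (integral_fune_fin_num measurableT (int_f A0))) lee_fin.
Qed.

End flow_mono.

(** * Contraction by complex Hermite multipliers *)

Section hermite_flow.
Context {R : realType}.
Local Open Scope complex_scope.
Local Notation MR := (measurableTypeR R).
Local Notation gam := (@gauss_prob R).

(** Young's inequality for x / y and 1, rescaled by y^b. *)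
Lemma powR_tangent (x y b : R) : 0 <= x -> 0 < y -> 1 <= b ->
  y `^ b + b * y `^ (b - 1) * (x - y) <= x `^ b.
Proof.
move=> x0 y0; rewrite le_eqVlt => /orP[/eqP <-|b1].
  rewrite subrr powRr0 ?gt_eqF// mulr1 mul1r !powRr1 ?(ltW y0)//.
  by rewrite addrC subrK.
have b0 : 0 < b := lt_trans ltr01 b1.
pose t := x / y; have t0 : 0 <= t by rewrite divr_ge0// ltW.
have := @conjugate_powR R t 1 b (b / (b - 1)) t0 ler01 b0.
rewrite divr_gt0 ?subr_gt0// => /(_ isT).
have -> : b^-1 + (b / (b - 1))^-1 = 1.
  by rewrite invf_div; field; rewrite gt_eqF.
move=> /(_ erefl); rewrite mulr1 powR1 => h.
have xE : x = t * y by rewrite /t divfK// gt_eqF.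
clearbody t.
have yb : y `^ b = y `^ (b - 1) * y.
  rewrite -{1}(subrK 1 b) [LHS]powRD ?powRr1 ?(ltW y0)//.
  by apply/implyP => _; rewrite gt_eqF.
rewrite xE powRM ?(ltW y0)// yb -!mulrA.
have -> : y `^ (b - 1) * y + b * (y `^ (b - 1) * (t * y - y)) =
  (1 + b * (t - 1)) * (y `^ (b - 1) * y) by ring.
rewrite ler_wpM2r ?mulr_ge0 ?powR_ge0 ?(ltW y0)//.
have := ler_wpM2l (ltW b0) h.
have -> : b * (t `^ b / b + 1 / (b / (b - 1))) = t `^ b + (b - 1).
  by field; rewrite !gt_eqF ?subr_gt0.
by lra.
Qed.

Lemma integral_gauss3_fst (g : MR -> \bar R) : (forall x, 0 <= g x)%E ->
  measurable_fun setT g -> (\int[gauss3]_w g w.1 = \int[gam]_x g x)%E.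
Proof.
move=> g0 mg.
rewrite /gauss3 fubini_tonelli1//; last exact: measurableT_comp.
apply: eq_integral => x _; rewrite /fubini_F /= integral_cst//=.
by rewrite [X in (_ * X)%E](_ : _ = 1%E) ?mule1//; exact: probability_setT.
Qed.

Lemma powR_sqn (q : R) (y : R[i]) : normc y `^ q = sqn y `^ (q / 2).
Proof.
have n0 := normc_ge0 y.
by rewrite -normc_sqr -powR_mulrn// -powRrM; congr (_ `^ _); field.
Qed.

Variables (q : R).
Hypotheses (q2 : 2 <= q) (q4 : q <= 4).
Variables (z : R[i]) (s : R) (K : nat) (c : nat -> R[i]).
Hypothesis hz : q * s ^+ 2 + (q - 2) * normc z <= q * Re z.

(** The source of all bounds: multiplication of H_k by e^(- k z) combined with
the complex shift contracts L^q when z lies in this convex region, which is a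
sector with a rounded vertex at distance of order s^2 from 0. The point
z = 0, which one would like to reach, is outside. *)
Lemma hermite_flow :
  (\int[gauss3]_w (normc (\sum_(k < K) c k * cexp (- (k%:R * z)) * (He k).[Wz s w]) `^ q)%:E <=
   \int[gam]_x (normc (\sum_(k < K) c k * (He k).[x%:C]) `^ q)%:E)%E.
Proof.
pose a := q / 2.
have a1 : 1 <= a by rewrite ler_pdivlMr// mul1r.
have a2 : a <= 2 by rewrite ler_pdivrMr// -natrM.
have hz' : a * s ^+ 2 + (a - 1) * normc z <= a * Re z.
  rewrite -(ler_pM2l (ltr0n R 2)) (_ : 2 * (a * _ + _) = q * s ^+ 2 + (q - 2) * normc z); last first.
    by rewrite /a; field.
  by have -> : 2 * (a * Re z) = q * Re z by rewrite /a; field.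
pose k1 w := kpath z s K c w 1.
pose k0 w := kpath z s K c w 0.
have k1E w : \sum_(k < K) c k * cexp (- (k%:R * z)) * (He k).[Wz s w] = k1 w.
  rewrite /k1 /kpath /hpath horner_sum; apply: eq_bigr => k _.
  by rewrite hornerZ /pcoef expr1n mulr1 mul1r.
have k0E w : \sum_(k < K) c k * (He k).[(w.1)%:C] = k0 w.
  rewrite /k0 /kpath /hpath horner_sum; apply: eq_bigr => k _.
  by rewrite hornerZ /pcoef expr0n mulr0 cexp0 mulr1 mul0r /Wz !mul0r addr0.
have m0 : measurable_fun setT (fun w => sqn (k0 w)).
  by apply: measurable_sqn; apply: cmeas_poly; exact: cmeas_Wz.
have m1 : measurable_fun setT (fun w => sqn (k1 w)).
  by apply: measurable_sqn; apply: cmeas_poly; exact: cmeas_Wz.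
have mp (f : MR * (MR * MR) -> R) b : measurable_fun setT f -> measurable_fun setT (fun w => (f w `^ b)%:E).
  by move=> mf; apply/measurable_EFinP; apply: (measurableT_comp (measurable_powR b)).
rewrite -(@integral_gauss3_fst (fun x => (normc (\sum_(k < K) c k * (He k).[x%:C]) `^ q)%:E)); first last.
- apply/measurable_EFinP.
  under eq_fun do rewrite powR_sqn.
  apply: (measurableT_comp (measurable_powR _)); apply: measurable_sqn.
  apply: cmeas_sum => k; apply: cmeasM; first exact: cmeas_cst.
  by apply: cmeas_poly; exact: cmeas_real.
- by move=> x; rewrite lee_fin powR_ge0.
under eq_integral do rewrite k1E powR_sqn -/a.
under [in leRHS]eq_integral do rewrite k0E powR_sqn -/a.
pose J := (\int[gauss3]_w (2 * (sqn (k0 w) + 1))%:E)%E.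
have J0 : (0 <= J)%E.
  by apply: integral_ge0 => w _; rewrite lee_fin mulr_ge0// (addr_ge0 (sqn_ge0 _) ler01).
have Jfin : J \is a fin_num.
  have g1 : ugrowth setT (fun w _ => 2%:C * ((sqn (k0 w))%:C + 1%:C)).
    apply: ugrowthM; first exact: ugrowth_cst.
    apply: ugrowthD; last exact: ugrowth_cst.
    apply: (@ugrowth_cgrowth _ setT (0 * s) (fun Z => (sqn (hpath z K c 0).[Z])%:C)).
    exact: cgrowth_sqn.
  have m : cmeas (fun w => 2%:C * ((sqn (k0 w))%:C + 1%:C)).
    apply: cmeasM; first exact: cmeas_cst.
    by apply: cmeasD; [exact: cmeas_real|exact: cmeas_cst].
  have := integral_fune_fin_num measurableT (@ugrowth_integrable _ setT _ 0 I g1 m).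
  by under eq_integral do rewrite rcD rcM ReC.
suff H (e : R) : 0 < e -> e <= 1 ->
  (\int[gauss3]_w (sqn (k1 w) `^ a)%:E <= \int[gauss3]_w (sqn (k0 w) `^ a)%:E + e%:E * J)%E.
  apply/lee_addgt0Pr => e e0.
  pose j := fine J; have j0 : 0 <= j by exact: fine_ge0.
  pose e' := Num.min 1 (e / (j + 1)).
  have j1 : 0 < j + 1 by rewrite ltr_wpDl.
  have e'0 : 0 < e' by rewrite lt_min ltr01 divr_gt0.
  apply: (le_trans (H e' e'0 _)); first by rewrite ge_min lexx.
  rewrite leeD2l// -(fineK Jfin) -EFinM lee_fin -/j.
  apply: (@le_trans _ _ (e / (j + 1) * (j + 1))); last by rewrite divfK ?gt_eqF.
  by apply: ler_pM; rewrite ?(ltW e'0) ?ge_min ?lexx ?orbT// lerDl.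
move=> e0 e1.
apply: (@le_trans _ _ (\int[gauss3]_w (Fe a e (sqn (k1 w)))%:E)%E).
  apply: ge0_le_integral => //.
  - by move=> w _; rewrite lee_fin powR_ge0.
  - exact: mp.
  - by apply: mp; exact: measurable_funD.
  - move=> w _; rewrite lee_fin; apply: ge0_ler_powR; rewrite ?nnegrE.
    + by rewrite (le_trans _ a1).
    + exact: sqn_ge0.
    + exact: addr_ge0 (sqn_ge0 _) (ltW e0).
    + by rewrite lerDl ltW.
apply: (le_trans (flow_eps a1 a2 e0 e1 K c hz' )).
rewrite -/k0 -ge0_integralZl//; first last.
- by rewrite lee_fin ltW.
- by move=> w _; rewrite lee_fin mulr_ge0// (addr_ge0 (sqn_ge0 _) ler01).
- by apply/measurable_EFinP; apply: measurable_funM => //; apply: measurable_funD.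
rewrite -ge0_integralD//; first last.
- by apply/measurable_EFinP; apply: measurable_funM => //; apply: measurable_funM => //; apply: measurable_funD.
- by move=> w _; rewrite -EFinM lee_fin (mulr_ge0 (ltW e0))// mulr_ge0// (addr_ge0 (sqn_ge0 _) ler01).
- exact: mp.
- by move=> w _; rewrite lee_fin powR_ge0.
apply: ge0_le_integral => //.
- by move=> w _; rewrite lee_fin Fe_ge0.
- by apply: mp; exact: measurable_funD.
- apply: emeasurable_funD; first exact: mp.
  by apply/measurable_EFinP; apply: measurable_funM => //; apply: measurable_funM => //; apply: measurable_funD.
- move=> w _; rewrite -EFinM -EFinD lee_fin.
  have r0 := sqn_ge0 (k0 w).
  have re0 : 0 < sqn (k0 w) + e by rewrite ltr_wpDl.
  have := powR_tangent r0 re0 a1; have := Fe1_le a1 a2 e0 e1 r0.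
  rewrite /Fe /Fe1 opprD addNKr mulrN; set X := a * _ => X2 h.
  have := ler_wpM2r (ltW e0) X2; lra.
Qed.

End hermite_flow.

(** * Tensorization *)

Section tensor.
Context {R : realType}.
Local Open Scope complex_scope.

Section powerS.
Context d (T : measurableType d) (P : probability T R).

Lemma integral_power_probS n (f : n.+1.-tuple T -> \bar R) :
  (forall x, 0 <= f x)%E -> measurable_fun setT f ->
  (\int[power_prob P n.+1]_x f x =
   \int[P]_x \int[power_prob P n]_y f (tuple_cons (x, y)))%E.
Proof.
move=> f0 mf; rewrite /= ge0_integral_distribution//.
rewrite fubini_tonelli1//.
- by apply: measurableT_comp => //; exact: measurable_tuple_cons.
- by move=> z; exact: f0.
Qed.

Lemma integral_power_prob0 (f : 0.-tuple T -> \bar R) :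
  (forall x, 0 <= f x)%E -> measurable_fun setT f ->
  (\int[power_prob P 0]_x f x = f [tuple])%E.
Proof.
by move=> f0 mf; rewrite /= integral_dirac// diracT mul1e.
Qed.

End powerS.

Section terms.
Context d (T : measurableType d) (I : eqType).
Variable phi : nat -> T -> R[i].

(** Multi-indices are functions on nat, so that removing the first coordinate
is a mere shift. *)
Definition tsum n (r : seq I) (c : I -> R[i]) (al : I -> nat -> nat) (x : n.-tuple T) : R[i] :=
  \sum_(j <- r) c j * \prod_(i < n) phi (al j i) (tnth x i).

Lemma tsumS n r c al x (y : n.-tuple T) :
  tsum r c al (tuple_cons (x, y)) =
  tsum r (fun j => c j * phi (al j 0%N) x) (fun j i => al j i.+1) y.
Proof.
apply: eq_bigr => j _; rewrite big_ord_recl mulrA; congr (_ * _ * _).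
by apply: eq_bigr => i _; rewrite tnthS.
Qed.

Hypothesis mphi : forall k, cmeas (phi k).

Lemma cmeas_tsum n r c al : cmeas (@tsum n r c al).
Proof.
apply: cmeas_sum => j; apply: cmeasM; first exact: cmeas_cst.
apply: cmeas_prod => i; have [m1 m2] := mphi (al j i).
by split; [apply: (measurableT_comp m1)|apply: (measurableT_comp m2)]; exact: measurable_tnth.
Qed.

Lemma cmeas_tsum2 d' (S : measurableType d') n r (c : I -> S -> R[i]) al : (forall j, cmeas (c j)) ->
  cmeas (fun z : S * n.-tuple T => tsum r (c ^~ z.1) al z.2).
Proof.
move=> mc; apply: cmeas_sum => j; apply: cmeasM.
  by have [m1 m2] := mc j; split; [apply: (measurableT_comp m1)|apply: (measurableT_comp m2)].
apply: cmeas_prod => i; have [m1 m2] := mphi (al j i).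
have mt : measurable_fun setT (fun z : S * n.-tuple T => tnth z.2 i).
  by apply: (measurableT_comp (measurable_tnth i)).
by split; [apply: (measurableT_comp m1)|apply: (measurableT_comp m2)].
Qed.

End terms.

Lemma measurable_normc_powR d (T : measurableType d) (f : T -> R[i]) (q : R) : cmeas f ->
  measurable_fun setT (fun x => (normc (f x) `^ q)%:E).
Proof.
move=> mf; apply/measurable_EFinP; under eq_fun do rewrite powR_sqn.
by apply: (measurableT_comp (measurable_powR _)); exact: measurable_sqn.
Qed.

Section tensorization.
Context d (T : measurableType d) d' (S : measurableType d').
Variables (P : probability T R) (Q : probability S R).
Variables (phi : nat -> T -> R[i]) (chi : nat -> S -> R[i]).
Hypothesis mphi : forall k, cmeas (phi k).
Hypothesis mchi : forall k, cmeas (chi k).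
Variables (q : R).
Hypothesis PQ : forall K (c : nat -> R[i]),
  (\int[P]_x (normc (\sum_(k < K) c k * phi k x) `^ q)%:E <=
   \int[Q]_x (normc (\sum_(k < K) c k * chi k x) `^ q)%:E)%E.

Lemma regroup (I : eqType) (r : seq I) (c : I -> R[i]) (a : I -> nat) (F : nat -> R[i]) K :
  (forall j, j \in r -> a j < K)%N ->
  \sum_(j <- r) c j * F (a j) = \sum_(k < K) (\sum_(j <- r | a j == k) c j) * F k.
Proof.
move=> aK; under [RHS]eq_bigr do rewrite mulr_suml.
rewrite (exchange_big_dep xpredT)//= big_seq [RHS]big_seq; apply: eq_bigr => j jr.
by rewrite (big_pred1 (Ordinal (aK j jr))).
Qed.

Lemma tensor_step (I : eqType) (r : seq I) (c : I -> R[i]) (a : I -> nat) :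
  (\int[P]_x (normc (\sum_(j <- r) c j * phi (a j) x) `^ q)%:E <=
   \int[Q]_x (normc (\sum_(j <- r) c j * chi (a j) x) `^ q)%:E)%E.
Proof.
pose K := (\sum_(j <- r) a j).+1.
have aK j : j \in r -> (a j < K)%N.
  by move=> jr; rewrite ltnS (big_rem j)//= leq_addr.
under eq_integral do rewrite (regroup c (phi ^~ _) aK).
under [leRHS]eq_integral do rewrite (regroup c (chi ^~ _) aK).
exact: (PQ K (fun k => \sum_(j <- r | a j == k) c j)).
Qed.

(** Induction on n: the one-variable inequality is applied to the first
coordinate with the others frozen in the coefficients, then the integrals are
exchanged. The hypothesis must therefore hold for complex coefficients. *)
Lemma tensorization n (I : eqType) (r : seq I) (c : I -> R[i]) (al : I -> nat -> nat) :
  (\int[power_prob P n]_x (normc (tsum phi r c al x) `^ q)%:E <=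
   \int[power_prob Q n]_x (normc (tsum chi r c al x) `^ q)%:E)%E.
Proof.
have ge0 (y : R[i]) : (0 <= (normc y `^ q)%:E)%E by rewrite lee_fin powR_ge0.
elim: n c al => [|n IH] c al.
  rewrite !integral_power_prob0//; first last.
  - by apply: measurable_normc_powR; exact: cmeas_tsum.
  - by apply: measurable_normc_powR; exact: cmeas_tsum.
  by rewrite lee_fin /tsum; under eq_bigr do rewrite big_ord0;
     under [in leRHS]eq_bigr do rewrite big_ord0.
rewrite !integral_power_probS//; first last.
- by apply: measurable_normc_powR; exact: cmeas_tsum.
- by apply: measurable_normc_powR; exact: cmeas_tsum.
under eq_integral do under eq_integral do rewrite tsumS.
under [leRHS]eq_integral do under eq_integral do rewrite tsumS.
pose al' j i := al j i.+1.
have mc1 : forall j, cmeas (fun x => c j * phi (al j 0%N) x).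
  by move=> j; apply: cmeasM => //; exact: cmeas_cst.
have mc2 : forall j, cmeas (fun x => c j * chi (al j 0%N) x).
  by move=> j; apply: cmeasM => //; exact: cmeas_cst.
apply: (@le_trans _ _ (\int[P]_x \int[power_prob Q n]_y
   (normc (tsum chi r (fun j => c j * phi (al j 0%N) x) al' y) `^ q)%:E)%E).
  apply: ge0_le_integral => //.
  - by move=> x _; exact: integral_ge0.
  - apply: (measurable_fun_fubini_tonelli_F (fun z => (normc (tsum phi r (fun j => c j * phi (al j 0%N) z.1) al' z.2) `^ q)%:E)) => //.
    by apply: measurable_normc_powR; exact: (cmeas_tsum2 mphi n r al' mc1).
  - apply: (measurable_fun_fubini_tonelli_F (fun z => (normc (tsum chi r (fun j => c j * phi (al j 0%N) z.1) al' z.2) `^ q)%:E)) => //.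
    by apply: measurable_normc_powR; exact: (cmeas_tsum2 mchi n r al' mc1).
rewrite (fubini_tonelli (fun z : T * n.-tuple S => (normc (tsum chi r (fun j => c j * phi (al j 0%N) z.1) al' z.2) `^ q)%:E))//; last first.
  by apply: measurable_normc_powR; exact: (cmeas_tsum2 mchi n r al' mc1).
rewrite [leRHS](fubini_tonelli (fun z : S * n.-tuple S => (normc (tsum chi r (fun j => c j * chi (al j 0%N) z.1) al' z.2) `^ q)%:E))//; last first.
  by apply: measurable_normc_powR; exact: (cmeas_tsum2 mchi n r al' mc2).
have swap (U : Type) (F : nat -> U -> R[i]) (x : U) (y : n.-tuple S) :
  tsum chi r (fun j => c j * F (al j 0%N) x) al' y =
  \sum_(j <- r) (c j * \prod_(i < n) chi (al' j i) (tnth y i)) * F (al j 0%N) x.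
  by apply: eq_bigr => j _; rewrite mulrAC.
apply: ge0_le_integral => //.
- by move=> y _; exact: integral_ge0.
- apply: (measurable_fun_fubini_tonelli_G (fun z : T * n.-tuple S => (normc (tsum chi r (fun j => c j * phi (al j 0%N) z.1) al' z.2) `^ q)%:E)) => //.
  by apply: measurable_normc_powR; exact: (cmeas_tsum2 mchi n r al' mc1).
- apply: (measurable_fun_fubini_tonelli_G (fun z : S * n.-tuple S => (normc (tsum chi r (fun j => c j * chi (al j 0%N) z.1) al' z.2) `^ q)%:E)) => //.
  by apply: measurable_normc_powR; exact: (cmeas_tsum2 mchi n r al' mc2).
move=> y _; rewrite /fubini_G /=.
under eq_integral do rewrite (swap T phi).
under [leRHS]eq_integral do rewrite (swap S chi).
exact: tensor_step.
Qed.

End tensorization.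

End tensor.

(** * The Lq seminorm of complex functions *)

Section complex_Lq.
Context {R : realType} d (T : measurableType d) (mu : probability T R).
Local Open Scope complex_scope.
Variable q : R.
Hypothesis q1 : 1 <= q.
Let q0 : 0 < q := lt_le_trans ltr01 q1.
Implicit Types f g : T -> R[i].

Definition LN f : \bar R := Lnorm mu q%:E (fun x => (normc (f x))%:E).

Lemma LNE f : LN f = ((\int[mu]_x (normc (f x) `^ q)%:E) `^ q^-1)%E.
Proof.
rewrite /LN unlock; apply: (congr1 (fun x => (x `^ q^-1)%E)); apply: eq_integral => x _.
by rewrite /= ger0_norm ?normc_ge0.
Qed.

Lemma LN_powq f : (LN f `^ q = \int[mu]_x (normc (f x) `^ q)%:E)%E.
Proof.
rewrite LNE -poweRrM mulVf ?gt_eqF// poweRe1//.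
by apply: integral_ge0 => x _; rewrite lee_fin powR_ge0.
Qed.

Lemma LN_ge0 f : (0 <= LN f)%E. Proof. exact: Lnorm_ge0. Qed.

Lemma measurable_normc f : cmeas f -> measurable_fun setT (fun x => normc (f x)).
Proof.
move=> mf; apply/measurable_EFinP; have := measurable_normc_powR 1 mf.
by under eq_fun do rewrite powRr1 ?normc_ge0//.
Qed.

Lemma LND f g : cmeas f -> cmeas g -> (LN (fun x => (f x + g x)%R) <= LN f + LN g)%E.
Proof.
move=> mf mg.
have m1 := measurable_normc mf; have m2 := measurable_normc mg.
apply: (@le_trans _ _ ('N[mu]_q%:E [EFin \o ((fun x => normc (f x)) \+ (fun x => normc (g x)))%R])%E).
  rewrite LNE unlock; apply: gt0_ler_poweR.
  - by rewrite invr_ge0 ltW.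
  - by rewrite in_itv/= leey andbT; apply: integral_ge0 => x _; rewrite lee_fin powR_ge0.
  - by rewrite in_itv/= leey andbT; apply: integral_ge0 => x _; rewrite lee_fin powR_ge0.
  apply: ge0_le_integral => //=.
  - by move=> x _; rewrite lee_fin powR_ge0.
  - by apply: measurable_normc_powR; exact: cmeasD.
  - apply/measurable_EFinP; apply: (measurableT_comp (measurable_powR _)).
    by apply: measurableT_comp => //; exact: measurable_funD.
  - move=> x _; rewrite lee_fin; apply: ge0_ler_powR; rewrite ?nnegrE ?normc_ge0//.
      exact: ltW.
    by rewrite ger0_norm ?addr_ge0 ?normc_ge0//; exact: le_normcD.
exact: minkowski_EFin.
Qed.

Lemma LNZ z f : cmeas f -> (LN (fun x => (z * f x)%R) = (normc z)%:E * LN f)%E.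
Proof.
move=> mf; rewrite !LNE.
under eq_integral do rewrite normcM powRM ?normc_ge0// EFinM.
rewrite ge0_integralZl//; first last.
- by rewrite lee_fin powR_ge0.
- by move=> x _; rewrite lee_fin powR_ge0.
- exact: measurable_normc_powR.
rewrite poweRM; first last.
- by apply: integral_ge0 => x _; rewrite lee_fin powR_ge0.
- by rewrite lee_fin powR_ge0.
by rewrite poweR_EFin -powRrM mulfV ?gt_eqF// powRr1 ?normc_ge0.
Qed.

Lemma LN0 : LN (fun=> 0) = 0%E.
Proof.
have := LNZ 0 (@cmeas_cst _ _ _ 0).
by rewrite normc0 mul0e mul0r.
Qed.

Lemma LN_sum (I : Type) (r : seq I) (F : I -> T -> R[i]) : (forall j, cmeas (F j)) ->
  (LN (fun x => (\sum_(j <- r) F j x)%R) <= \sum_(j <- r) LN (F j))%E.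
Proof.
move=> mF; elim: r => [|j r IH].
  rewrite big_nil (_ : (fun x => _) = (fun=> 0)); first by rewrite LN0.
  by apply/funext => x; rewrite big_nil.
rewrite (_ : (fun x => _) = (fun x => (F j x + \sum_(i <- r) F i x)%R)); last first.
  by apply/funext => x; rewrite big_cons.
rewrite big_cons (le_trans (LND _ _))//; first exact: cmeas_sum.
by rewrite leeD2l.
Qed.

Lemma LN_sum_lty (I : Type) (r : seq I) (F : I -> T -> R[i]) :
  (forall j, cmeas (F j)) -> (forall j, LN (F j) < +oo)%E ->
  (LN (fun x => (\sum_(j <- r) F j x)%R) < +oo)%E.
Proof.
move=> mF FF; apply: (le_lt_trans (LN_sum r mF)).
by apply: lte_sum_pinfty => j _.
Qed.

End complex_Lq.

(** * Second-order complex Taylor expansions *)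

Section ctaylor.
Context {R : realType}.
Local Open Scope complex_scope.
Implicit Types (f g : R[i] -> R[i]) (z h : R[i]).

(** The only form of holomorphy that is required: a complex Taylor expansion
of order two with cubic error, a property stable under sums, products and
the exponential. *)
Definition ctaylor f z := exists a1, exists a2, exists C : R, 0 <= C /\
  forall h, normc h <= 1 ->
    normc (f (z + h) - (f z + a1 * h + a2 * h ^+ 2)) <= C * normc h ^+ 3.

Lemma ctaylor_cst c z : ctaylor (fun=> c) z.
Proof.
exists 0, 0, 0; split=> // h _.
by rewrite !mul0r !addr0 subrr normc0.
Qed.

Lemma ctaylor_id z : ctaylor id z.
Proof.
exists 1, 0, 0; split=> // h _.
by rewrite !mul0r mul1r addr0 subrr normc0.
Qed.

Lemma ctaylorD f g z : ctaylor f z -> ctaylor g z -> ctaylor (fun z => f z + g z) z.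
Proof.
move=> [a1 [a2 [C [C0 fC]]]] [b1 [b2 [D [D0 gD]]]].
exists (a1 + b1), (a2 + b2), (C + D); split=> [|h h1]; first exact: addr_ge0.
rewrite (_ : _ - _ = (f (z + h) - (f z + a1 * h + a2 * h ^+ 2)) +
  (g (z + h) - (g z + b1 * h + b2 * h ^+ 2))); last by ring.
by rewrite (le_trans (le_normcD _ _))// [leRHS]mulrDl lerD ?fC ?gD.
Qed.

Lemma ctaylorM f g z : ctaylor f z -> ctaylor g z -> ctaylor (fun z => f z * g z) z.
Proof.
move=> [a1 [a2 [C [C0 fC]]]] [b1 [b2 [D [D0 gD]]]].
pose Pg := normc (g z) + normc b1 + normc b2 + D.
pose Pf := normc (f z) + normc a1 + normc a2.
exists (a1 * g z + f z * b1), (a2 * g z + a1 * b1 + f z * b2).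
exists (C * Pg + Pf * D + (normc (a1 * b2 + a2 * b1) + normc (a2 * b2))).
have n0 := @normc_ge0 R.
have Pg0 : 0 <= Pg by rewrite !addr_ge0.
have Pf0 : 0 <= Pf by rewrite !addr_ge0.
split=> [|h h1]; first by rewrite !addr_ge0 ?mulr_ge0.
set H := normc h; have H0 : 0 <= H by exact: n0.
have H2 : H ^+ 2 <= 1 by rewrite exprn_ile1.
have H3 : H ^+ 3 <= 1 by rewrite exprn_ile1.
set ef := f (z + h) - (f z + a1 * h + a2 * h ^+ 2).
set eg := g (z + h) - (g z + b1 * h + b2 * h ^+ 2).
rewrite (_ : _ - _ = ef * g (z + h) + (f z + a1 * h + a2 * h ^+ 2) * eg +
   ((a1 * b2 + a2 * b1) * h ^+ 3 + a2 * b2 * h ^+ 4)); last by rewrite /ef /eg; ring.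
rewrite (le_trans (le_normcD _ _))// [leRHS]mulrDl lerD//.
  rewrite (le_trans (le_normcD _ _))// [leRHS]mulrDl lerD//.
    rewrite normcM mulrAC; apply: ler_pM => //; first exact: fC.
    rewrite (_ : g (z + h) = g z + b1 * h + b2 * h ^+ 2 + eg); last by rewrite /eg; ring.
    rewrite (le_trans (le_normcD _ _))// lerD//; last first.
      by rewrite (le_trans (gD h h1))// ler_piMr.
    rewrite (le_trans (le_normcD _ _))// lerD//; last first.
      by rewrite normcM normc_X ler_piMr.
    rewrite (le_trans (le_normcD _ _))// lerD//.
    by rewrite normcM ler_piMr.
  rewrite normcM -mulrA; apply: ler_pM => //; last exact: gD.
  rewrite (le_trans (le_normcD _ _))// lerD//; last first.
    by rewrite normcM normc_X ler_piMr.
  rewrite (le_trans (le_normcD _ _))// lerD//.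
  by rewrite normcM ler_piMr.
rewrite (le_trans (le_normcD _ _))// [leRHS]mulrDl lerD//.
  by rewrite normcM normc_X.
rewrite normcM normc_X ler_wpM2l// -/H exprS ler_piMl// exprn_ge0//.
Qed.

Lemma ctaylorN f z : ctaylor f z -> ctaylor (fun z => - f z) z.
Proof.
move=> fz; have := ctaylorM (ctaylor_cst (-1) z) fz.
by under eq_fun do rewrite mulN1r.
Qed.

Lemma ctaylorX f z n : ctaylor f z -> ctaylor (fun z => f z ^+ n) z.
Proof.
move=> fz; elim: n => [|n IH].
  by under eq_fun do rewrite expr0; exact: ctaylor_cst.
by under eq_fun do rewrite exprS; exact: ctaylorM.
Qed.

Let unit_bound (g g' : R -> R) (M : R) : 0 <= M ->
  (forall t, is_derive t (1 : R) g (g' t)) -> g 0 = 0 ->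
  (forall t, 0 <= t <= 1 -> `|g' t| <= M) -> forall t, 0 <= t <= 1 -> `|g t| <= M.
Proof.
move=> M0 dg g0 g'M t /andP[t0 t1].
have cg (x : R) : {for x, continuous g}.
  by apply: differentiable_continuous; apply/derivable1_diffP; case: (dg x).
have [->|tn0] := eqVneq t 0; first by rewrite g0 normr0.
have tp : 0 < t by rewrite lt_def tn0.
have [c] := @MVT _ g g' 0 t tp (fun x _ => dg x) (continuous_subspaceT cg).
rewrite in_itv /= => /andP[c0 ct]; rewrite g0 !subr0 => ->.
rewrite normrM (ger0_norm t0) -[leRHS]mulr1; apply: ler_pM => //.
by apply: g'M; rewrite (ltW c0)/= (le_trans (ltW ct)).
Qed.

(** The third derivative of t |-> e^(t u) is integrated three times over
[0, 1]; the factor 2 comes from bounding the two parts separately. *)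
Lemma cexp_taylor (u : R[i]) :
  normc (cexp u - (1 + u + 2^-1 * u ^+ 2)) <= 2 * expR (normc u) * normc u ^+ 3.
Proof.
pose M := expR (normc u) * normc u ^+ 3.
have n0 := @normc_ge0 R.
have M0 : 0 <= M by rewrite mulr_ge0 ?expR_ge0 ?exprn_ge0.
pose k0 (t : R) := cexp (t%:C * u) - (1 + t%:C * u + 2^-1 * (t%:C * u) ^+ 2).
pose k1 (t : R) := u * cexp (t%:C * u) - (u + u * (t%:C * u)).
pose k2 (t : R) := u ^+ 2 * cexp (t%:C * u) - u ^+ 2.
pose k3 (t : R) := u ^+ 3 * cexp (t%:C * u).
have dt (t : R) : is_cder (fun t : R => t%:C * u) t u.
  apply: is_cder_eq; first by apply: is_cderM; [exact: (@is_cder_real _ id t 1)|exact: is_cder_cst].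
  by rewrite mul1r mulr0 addr0.
have d0 t : is_cder k0 t (k1 t).
  apply: is_cder_eq.
    apply: is_cderD; first exact: is_cder_cexp.
    apply: is_cderN; apply: is_cderD; first by apply: is_cderD; [exact: is_cder_cst|exact: dt].
    apply: is_cderM; first exact: is_cder_cst.
    by under eq_fun do rewrite expr2; apply: is_cderM; exact: dt.
  by rewrite /k1; field.
have d1 t : is_cder k1 t (k2 t).
  apply: is_cder_eq.
    apply: is_cderD; first by apply: is_cderM; [exact: is_cder_cst|exact: is_cder_cexp].
    apply: is_cderN; apply: is_cderD; first exact: is_cder_cst.
    by apply: is_cderM; [exact: is_cder_cst|exact: dt].
  rewrite /k2; ring.
have d2 t : is_cder k2 t (k3 t).
  apply: is_cder_eq.
    apply: is_cderD; first by apply: is_cderM; [exact: is_cder_cst|exact: is_cder_cexp].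
    exact: is_cder_cst.
  rewrite /k3; ring.
have b3 t : 0 <= t <= 1 -> normc (k3 t) <= M.
  move=> /andP[t0 t1]; rewrite /k3 normcM normc_X mulrC ler_wpM2r ?exprn_ge0//.
  rewrite normc_cexp ler_expR ReCM (le_trans (ler_norm _))// normrM ger0_norm//.
  by rewrite -[leRHS]mul1r ler_pM// ler_Re_normc.
have z0 : cexp ((0 : R)%:C * u) = 1 by rewrite mul0r cexp0.
have k00 : k0 0 = 0 by rewrite /k0 z0 mul0r expr0n mulr0 !addr0 subrr.
have k10 : k1 0 = 0 by rewrite /k1 z0 mul0r mulr1 mulr0 addr0 subrr.
have k20 : k2 0 = 0 by rewrite /k2 z0 mulr1 subrr.
have b30 t : 0 <= t <= 1 -> `|Re (k3 t)| <= M /\ `|Im (k3 t)| <= M.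
  by move=> /b3 h; split; apply: le_trans h; [exact: ler_Re_normc|exact: ler_Im_normc].
have step k k' : (forall t, is_cder k t (k' t)) -> k 0 = 0 ->
    (forall t, 0 <= t <= 1 -> `|Re (k' t)| <= M /\ `|Im (k' t)| <= M) ->
    forall t, 0 <= t <= 1 -> `|Re (k t)| <= M /\ `|Im (k t)| <= M.
  move=> dk kk0 bk t t01; split.
    apply: (@unit_bound (fun t => Re (k t)) (fun t => Re (k' t))) => //.
    - by move=> x; case: (dk x).
    - by rewrite kk0.
    - by move=> x /bk [].
  apply: (@unit_bound (fun t => Im (k t)) (fun t => Im (k' t))) => //.
  - by move=> x; case: (dk x).
  - by rewrite kk0.
  - by move=> x /bk [].
have [|h1 h2] := step _ _ d0 k00 (step _ _ d1 k10 (step _ _ d2 k20 b30)) 1.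
  by rewrite ler01 lexx.
have -> : cexp u - (1 + u + 2^-1 * u ^+ 2) = k0 1 by rewrite /k0 mul1r.
by rewrite (le_trans (normc_le_reim _))// -mulrA -/M; lra.
Qed.

Lemma ctaylor_cexp f z : ctaylor f z -> ctaylor (fun z => cexp (f z)) z.
Proof.
move=> [b1 [b2 [C [C0 fC]]]].
have n0 := @normc_ge0 R.
pose B := normc b1 + normc b2 + C.
have B0 : 0 <= B by rewrite !addr_ge0.
have [D [DE D0]] : exists D : R, D = (normc b2 + C) * (2 * B) * normc (2^-1 : R[i]) /\ 0 <= D.
  by eexists; split; first reflexivity; rewrite !mulr_ge0 ?addr_ge0.
suff h0 : ctaylor (fun w => cexp (f w - f z)) z.
  have := ctaylorM (ctaylor_cst (cexp (f z)) z) h0.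
  by under eq_fun do rewrite -cexpD addrC subrK.
exists b1, (b2 + 2^-1 * b1 ^+ 2), (2 * expR B * B ^+ 3 + C + D).
split=> [|h h1].
  by rewrite addr_ge0// addr_ge0// !mulr_ge0 ?expR_ge0 ?exprn_ge0.
rewrite subrr cexp0; set u := f (z + h) - f z.
set H := normc h; have H0 : 0 <= H by exact: n0.
pose e := f (z + h) - (f z + b1 * h + b2 * h ^+ 2).
have eC : normc e <= C * H ^+ 3 by exact: fC.
have ue : u = b1 * h + b2 * h ^+ 2 + e by rewrite /e /u; ring.
have H21 : H ^+ 2 <= H by rewrite expr2 ler_piMr.
have H32 : H ^+ 3 <= H ^+ 2 by rewrite exprS ler_piMl// exprn_ge0.
have u1 : normc (u - b1 * h) <= (normc b2 + C) * H ^+ 2.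
  rewrite ue (_ : _ - _ = b2 * h ^+ 2 + e); last by ring.
  rewrite (le_trans (le_normcD _ _))// [leRHS]mulrDl lerD//; first by rewrite normcM normc_X.
  by rewrite (le_trans eC)// ler_wpM2l.
have b1H : normc (b1 * h) <= normc b1 * H by rewrite normcM.
have uB : normc u <= B * H.
  rewrite (_ : u = b1 * h + (u - b1 * h)); last by ring.
  rewrite (_ : B * H = normc b1 * H + (normc b2 + C) * H); last by rewrite /B; ring.
  rewrite (le_trans (le_normcD _ _))// lerD//.
  by rewrite (le_trans u1)// ler_wpM2l// addr_ge0.
have uB1 : normc u <= B by rewrite (le_trans uB)// ler_piMr.
rewrite (_ : _ - _ = (cexp u - (1 + u + 2^-1 * u ^+ 2)) + e +
   (u - b1 * h) * (u + b1 * h) * 2^-1); last by rewrite ue; ring.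
rewrite (le_trans (le_normcD _ _))// [leRHS]mulrDl lerD//.
  rewrite (le_trans (le_normcD _ _))// [leRHS]mulrDl lerD//.
  rewrite (le_trans (cexp_taylor u))//.
  rewrite (_ : _ * H ^+ 3 = 2 * expR B * (B * H) ^+ 3); last by ring.
  apply: ler_pM; rewrite ?mulr_ge0 ?expR_ge0 ?exprn_ge0 ?ler_pM2l ?ler_expR//.
  by apply: lerXn2r; rewrite ?nnegrE ?mulr_ge0.
rewrite DE normcM mulrAC ler_wpM2r// normcM.
rewrite (_ : _ * H ^+ 3 = ((normc b2 + C) * H ^+ 2) * (2 * B * H)); last by ring.
apply: ler_pM => //.
rewrite (le_trans (le_normcD _ _))//.
have : normc b1 * H <= B * H by rewrite ler_wpM2r// /B -addrA lerDl addr_ge0.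
by move: uB b1H; lra.
Qed.

Lemma ctaylor_lip f z : ctaylor f z -> exists L, 0 <= L /\
  forall h, normc h <= 1 -> normc (f (z + h) - f z) <= L * normc h.
Proof.
move=> [b1 [b2 [C [C0 fC]]]].
have n0 := @normc_ge0 R.
exists (normc b1 + normc b2 + C); split=> [|h h1]; first by rewrite !addr_ge0.
set e := f (z + h) - (f z + b1 * h + b2 * h ^+ 2).
rewrite (_ : _ - _ = b1 * h + b2 * h ^+ 2 + e); last by rewrite /e; ring.
set H := normc h; have H0 : 0 <= H by exact: n0.
have H21 : H ^+ 2 <= H by rewrite expr2 ler_piMr.
have H32 : H ^+ 3 <= H by rewrite exprS ler_piMr// exprn_ile1.
rewrite (le_trans (le_normcD _ _))// [leRHS]mulrDl lerD//.
  rewrite (le_trans (le_normcD _ _))// [leRHS]mulrDl lerD//; first by rewrite normcM.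
  by rewrite normcM normc_X ler_wpM2l.
by rewrite (le_trans (fC h h1))// ler_wpM2l.
Qed.

End ctaylor.

(** * A maximum principle for seminorms *)

Section max_principle.
Context {R : realType}.
Local Open Scope complex_scope.
Implicit Types (z h : R[i]).

Lemma continuous_sqn : continuous (fun x : R * R => sqn (x.1 +i* x.2)).
Proof.
move=> x; rewrite /sqn /=; apply: cvgD; rewrite expr2; apply: cvgM;
by [exact: cvg_fst|exact: cvg_snd].
Qed.

(** Below, N v is the L^q seminorm of a combination, with coefficients
v 0, ..., v (m - 1), of fixed functions. *)
Definition seminorm_on (m : nat) (N : (nat -> R[i]) -> R) :=
  [/\ forall v, 0 <= N v,
      forall v w, N (fun k => v k + w k) <= N v + N w,
      forall a v, N (fun k => a * v k) = normc a * N v &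
      exists2 A, 0 <= A & forall v, N v <= A * \sum_(k < m) normc (v k)].

Variables (m : nat) (N : (nat -> R[i]) -> R).
Hypothesis hN : seminorm_on m N.

Lemma seminormB v w : `|N v - N w| <= N (fun k => v k - w k).
Proof.
case: hN => _ ND NZ _.
have H v' w' : N v' - N w' <= N (fun k => v' k - w' k).
  rewrite lerBlDr; apply: le_trans (ND _ _).
  by rewrite le_eqVlt (_ : (fun k => _) = v') ?eqxx//; apply/funext => k; rewrite subrK.
rewrite ler_norml H andbT lerNl opprB (le_trans (H _ _))//.
have := NZ (-1) (fun k => v k - w k); rewrite normcN normc1 mul1r => <-.
by rewrite le_eqVlt (_ : (fun k => w k - v k) = (fun k => -1 * (v k - w k))) ?eqxx//; apply/funext => k; ring.
Qed.

Lemma seminorm4 v0 v1 v2 v3 :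
  N (fun k => v0 k + v1 k + v2 k + v3 k) <= N v0 + N v1 + N v2 + N v3.
Proof.
case: hN => _ ND _ _; rewrite (le_trans (ND (fun k => v0 k + v1 k + v2 k) _))// lerD2r.
by rewrite (le_trans (ND (fun k => v0 k + v1 k) _))// lerD2r ND.
Qed.

Variable Q : nat -> R[i] -> R[i].

Lemma ctaylor_unif z : (forall k, ctaylor (Q k) z) ->
  exists a1, exists a2, exists2 C : R, 0 <= C & forall k h, (k < m)%N -> normc h <= 1 ->
    normc (Q k (z + h) - (Q k z + a1 k * h + a2 k * h ^+ 2)) <= C * normc h ^+ 3.
Proof.
move=> /choice [a1] /choice [a2] /choice [C hC].
exists a1, a2, (\sum_(k < m) C k) => [|k h km h1].
  by apply: sumr_ge0 => k _; case: (hC k).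
rewrite (le_trans ((hC k).2 h h1))// ler_wpM2r ?exprn_ge0 ?normc_ge0//.
rewrite (bigD1 (Ordinal km))//= lerDl; apply: sumr_ge0 => j _; by case: (hC j).
Qed.

Let normcBC z w : normc (z - w) = normc (w - z).
Proof. by rewrite -normcN opprB. Qed.

Lemma seminorm_lip z : (forall k, ctaylor (Q k) z) ->
  exists2 L : R, 0 <= L & forall h, normc h <= 1 ->
    `|N (Q ^~ z) - N (Q ^~ (z + h))| <= L * normc h.
Proof.
move=> tQ; have [L hL] := choice (fun k => ctaylor_lip (tQ k)).
case: hN => _ _ _ [A A0 NA].
exists (A * \sum_(k < m) L k); first by rewrite mulr_ge0// sumr_ge0// => k _; case: (hL k).
move=> h h1; rewrite (le_trans (seminormB _ _))// (le_trans (NA _))// -mulrA ler_wpM2l//.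
rewrite mulr_suml; apply: ler_sum => k _; rewrite normcBC; exact: (hL k).2.
Qed.

(** Averaging over z + t i^j cancels the Taylor terms of order one and two:
a sub-mean value property with cubic error, obtained without integration. *)
Lemma four_points z : (forall k, ctaylor (Q k) z) ->
  exists2 C : R, 0 <= C & forall t, 0 <= t -> t <= 1 ->
    4 * N (Q ^~ z) <= N (Q ^~ (z + t%:C)) + N (Q ^~ (z - t%:C)) +
      N (Q ^~ (z + 'i * t%:C)) + N (Q ^~ (z - 'i * t%:C)) + C * t ^+ 3.
Proof.
move=> /ctaylor_unif [a1 [a2 [C C0 hC]]].
case: hN => _ ND NZ [A A0 NA].
exists (A * \sum_(k < m) (4 * C)) => [|t t0 t1].
  by rewrite mulr_ge0// sumr_ge0// => k _; rewrite mulr_ge0.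
pose e h k := Q k z + a1 k * h + a2 k * h ^+ 2 - Q k (z + h).
pose i : R[i] := 'i.
have i2 : i ^+ 2 = -1 by exact: sqr_i.
pose T : R[i] := t%:C.
have nT : normc T = t by rewrite normcC ger0_norm.
have ni : normc i = 1 by rewrite /= expr0n expr1n add0r sqrtr1.
have -> : 4 * N (Q ^~ z) = N (fun k => 4 * Q k z).
  rewrite NZ (_ : normc _ = 4)//.
  by rewrite (_ : 4 = 4%:C) ?normcC ?ger0_norm//; rewrite rmorph_nat.
(* The four points sum to 4 z, and their squares cancel as i^2 = -1. *)
have -> : (fun k => 4 * Q k z) = (fun k =>
    (Q k (z + T) + Q k (z - T) + Q k (z + i * T) + Q k (z - i * T)) +
    (e T k + e (- T) k + e (i * T) k + e (- (i * T)) k)).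
  apply/funext => k; rewrite /e !sqrrN !exprMn i2; ring.
rewrite (le_trans (ND _ _))// lerD ?seminorm4//.
rewrite (le_trans (NA _))// -mulrA ler_wpM2l// mulr_suml; apply: ler_sum => k _.
have be h : normc h = t -> normc (e h k) <= C * t ^+ 3.
  by move=> ht; rewrite -normcN opprB -ht hC// ht.
have b1 := be T nT; have b2 := be (- T) (etrans (normcN _) nT).
have niT : normc (i * T) = t by rewrite normcM ni mul1r.
have b3 := be (i * T) niT; have b4 := be (- (i * T)) (etrans (normcN _) niT).
have n1 := le_normcD (e T k + e (- T) k + e (i * T) k) (e (- (i * T)) k).
have n2 := le_normcD (e T k + e (- T) k) (e (i * T) k).
have n3 := le_normcD (e T k) (e (- T) k).
move: b1 b2 b3 b4 n1 n2 n3; clear; lra.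
Qed.

Lemma sqn4 z t : sqn (z + t%:C) + sqn (z - t%:C) + sqn (z + 'i * t%:C) + sqn (z - 'i * t%:C)
  = 4 * sqn z + 4 * t ^+ 2.
Proof. by case: z => a b; rewrite /sqn /=; ring. Qed.

Let toC (x : R * R) : R[i] := x.1 +i* x.2.

(** Perturb N (Q z) by eps |z|^2, with eps so small that the maximum over K
still exceeds B. The maximum is then at an interior point, where
[four_points] gives 4 eps t^2 <= C t^3 for all small t, which is absurd. *)
Lemma max_principle (K : set R[i]) B :
  compact [set x : R * R | K (x.1 +i* x.2)] ->
  (forall z k, K z -> ctaylor (Q k) z) ->
  (forall z, K z -> N (Q ^~ z) <= B \/
     exists2 r : R, 0 < r & forall h, normc h <= r -> K (z + h)) ->
  forall z, K z -> N (Q ^~ z) <= B.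
Proof.
move=> cK tQ hK z0 Kz0; rewrite leNgt; apply/negP => zB.
set K2 := [set x : R * R | _] in cK.
have K2E z : K2 (Re z, Im z) = K z by case: z.
have csq := @continuous_sqn.
have cG (x : R * R) : x \in K2 -> {for x, continuous (fun x => N (Q ^~ (toC x)))}.
  move=> /set_mem Kx; apply/cvgrPdist_le => eps e0.
  have [L L0 hL] := seminorm_lip (fun k => tQ _ k Kx).
  have L1 : 0 < L + 1 by rewrite ltr_pwDr.
  pose dl := Num.min 1 (eps / (L + 1)) / 2.
  have d0 : 0 < dl by rewrite divr_gt0// lt_min ltr01 divr_gt0.
  have f1 : y.1 @[y --> x] --> x.1 by exact: cvg_fst.
  have f2 : y.2 @[y --> x] --> x.2 by exact: cvg_snd.
  have c1 : \forall y \near nbhs x, `|x.1 - y.1| <= dl by exact: (cvgr_dist_le _ _ f1).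

  have c2 : \forall y \near nbhs x, `|x.2 - y.2| <= dl by exact: (cvgr_dist_le _ _ f2).
  near=> y.
  have y1 : `|x.1 - y.1| <= dl by near: y.
  have y2 : `|x.2 - y.2| <= dl by near: y.
  pose h := toC y - toC x.
  have hn : normc h <= 2 * dl.
    rewrite (le_trans (normc_le_reim _))// (_ : 2 * dl = dl + dl); last by ring.
    by rewrite lerD// /h /= distrC.
  have dE : 2 * dl = Num.min 1 (eps / (L + 1)) by rewrite /dl mulrC divfK.
  have h1 : normc h <= 1 by rewrite (le_trans hn)// dE ge_min lexx.
  have := hL h h1; rewrite (_ : toC x + h = toC y); last by rewrite /h addrC subrK.
  move=> /le_trans; apply.
  have h2 : normc h <= eps / (L + 1) by rewrite (le_trans hn)// dE ge_min lexx orbT.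
  rewrite (le_trans (ler_wpM2l L0 h2))// mulrCA ger_pMr// ler_pdivrMr// mul1r lerDl//.
have K0 : K2 !=set0 by exists (Re z0, Im z0); rewrite K2E.
have [xM _ hM] := compact_EVT_max K0 cK (continuous_subspaceT csq).
pose M := sqn (toC xM).
have M0 : 0 <= M by exact: sqn_ge0.
have M1 : 0 < M + 1 by rewrite ltr_pwDr.
(* eps |z|^2 is less than half of the excess of N (Q z0) over B on K. *)
pose eps := (N (Q ^~ z0) - B) / 2 / (M + 1).
have e0 : 0 < eps by rewrite !divr_gt0// subr_gt0.
pose phi x := N (Q ^~ (toC x)) + eps * sqn (toC x).
have cphi : {within K2, continuous phi}.
  apply: continuous_in_subspaceT => x xK; apply: cvgD; first exact: cG.
  by apply: cvgM; [exact: cvg_cst|exact: csq].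
have [x1 /set_mem K1 h1] := compact_EVT_max K0 cK cphi.
have gt1 : B < N (Q ^~ (toC x1)).
  have := h1 (Re z0, Im z0); rewrite inE K2E => /(_ Kz0).
  rewrite /phi (_ : toC (_, _) = z0); last by rewrite /toC; case: (z0).
  have := hM x1 (mem_set K1).
  move=> /(ler_wpM2l (ltW e0)); rewrite -/M => s1.
  have s0 : 0 <= eps * sqn z0 by rewrite mulr_ge0 ?sqn_ge0// ltW.
  have : eps * M <= (N (Q ^~ z0) - B) / 2.
    rewrite /eps -[leRHS]mulr1 -mulrA ler_wpM2l ?divr_ge0 ?subr_ge0 ?(ltW zB)//.
    by rewrite mulrC ler_pdivrMr// mul1r lerDl.
  move: s1 s0 zB; clear; lra.
have [|[r r0 hr]] := hK _ K1; first by rewrite leNgt gt1.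
have [C C0 hC] := four_points (fun k => tQ _ k K1).
have C1 : 0 < C + 1 by rewrite ltr_pwDr.
(* t < 4 eps / C makes the gain 4 eps t^2 larger than the error C t^3. *)
pose t := Num.min (Num.min 1 r) (eps / (C + 1)).
have t0 : 0 < t by rewrite !lt_min ltr01 r0 divr_gt0.
have t1 : t <= 1 by rewrite !ge_min lexx.
have tr : t <= r by rewrite !ge_min lexx orbT.
have te : t <= eps / (C + 1) by rewrite !ge_min lexx !orbT.
have nT : normc t%:C = t by rewrite normcC ger0_norm// ltW.
have niT : normc ('i * t%:C) = t.
  by rewrite normcM nT/= expr0n expr1n add0r sqrtr1 mul1r.
have ph h : normc h = t -> N (Q ^~ (toC x1 + h)) + eps * sqn (toC x1 + h) <= phi x1.
  move=> ht; set w := toC x1 + h.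
  have -> : w = toC (Re w, Im w) by rewrite /toC; case: (w).
  by apply: h1; apply/mem_set; rewrite K2E; apply: hr; rewrite ht.
have p1 := ph _ nT; have p2 := ph (- t%:C) (etrans (normcN _) nT).
have p3 := ph _ niT; have p4 := ph (- ('i * t%:C)) (etrans (normcN _) niT).
have := hC t (ltW t0) t1; rewrite -/(toC x1); have := sqn4 (toC x1) t.
have : C * t ^+ 3 < eps * (4 * t ^+ 2).
  rewrite (_ : C * t ^+ 3 = C * t * t ^+ 2); last by ring.
  rewrite [ltRHS]mulrA ltr_pM2r ?exprn_gt0//.
  have : (C + 1) * t <= eps by rewrite mulrC -ler_pdivlMr.
  move: t0 e0; clear; lra.
move: p1 p2 p3 p4; rewrite /phi.
move=> p1 p2 p3 p4 p5 /(congr1 ( *%R eps)) p6 p7.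
move: p1 p2 p3 p4 p5 p6 p7; clear; lra.
Unshelve. all: by end_near. Qed.

End max_principle.

(** * Bernstein-Walsh inequality on discs *)

Section bernstein_walsh.
Context {R : realType}.
Local Open Scope complex_scope.
Implicit Types (z h w : R[i]).

Lemma compact_box (a b c d : R) (K : set R[i]) : closed [set x : R * R | K (x.1 +i* x.2)] ->
  (forall z, K z -> a <= Re z <= b /\ c <= Im z <= d) ->
  compact [set x : R * R | K (x.1 +i* x.2)].
Proof.
move=> cK hK; apply: (subclosed_compact cK (compact_setX (@segment_compact _ a b) (@segment_compact _ c d))).
by move=> x /hK []; split; rewrite /= in_itv.
Qed.

Lemma compact_disc (r : R) : 0 <= r -> compact [set x : R * R | normc (x.1 +i* x.2) <= r].
Proof.
move=> r0; apply: (@compact_box (- r) r (- r) r (fun z => normc z <= r)).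
  rewrite (_ : [set x | _] = (fun x : R * R => sqn (x.1 +i* x.2)) @^-1` [set y | y <= r ^+ 2]).
    by apply: closed_comp; [move=> x _; exact: continuous_sqn|exact: closed_le].
  apply/seteqP; split=> x /=; rewrite -normc_sqr ler_pXn2r//;
  by rewrite nnegrE normc_ge0.
move=> z zr; rewrite -!ler_norml.
by rewrite !(le_trans _ zr) ?ler_Re_normc ?ler_Im_normc.
Qed.

Lemma compact_rect (a b c d : R) :
  compact [set x : R * R | a <= Re (x.1 +i* x.2) <= b /\ c <= Im (x.1 +i* x.2) <= d].
Proof.
rewrite (_ : [set x | _] = `[a, b] `*` `[c, d]); last first.
  by apply/seteqP; split=> x /=; rewrite !in_itv.
by apply: compact_setX; exact: segment_compact.
Qed.

Lemma polar w : w != 0 -> exists z, [/\ w = cexp z, Re z = ln (normc w) & `|Im z| <= pi].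
Proof.
move=> w0.
have n0 : 0 < normc w.
  by rewrite lt_def normc_ge0 andbT; apply/eqP => /eq0_normc/eqP; apply/negP.
set r := normc w in n0 *.
have ab : (Re w / r) ^+ 2 + (Im w / r) ^+ 2 = 1.
  by rewrite !exprMn -mulrDl exprVn -/(sqn w) -normc_sqr divff// expf_neq0// gt_eqF.
have a1 : -1 <= Re w / r <= 1.
  by rewrite -ler_norml -(expr_le1 (n := 2))// real_normK ?num_real// -ab lerDl sqr_ge0.
have ac := acosK a1.
have sa : sin (acos (Re w / r)) = `|Im w / r|.
  by rewrite sin_acos// -sqrtr_sqr -ab addrC addKr.
have a0 : 0 <= acos (Re w / r) <= pi by rewrite acos_ge0 ?acos_lepi.
have key (s : R) : `|s| = 1 -> s * `|Im w / r| = Im w / r ->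
    exists z, [/\ w = cexp z, Re z = ln r & `|Im z| <= pi].
  move=> s1 sI; exists (ln r +i* (s * acos (Re w / r))); split=> //=; last first.
    by rewrite normrM s1 mul1r ger0_norm; case/andP: a0.
  rewrite /cexp /= lnK ?posrE//; apply: reim_eq => /=.
    have -> : cos (s * acos (Re w / r)) = Re w / r.
      by move: s1 => /eqP; rewrite eqr_norml ler01 andbT => /orP[] /eqP ->; rewrite ?mul1r ?mulN1r ?cosN ac.
    by rewrite mulrCA divff ?mulr1 ?gt_eqF.
  have -> : sin (s * acos (Re w / r)) = Im w / r.
    rewrite -[RHS]sI -sa.
    by move: s1 => /eqP; rewrite eqr_norml ler01 andbT => /orP[] /eqP ->; rewrite ?mul1r ?mulN1r ?sinN.
  by rewrite mulrCA divff ?mulr1 ?gt_eqF.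
have [i0|i0] := leP 0 (Im w / r).
  by apply: (key 1); rewrite ?normr1 ?mul1r ?ger0_norm.
by apply: (key (-1)); rewrite ?normrN1 ?mulN1r ?ltr0_norm ?opprK.
Qed.

Variables (D : nat) (N : (nat -> R[i]) -> R).
Hypothesis hN : seminorm_on D.+1 N.

Lemma seminorm_ext (v w : nat -> R[i]) : (forall k, (k <= D)%N -> v k = w k) -> N v = N w.
Proof.
move=> vw; apply/eqP; rewrite -subr_eq0 -normr_eq0 eq_le normr_ge0 andbT.
rewrite (le_trans (seminormB hN _ _))//.
case: (hN) => _ _ _ [A A0 NA]; rewrite (le_trans (NA _))// big1 ?mulr0// => k _.
by rewrite vw ?subrr ?normc0// -ltnS.
Qed.

(** The reversed polynomial has coefficients z^(D - k), and N of them at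
z = 1 / w is |w|^(- D) N (w^k). It is bounded on the circle |z| = 1 / rho, so
by the maximum principle on the whole disc. *)
Lemma bernstein_walsh (rho B : R) : 0 < rho ->
  (forall w, normc w = rho -> N (fun k => w ^+ k) <= B) ->
  forall w, rho <= normc w -> N (fun k => w ^+ k) <= (normc w / rho) ^+ D * B.
Proof.
move=> r0 hB w rw.
have NZ : forall a v, N (fun k => a * v k) = normc a * N v by case: hN.
have ri : 0 < rho^-1 by rewrite invr_gt0.
have w0 z : 0 < normc z -> z != 0 by apply: contraTneq => ->; rewrite normc0 ltxx.
have nV z : 0 < normc z -> normc z^-1 = (normc z)^-1.
  move=> z0; apply: (mulfI (lt0r_neq0 z0)).
  by rewrite -normcM divff ?w0// normc1 divff// gt_eqF.
have rev z : z != 0 -> N (fun k => z ^+ k) = normc z ^+ D * N (fun k => z^-1 ^+ (D - k)).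
  move=> z0; rewrite -normc_X -NZ; apply: seminorm_ext => k kD.
  by rewrite exprVn -[in z ^+ D](subnK kD) exprD mulrAC divff ?mul1r// expf_neq0.
have wp : 0 < normc w := lt_le_trans r0 rw.
rewrite rev ?w0// exprMn -mulrA ler_wpM2l ?exprn_ge0 ?(ltW wp)//.
apply: (@max_principle _ _ _ hN (fun k z => z ^+ (D - k)) (fun z => normc z <= rho^-1)).
- exact: compact_disc (ltW ri).
- by move=> z k _; apply: ctaylorX; exact: ctaylor_id.
- move=> z; rewrite le_eqVlt => /orP[/eqP zr|zr]; [left|right].
    have zp : 0 < normc z by rewrite zr.
    have := rev z^-1; rewrite invr_eq0 w0// => /(_ isT); rewrite invrK nV// zr invrK => e.
    have := hB z^-1; rewrite nV// zr invrK => /(_ erefl); rewrite e.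
    by rewrite exprVn ler_pdivlMl// exprn_gt0.
  exists (rho^-1 - normc z) => [|h hr]; first by rewrite subr_gt0.
  by rewrite (le_trans (le_normcD _ _))// addrC -lerBrDr.
- by rewrite nV// lef_pV2 ?posrE.
Qed.

End bernstein_walsh.

(** * Extrapolation from the contraction region *)

Section rectangle.
Context {R : realType}.

Lemma rect_interior (a b c d : R) (z : R[i]) : a < Re z < b -> c < Im z < d ->
  exists2 r : R, 0 < r & forall h, normc h <= r ->
    a <= Re (z + h) <= b /\ c <= Im (z + h) <= d.
Proof.
rewrite -subr_gt0 -[Re z < b]subr_gt0 -[c < _]subr_gt0 -[Im z < d]subr_gt0.
move=> /andP[a0 b0] /andP[c0 d0].
exists (Num.min (Num.min (Re z - a) (b - Re z)) (Num.min (Im z - c) (d - Im z))).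
  by rewrite !lt_min a0 b0 c0.
move=> h; rewrite !le_min => /andP[/andP[h1 h2] /andP[h3 h4]].
have := ler_Re_normc h; have := ler_Im_normc h; rewrite !ler_norml => /andP[i1 i2] /andP[r1 r2].
by rewrite ReD ImD; split; apply/andP; split; lra.
Qed.

End rectangle.

Section extrapolation.
Context {R : realType}.
Local Open Scope complex_scope.
Implicit Types (z h w : R[i]).
Variables (D : nat) (N : (nat -> R[i]) -> R) (s kap B : R).
Hypothesis hN : seminorm_on D.+1 N.
Hypothesis contr : forall z, s ^+ 2 + kap * normc z <= Re z ->
  N (fun k => cexp (- z) ^+ k) <= B.

(** For kap = 0 the region is the half-plane Re z >= s^2, that is
|w| <= e^(- s^2) for w = e^(- z), and w = 1 is reached by
[bernstein_walsh]. *)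
Lemma extrapolate_disc : kap = 0 -> N (fun=> 1) <= expR (s ^+ 2) ^+ D * B.
Proof.
move=> k0.
have := @bernstein_walsh _ _ _ hN (expR (- s ^+ 2)) B (expR_gt0 _) _ 1.
have -> : (fun k => (1 : R[i]) ^+ k) = (fun=> 1) by apply/funext => k; rewrite expr1n.
rewrite normc1 (_ : 1 / expR (- s ^+ 2) = expR (s ^+ 2)); last by rewrite mul1r -expRN opprK.
apply; last first.
  by rewrite expR_le1 oppr_le0 sqr_ge0.
move=> w nw; have w0 : w != 0.
  by apply/eqP => w0; move: (expR_gt0 (- s ^+ 2)); rewrite -nw w0 normc0 ltxx.
have [z [wE Rz _]] := polar w0.
have := contr (z := - z); rewrite opprK -wE; apply.
by rewrite k0 mul0r addr0 ReN Rz nw expRK opprK.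
Qed.

(** A crude bound for the far side of the domain of [extrapolate_wedge]. The
circle |w| = e^-4 consists of the e^(- z) with Re z = 4 and |z| <= 8, which
are in the contraction region since kap <= 1/3 and s^2 <= 1. *)
Lemma big_circle : 0 <= kap -> kap <= 3^-1 -> s ^+ 2 <= 1 ->
  forall w, expR (-4) <= normc w -> normc w <= expR 1 ->
    N (fun k => w ^+ k) <= expR 5 ^+ D * B.
Proof.
move=> k0 k3 s1 w wr wl.
have B0 : 0 <= B.
  apply: le_trans (contr (z := 4%:C) _); first by case: hN.
  by rewrite normcC ger0_norm //=; lra.
have H := @bernstein_walsh _ _ _ hN (expR (-4)) B (expR_gt0 _) _ w wr.
apply: (le_trans (H _)); last first.
  rewrite ler_wpM2r// lerXn2r ?nnegrE ?expR_ge0 ?divr_ge0 ?normc_ge0 ?expR_ge0//.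
  rewrite -expRN opprK (_ : 5 = 1 + 4); last by ring.
  by rewrite [leRHS]expRD ler_wpM2r// expR_ge0.
move=> v nv; have v0 : v != 0.
  by apply/eqP => v0; move: (expR_gt0 (-4 : R)); rewrite -nv v0 normc0 ltxx.
have [z [vE Rz Iz]] := polar v0.
have := contr (z := - z); rewrite opprK -vE; apply.
have R4 : Re z = -4 by rewrite Rz nv expRK.
have pi4 : pi <= 4 :> R by have := @pihalf_lt2 R; lra.
have : normc (- z) <= 8.
  rewrite normcN (le_trans (normc_le_reim _))// R4 normrN ger0_norm//.
  by lra.
move=> /(ler_wpM2l k0); rewrite ReN R4.
by lra.
Qed.

Variables (psi dl : R).
Hypotheses (psi0 : 0 <= psi) (psi1 : psi < pi / 2) (kapE : sin psi = kap).
Hypotheses (k3 : kap <= 3^-1) (dl0 : 0 < dl) (dl1 : dl <= 1).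
Hypothesis s2 : s ^+ 2 = (1 - kap) * dl.

Let b := pi / 2 + psi.
Let al := pi / 2 / b.

Let pi0 := @pi_gt0 R.
Let b0 : 0 < b. Proof. by rewrite /b ltr_wpDr// divr_gt0. Qed.
Let al0 : 0 < al. Proof. by rewrite !divr_gt0. Qed.
Let alb : al * b = pi / 2. Proof. by rewrite /al divfK// gt_eqF. Qed.
Let kap0 : 0 <= kap.
Proof. by rewrite -kapE sin_ge0_pi// psi0/=; have := psi1; have := @pi_gt0 R; lra. Qed.

(* E has nonnegative real part on the strip and real part at least 1 on
   Re eta = 0; there 2 cos phi - cos (2 phi) >= 1 for |phi| <= pi / 2. *)
Let E (eta : R[i]) := 2 * cexp (al%:C * eta) - cexp (al%:C * eta) ^+ 2.
Let M (eta : R[i]) := cexp (- (5 * D%:R) * E eta).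
Let zz (eta : R[i]) := dl%:C - cexp eta.

Let ReE eta : Re (E eta) = expR (al * Re eta) * (2 * cos (al * Im eta)
   - expR (al * Re eta) * (2 * cos (al * Im eta) ^+ 2 - 1)).
Proof.
have r2 (c : R[i]) : Re (2 * c - c ^+ 2) = 2 * Re c - (Re c ^+ 2 - Im c ^+ 2).
  by case: c => x y; rewrite expr2 /=; ring.
rewrite /E r2 Re_cexp Im_cexp ReCM.
have -> : Im (al%:C * eta) = al * Im eta by rewrite ImM ReC ImC mul0r addr0.
have := cos2Dsin2 (al * Im eta); move: (expR _) (cos _) (sin _) => e c t ct.
rewrite !exprMn (_ : t ^+ 2 = 1 - c ^+ 2); last by rewrite -ct addrC addKr.
by ring.
Qed.

Let normcM_E eta : normc (M eta) = expR (- (5 * D%:R) * Re (E eta)).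
Proof.
rewrite /M normc_cexp; congr expR.
by rewrite (_ : - (5 * D%:R) = (- (5 * D%:R) : R)%:C) ?ReCM// rmorphN rmorphM !rmorph_nat.
Qed.

Let cos_al eta : `|Im eta| <= b -> 0 <= cos (al * Im eta) <= 1.
Proof.
move=> hb; rewrite cos_le1 andbT cos_ge0_pihalf// -ler_norml normrM gtr0_norm//.
by rewrite -alb ler_wpM2l// ltW.
Qed.

Let ReE_ge0 eta : Re eta <= 0 -> `|Im eta| <= b -> 0 <= Re (E eta).
Proof.
move=> h0 hb; rewrite ReE; have := cos_al hb; set c := cos _ => /andP[c0 c1].
have : expR (al * Re eta) <= 1 by rewrite expR_le1 mulr_ge0_le0// ltW.
have := expR_ge0 (al * Re eta); move: (expR _) => e e0 e1.
rewrite mulr_ge0// subr_ge0.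
have c2 : c ^+ 2 <= c by rewrite expr2 ler_piMr.
have [h|h] := leP 0 (2 * c ^+ 2 - 1).
  by rewrite (le_trans (ler_piMl h e1))//; lra.
have : e * (2 * c ^+ 2 - 1) <= 0 by rewrite mulr_ge0_le0// ltW.
by lra.
Qed.

Let ReE_ge1 eta : Re eta = 0 -> `|Im eta| <= b -> 1 <= Re (E eta).
Proof.
move=> h0 hb; rewrite ReE; have := cos_al hb; set c := cos _ => /andP[c0 c1].
rewrite h0 mulr0 expR0 !mul1r.
have c2 : c ^+ 2 <= c by rewrite expr2 ler_piMr.
by lra.
Qed.

Let side eta : `|Im eta| = b -> N (fun k => cexp (- zz eta) ^+ k) <= B.
Proof.
move=> hb; apply: contr.
have [cE sE] : cos (Im eta) = - kap /\ sin (Im eta) ^+ 2 = 1 - kap ^+ 2.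
  have -> : sin (Im eta) ^+ 2 = 1 - cos (Im eta) ^+ 2.
    by rewrite -(cos2Dsin2 (Im eta)) addrAC subrr add0r.
  suff -> : cos (Im eta) = - kap by rewrite sqrrN.
  have -> : cos (Im eta) = cos b.
    by rewrite -hb; case: (ger0P (Im eta)) => _; rewrite ?cosN.
  by rewrite /b addrC cosDpihalf kapE.
set u := expR (Re eta); have u0 : 0 <= u by exact: expR_ge0.
have Rz : Re (zz eta) = dl + kap * u by rewrite /zz ReD ReN Re_cexp cE ReC -/u; ring.
have nz : normc (zz eta) <= dl + u.
  rewrite (le_trans (le_normcD _ _))// normcN normc_cexp normcC ger0_norm//.
  exact: ltW.
have := ler_wpM2l kap0 nz; rewrite Rz s2.
by move: (kap) (normc _) => k n; nra.
Qed.

(** The contraction region contains a sector with vertex dl and half-angle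
pi/2 - psi, where sin psi = kap. In the coordinate z = dl - e^eta the
complement of that sector within distance 1 of dl is the half-strip
Re eta <= 0, |Im eta| <= b with b = pi/2 + psi, and z = 0 is eta = ln dl.

On the sides |Im eta| = b the bound B holds. On Re eta = 0 there is only the
bound e^(5 D) B, so the function is multiplied by
exp (- 5 D (2 e^(al eta) - e^(2 al eta))) with al b = pi/2, whose modulus is at
most e^(- 5 D) there and at most 1 on the strip. The maximum principle on
[- S, 0] x [- b, b] with S -> oo gives the bound B inside, and dividing by the
multiplier at eta = ln dl costs at most exp (10 D dl^al). *)
Lemma extrapolate_wedge : N (fun=> 1) <= expR (10 * D%:R * dl `^ al) * B.
Proof.
have NZ : forall a v, N (fun k => a * v k) = normc a * N v by case: hN.
have N0 : forall v, 0 <= N v by case: hN.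
pose Q k (eta : R[i]) := M eta * cexp (- zz eta) ^+ k.
have NQ eta : N (Q ^~ eta) = normc (M eta) * N (fun k => cexp (- zz eta) ^+ k) by exact: NZ.
have cB : N (fun k => cexp (- dl%:C) ^+ k) <= B.
  apply: contr; rewrite normcC ger0_norm ?(ltW dl0)// s2 ReC.
  by move: (kap) => k; nra.
have B0 : 0 <= B by exact: le_trans cB.
have tz (z : R[i]) k : ctaylor (fun z => cexp (- z) ^+ k) z.
  by apply: ctaylorX; apply: ctaylor_cexp; apply: ctaylorN; exact: ctaylor_id.
have tQ (eta : R[i]) k : ctaylor (Q k) eta.
  have ta : ctaylor (fun eta => cexp (al%:C * eta)) eta.
    by apply: ctaylor_cexp; apply: ctaylorM; [exact: ctaylor_cst|exact: ctaylor_id].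
  apply: ctaylorM.
    apply: ctaylor_cexp; apply: ctaylorM; first exact: ctaylor_cst.
    apply: ctaylorD; first by apply: ctaylorM ta; exact: ctaylor_cst.
    by apply: ctaylorN; exact: ctaylorX.
  apply: ctaylorX; apply: ctaylor_cexp; apply: ctaylorN; apply: ctaylorD; first exact: ctaylor_cst.
  by apply: ctaylorN; apply: ctaylor_cexp; exact: ctaylor_id.
have [L L0 hL] := seminorm_lip hN (tz dl%:C).
have L1 : 0 < L + 1 by rewrite ltr_pwDr.
have rect S : 0 < S -> - S <= ln dl -> N (fun=> 1) <= expR (10 * D%:R * dl `^ al) * (B + L * expR (- S)).
  move=> S0 Sd.
  have Pb := pi0.
  have hQ : forall eta, (- S <= Re eta <= 0 /\ - b <= Im eta <= b) -> N (Q ^~ eta) <= B + L * expR (- S).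
    apply: (max_principle hN (compact_rect (a := - S) (b := 0) (c := - b) (d := b))).
      by move=> z k _; exact: tQ.
    move=> z [/andP[z1 z2] /andP[z3 z4]].
    have zb : `|Im z| <= b by rewrite ler_norml z3.
    have LS : 0 <= L * expR (- S) by rewrite mulr_ge0 ?expR_ge0.
    have M1 : normc (M z) <= 1.
      by rewrite normcM_E expR_le1 mulNr oppr_le0 !mulr_ge0 ?ReE_ge0.
    have [e|n4] := eqVneq `|Im z| b.
      left; rewrite NQ (le_trans (ler_piMl (N0 _) M1))// (le_trans (side e))//.
      by rewrite lerDl.
    have [e0|n2] := eqVneq (Re z) 0.
      left; rewrite NQ; apply: (@le_trans _ _ B); last by rewrite lerDl.
      have nw : normc (cexp (- zz z)) <= expR 1.
        rewrite normc_cexp ler_expR ReN /zz ReD ReN ReC Re_cexp e0 expR0 mul1r.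
        by have := cos_le1 (Im z); have := ltW dl0; lra.
      have nw' : expR (-4) <= normc (cexp (- zz z)).
        rewrite normc_cexp ler_expR ReN /zz ReD ReN ReC Re_cexp e0 expR0 mul1r.
        by have := cos_geN1 (Im z); have := dl1; lra.
      have s21 : s ^+ 2 <= 1.
        by rewrite s2 mulr_ile1// ?(ltW dl0)//; have := k3; have := kap0; lra.
      have h5 := big_circle kap0 k3 s21 nw' nw.
      have M2 : normc (M z) <= expR (- (5 * D%:R)).
        rewrite normcM_E ler_expR mulNr lerN2 -[leLHS]mulr1 ler_wpM2l ?mulr_ge0//.
        exact: ReE_ge1.
      apply: (le_trans (ler_pM (normc_ge0 _) (N0 _) M2 h5)).
      rewrite mulrA -expRM_natr -expRD (_ : _ + _ = 0) ?expR0 ?mul1r//; by ring.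
    have [e|n1] := eqVneq (Re z) (- S).
      (* On Re eta = - S the point z is within e^(- S) of dl, where the bound B
         holds. *)
      left; rewrite NQ (le_trans (ler_piMl (N0 _) M1))//.
      have nh : normc (- cexp z) = expR (- S) by rewrite normcN normc_cexp e.
      have := hL (- cexp z); rewrite nh expR_le1 oppr_le0 (ltW S0) => /(_ isT).
      rewrite distrC -/(zz z) => /(le_trans (ler_norm _)).
      by move: cB; lra.
    right.
    apply: rect_interior.
      by rewrite !lt_def n1 z1 [0 == _]eq_sym n2 z2.
    by rewrite -ltr_norml lt_def zb andbT eq_sym n4.
  have := hQ (ln dl)%:C; rewrite ReC ImC Sd ln_le0// oppr_le0 (ltW b0).
  move=> /(_ (conj isT isT)); rewrite NQ.
  have z0 : zz (ln dl)%:C = 0.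
    by rewrite /zz /cexp /= lnK ?posrE// cos0 sin0 mulr0 mulr1 subrr.
  rewrite z0 oppr0 cexp0 (_ : (fun k => _) = (fun=> 1)); last by apply/funext => k; rewrite expr1n.
  rewrite normcM_E ReE ReC ImC mulr0 cos0 expr1n mulr1.
  have -> : expR (al * ln dl) = dl `^ al by rewrite /powR gt_eqF.
  rewrite -ler_pdivlMl ?expR_gt0// -expRN mulNr opprK => /le_trans; apply.
  rewrite ler_wpM2r ?addr_ge0 ?mulr_ge0 ?expR_ge0// ler_expR.
  have := powR_ge0 dl al; move: (_ `^ _) => t t0.
  have := ler0n R D; move: D%:R => d d0.
  have : 0 <= d * (t * t) by rewrite !mulr_ge0.
  by nra.
apply/ler_addgt0Pr => e e0.
pose e' := e / expR (10 * D%:R * dl `^ al).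
have e'0 : 0 < e' by rewrite divr_gt0 ?expR_gt0.
(* Large enough for the strip to contain ln dl and for the error L e^(- S) on its
   far side to be at most e'. *)
pose S := Num.max (Num.max 1 (- ln dl)) (- ln (e' / (L + 1))).
have S1 : 0 < S by rewrite !lt_max ltr01.
have S2 : - S <= ln dl by rewrite lerNl !le_max lexx orbT.
apply: (le_trans (rect S S1 S2)).
rewrite mulrDr lerD2l mulrC -ler_pdivlMr ?expR_gt0// -/e'.
have : expR (- S) <= e' / (L + 1).
  rewrite -[leRHS]lnK ?posrE ?divr_gt0// ler_expR lerNl !le_max lexx !orbT//.
move=> /(ler_wpM2l L0) /le_trans; apply.
by rewrite mulrCA ger_pMr// ler_pdivrMr// mul1r lerDl.
Qed.

End extrapolation.

(** * Hermite expansion of polynomials *)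

Section hermite_expansion.
Context {R : realType}.
Local Open Scope complex_scope.

Lemma He_monic (k : nat) : (size (@He R k) <= k.+1)%N /\ (@He R k)`_k = 1.
Proof.
elim: k => [|k [IH1 IH2]]; first by rewrite size_poly1 coef1.
have sd : (size (He k : {poly R[i]})^`() <= k.+1)%N.
  exact: leq_trans (size_poly _ _) (leq_trans (leq_pred _) IH1).
split.
  rewrite HeS (leq_trans (size_polyD _ _))// geq_max size_polyN (leq_trans sd)// andbT.
  by rewrite (leq_trans (size_polyMleq _ _))// size_polyX.
rewrite HeS coefB coefXM /= IH2 nth_default ?subr0//.
Qed.

Lemma He_span a (p : {poly R[i]}) : (size p <= a)%N ->
  exists e : nat -> R[i], p = \sum_(k < a) e k *: He k.
Proof.
elim: a p => [|a IH] p.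
  rewrite leqn0 size_poly_eq0 => /eqP ->; exists (fun=> 0).
  by rewrite big_ord0.
move=> sp; have [sH lH] := He_monic a.
have [|e pe] := IH (p - p`_a *: He a).
  apply/leq_sizeP => j; rewrite leq_eqVlt => /orP[/eqP <-|aj].
    by rewrite coefB coefZ lH mulr1 subrr.
  rewrite coefB coefZ (nth_default _ (leq_trans sH aj)) mulr0 subr0.
  by rewrite (nth_default _ (leq_trans sp aj)).
exists (fun k => if (k < a)%N then e k else p`_a).
rewrite big_ord_recr/= ltnn.
rewrite -[LHS](subrK (p`_a *: He a)) pe; congr (_ + _).
by apply: eq_bigr => k _; rewrite ltn_ord.
Qed.

Definition complex_eval n (z : 'I_n -> R[i]) (f : mpoly n R) : R[i] := mmap (real_complex R) z f.

Lemma complex_evalE n (z : 'I_n -> R[i]) f :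
  complex_eval z f = \sum_(m <- msupp f) (mcoeff m f)%:C * \prod_(i < n) z i ^+ m i.
Proof. by []. Qed.

Lemma complex_evalX n (z : 'I_n -> R[i]) f k : complex_eval z (f ^+ k) = complex_eval z f ^+ k.
Proof. by rewrite /complex_eval rmorphXn. Qed.

Lemma complex_eval_real n (x : n.-tuple R) f :
  complex_eval (fun i => (tnth x i)%:C) f = (poly_eval f x)%:C.
Proof.
rewrite /poly_eval mevalE complex_evalE rmorph_sum /=; apply: eq_bigr => m _.
rewrite rmorphM rmorph_prod; congr (_ * _); apply: eq_bigr => i _.
by rewrite rmorphXn.
Qed.

Definition mindex (n D : nat) := {ffun 'I_n -> 'I_D.+1}.

Definition mdegree n D (j : mindex n D) : nat := (\sum_i j i)%N.

(** Extension of a multi-index by 0 to all of nat, the format of [tsum]. *)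
Definition mnat n D (j : mindex n D) (i : nat) : nat :=
  oapp (fun i => j i : nat) 0%N (insub i).

Lemma mnatE n D (j : mindex n D) (i : 'I_n) : mnat j i = j i.
Proof. by rewrite /mnat valK. Qed.

Lemma mmono_le n (f : mpoly n R) D m : (msize f <= D.+1)%N -> m \in msupp f ->
  (\sum_i m i <= D)%N.
Proof.
move=> fD mf; rewrite -mdegE -ltnS; exact: leq_trans (msize_mdeg_lt mf) fD.
Qed.

(** Each power of a coordinate is expanded in Hermite polynomials and the
products are distributed; an index that occurs is bounded by the exponent in
each coordinate, hence the total degree does not increase. *)
Lemma hermite_expansion n D (f : mpoly n R) : (msize f <= D.+1)%N ->
  exists c : mindex n D -> R[i], (forall j, (D < mdegree j)%N -> c j = 0) /\
    forall z, complex_eval z f = \sum_j c j * \prod_i (He (j i)).[z i].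
Proof.
move=> fD.
have /choice[e he] a := @He_span a.+1 'X^a (eq_leq (size_polyXn _ a)).
pose e' a k := if (k <= a)%N then e a k else 0.
have xe a (x : R[i]) : (a <= D)%N -> x ^+ a = \sum_(k < D.+1) e' a k * (He k).[x].
  move=> aD; rewrite (_ : x ^+ a = ('X^a).[x]); last by rewrite hornerXn.
  rewrite he horner_sum (big_ord_widen D.+1 (fun k => (e a k *: He k).[x]))//.
  rewrite [LHS]big_mkcond; apply: eq_bigr => k _; rewrite /e' ltnS hornerZ.
  by case: ifP; rewrite ?mul0r.
exists (fun j : mindex n D => \sum_(m <- msupp f) (mcoeff m f)%:C * \prod_i e' (m i) (j i)); split.
  move=> j Dj; rewrite big_seq big1// => m mf.
  have [i ji] : exists i : 'I_n, (m i < j i)%N.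
    apply/existsP; apply: contraLR Dj => /existsPn h; rewrite -leqNgt.
    apply: leq_trans (mmono_le fD mf); apply: leq_sum => i _.
    by rewrite leqNgt h.
  by rewrite (bigD1 i)//= /e' leqNgt ji/= mul0r mulr0.
move=> z; rewrite complex_evalE.
under [RHS]eq_bigr do rewrite mulr_suml.
rewrite exchange_big /= big_seq [RHS]big_seq; apply: eq_bigr => m mf.
under [RHS]eq_bigr do rewrite -mulrA -big_split.
rewrite -mulr_sumr; congr (_ * _).
rewrite -(bigA_distr_bigA (fun (i : 'I_n) (k : 'I_D.+1) => e' (m i) k * (He k).[z i])).
apply: eq_bigr => i _; apply: xe; apply: leq_trans (mmono_le fD mf).
by rewrite (bigD1 i)//= leq_addr.
Qed.

Lemma msize_exp n d (f : mpoly n R) k : (msize f <= d.+1)%N -> (msize (f ^+ k) <= (k * d).+1)%N.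
Proof.
move=> fd; elim: k => [|k IH]; first by rewrite expr0 msize1.
have [->|f0] := eqVneq f 0; first by rewrite expr0n msize0.
rewrite exprS msizeM ?expf_neq0//; move: fd IH; set a := mmeasure _ _; set b := mmeasure _ _; rewrite mulSn.
by move=> h1 h2; have := leq_add h1 h2; rewrite addSn addnS; case: (a + b)%N.
Qed.

End hermite_expansion.

(** * Moments of polynomials at complex Gaussian points *)

Section power_moments.
Context {R : realType} d (T : measurableType d) (P : probability T R).
Local Open Scope complex_scope.
Variables (q : R) (phi : nat -> T -> R[i]).
Hypothesis mphi : forall k, cmeas (phi k).
Hypothesis fphi : forall k, (\int[P]_x (normc (phi k x) `^ q)%:E < +oo)%E.

Lemma cmeas_term n (al : nat -> nat) :
  cmeas (fun x : n.-tuple T => \prod_(i < n) phi (al i) (tnth x i)).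
Proof.
apply: cmeas_prod => i; have [m1 m2] := mphi (al i).
by split; [apply: (measurableT_comp m1)|apply: (measurableT_comp m2)]; exact: measurable_tnth.
Qed.

Lemma integral_term_lty n (al : nat -> nat) :
  (\int[power_prob P n]_x (normc (\prod_(i < n) phi (al i) (tnth x i)) `^ q)%:E < +oo)%E.
Proof.
have ge0 (y : R[i]) : (0 <= (normc y `^ q)%:E)%E by rewrite lee_fin powR_ge0.
elim: n al => [|n IH] al.
  rewrite integral_power_prob0 ?ltry//.
  by apply: measurable_normc_powR; exact: cmeas_term.
rewrite integral_power_probS//; last by apply: measurable_normc_powR; exact: cmeas_term.
pose h x := (normc (phi (al 0%N) x) `^ q)%:E.
pose J := (\int[power_prob P n]_y (normc (\prod_(i < n) phi (al i.+1) (tnth y i)) `^ q)%:E)%E.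
have -> : (\int[P]_x \int[power_prob P n]_y
    (normc (\prod_(i < n.+1) phi (al i) (tnth (tuple_cons (x, y)) i)) `^ q)%:E =
    \int[P]_x (h x * J))%E.
  apply: eq_integral => x _; rewrite /h /J -ge0_integralZl//; last first.
    exact: (measurable_normc_powR q (cmeas_term n (fun i => al i.+1))).
  apply: eq_integral => y _; rewrite big_ord_recl normcM powRM ?normc_ge0// EFinM.
  by congr (_ * (normc _ `^ _)%:E)%E; apply: eq_bigr => i _; rewrite tnthS.
have J0 : (0 <= J)%E by apply: integral_ge0.
rewrite ge0_integralZr//; [|exact: measurable_normc_powR|by move=> x _; exact: ge0].
apply: lte_mul_pinfty; last exact: (IH (fun i => al i.+1)).
- by apply: integral_ge0 => x _; exact: ge0.
- by rewrite ge0_fin_numE; [exact: fphi|apply: integral_ge0 => x _; exact: ge0].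
Qed.

End power_moments.

Section hypercontractivity.
Context {R : realType}.
Local Open Scope complex_scope.
Local Notation MR := (measurableTypeR R).
Local Notation gam := (@gauss_prob R).
Variables (n D : nat) (q s : R).
Hypotheses (q2 : 2 <= q) (q4 : q <= 4).
Variable c : mindex n D -> R[i].
Hypothesis hc : forall j, (D < mdegree j)%N -> c j = 0.

Let q1 : 1 <= q. Proof. by rewrite (le_trans _ q2)// ler1n. Qed.

Let phi k w := (He k).[Wz s w].
Let chi k (x : MR) := (He k : {poly R[i]}).[x%:C].

Let mphi k : cmeas (phi k). Proof. by apply: cmeas_poly; exact: cmeas_Wz. Qed.
Let mchi k : cmeas (chi k). Proof. by apply: cmeas_poly; exact: cmeas_real. Qed.

Let fphi k : (\int[gauss3]_w (normc (phi k w) `^ q)%:E < +oo)%E.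
Proof.
have g1 : ugrowth setT (fun w _ => ((sqn (phi k w))%:C + 1%:C) * ((sqn (phi k w))%:C + 1%:C)).
  have g0 : ugrowth setT (fun w _ => (sqn (phi k w))%:C + 1%:C).
    apply: ugrowthD; last exact: ugrowth_cst.
    by apply: (@ugrowth_cgrowth _ setT s (fun Z => (sqn (He k).[Z])%:C)); exact: cgrowth_sqn.
  exact: ugrowthM.
have m : cmeas (fun w => ((sqn (phi k w))%:C + 1%:C) * ((sqn (phi k w))%:C + 1%:C)).
  by apply: cmeasM; apply: cmeasD; (try exact: cmeas_cst); apply: cmeas_real; exact: measurable_sqn.
have := integral_fune_fin_num measurableT (@ugrowth_integrable _ setT _ 0 I g1 m).
under eq_integral do rewrite rcD rcM ReC.
rewrite fin_numElt => /andP[_]; apply: le_lt_trans.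
apply: ge0_le_integral => //.
- by move=> w _; rewrite lee_fin powR_ge0.
- exact: measurable_normc_powR.
- apply/measurable_EFinP; apply: measurable_funM; apply: measurable_funD => //; exact: measurable_sqn.
move=> w _; rewrite lee_fin powR_sqn -expr2.
have s0 := sqn_ge0 (phi k w).
apply: (@le_trans _ _ ((sqn (phi k w) + 1) `^ (q / 2))).
  by apply: ge0_ler_powR; rewrite ?nnegrE ?lerDl ?(addr_ge0 s0)// divr_ge0// (le_trans _ q2).
rewrite -powR_mulrn ?(addr_ge0 s0)//; apply: ler_powR; first by rewrite lerDr.
by rewrite ler_pdivrMr// -natrM; exact: q4.
Qed.

Let r := index_enum (mindex n D).
Let F (v : nat -> R[i]) : n.-tuple _ -> R[i] := tsum phi r (fun j => c j * v (mdegree j)) (@mnat n D).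
Let mu := power_prob (@gauss3 R) n.
Let N v := fine (LN mu q (F v)).

Let mF v : cmeas (F v). Proof. exact: cmeas_tsum. Qed.

Let term (j : mindex n D) (w : n.-tuple (MR * (MR * MR))) := \prod_(i < n) phi (mnat j i) (tnth w i).

Let term_lty j : (LN mu q (term j) < +oo)%E.
Proof. by rewrite LNE; apply: poweR_lty; exact: integral_term_lty. Qed.

Let mterm j : cmeas (term j).
Proof. exact: cmeas_term. Qed.

Let F_fin v : LN mu q (F v) \is a fin_num.
Proof.
rewrite ge0_fin_numE ?LN_ge0//; apply: LN_sum_lty => // j.
  by apply: cmeasM; [exact: cmeas_cst|exact: mterm].
by rewrite (LNZ mu q1 _ (mterm j)) lte_mul_pinfty// lee_fin normc_ge0.
Qed.

(** By homogeneity in the degree, the multiplier transform depends on z only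
through the D + 1 numbers e^(- k z). *)
Let hermite_seminorm : seminorm_on D.+1 N.
Proof.
split.
- by move=> v; apply: fine_ge0; exact: LN_ge0.
- move=> v w; rewrite -lee_fin EFinD !fineK//.
  rewrite (_ : F _ = (fun x => F v x + F w x)); first exact: (LND mu q1).
  apply/funext => x; rewrite /F /tsum -big_split; apply: eq_bigr => j _ /=.
  by rewrite mulrDr mulrDl.
- move=> a v; apply: EFin_inj; rewrite EFinM !fineK// -(LNZ mu q1)//; congr (LN mu q).
  apply/funext => x; rewrite /F /tsum mulr_sumr; apply: eq_bigr => j _.
  by rewrite mulrCA -!mulrA.
pose A j := normc (c j) * fine (LN mu q (term j)).
have A0 j : 0 <= A j by rewrite mulr_ge0 ?normc_ge0// fine_ge0// LN_ge0.
exists (\sum_j A j) => [|v]; first by apply: sumr_ge0.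
have H : N v <= \sum_j A j * normc (v (mdegree j)).
  rewrite -lee_fin fineK// (le_trans (LN_sum mu q1 _ _))//.
    by move=> j; apply: cmeasM; [exact: cmeas_cst|exact: mterm].
  rewrite -sumEFin; apply: lee_sum => j _; rewrite (LNZ mu q1 _ (mterm j)) normcM /A !EFinM fineK//.
    by rewrite muleAC.
  by rewrite ge0_fin_numE ?LN_ge0.
apply: (le_trans H); rewrite mulr_suml; apply: ler_sum => j _.
have [jD|jD] := leqP (mdegree j) D; last first.
  by rewrite {1}/A hc// normc0 !mul0r mulr_ge0// sumr_ge0// => k _; exact: normc_ge0.
rewrite ler_wpM2l// (bigD1 (inord (mdegree j)))//= inordK// lerDl.
by apply: sumr_ge0 => k _; exact: normc_ge0.
Qed.

Let G := tsum chi r c (@mnat n D) : n.-tuple MR -> R[i].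
Let nu := power_prob gam n.

Hypothesis Gfin : (LN nu q G < +oo)%E.

(** The factor e^(- |j| z) is the product over the coordinates of
e^(- j_i z), so that [hermite_flow] tensorizes. *)
Let contraction z : q * s ^+ 2 + (q - 2) * normc z <= q * Re z ->
  N (fun k => cexp (- z) ^+ k) <= fine (LN nu q G).
Proof.
move=> hz.
have Gf : LN nu q G \is a fin_num by rewrite ge0_fin_numE ?LN_ge0.
rewrite -lee_fin !fineK// !LNE.
pose phi' k w := cexp (- (k%:R * z)) * phi k w.
have mphi' k : cmeas (phi' k) by apply: cmeasM; [exact: cmeas_cst|exact: mphi].
have H K (e : nat -> R[i]) :
    (\int[gauss3]_w (normc (\sum_(k < K) e k * phi' k w) `^ q)%:E <=
     \int[gam]_x (normc (\sum_(k < K) e k * chi k x) `^ q)%:E)%E.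
  under eq_integral do under eq_bigr do rewrite mulrA.
  exact: hermite_flow.
have FE w : F (fun k => cexp (- z) ^+ k) w = tsum phi' r c (@mnat n D) w.
  apply: eq_bigr => j _; rewrite /phi' big_split /= mulrA; congr (_ * _ * _).
  rewrite /mdegree -prodrXr; apply: eq_bigr => i _.
  by rewrite mnatE -mulrN cexpMn.
apply: gt0_ler_poweR.
- by rewrite invr_ge0 (le_trans _ q1).
- by rewrite in_itv/= leey andbT; apply: integral_ge0 => x _; rewrite lee_fin powR_ge0.
- by rewrite in_itv/= leey andbT; apply: integral_ge0 => x _; rewrite lee_fin powR_ge0.
under eq_integral do rewrite FE.
exact: (tensorization mphi' mchi H).
Qed.

(** The hypothesis on M isolates the complex analysis: M is any constant by
which the bound on the contraction region extrapolates to z = 0, whatever the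
seminorm. *)
Lemma hypercontractivity M : 
  (forall N' B, seminorm_on D.+1 N' ->
    (forall z, q * s ^+ 2 + (q - 2) * normc z <= q * Re z ->
      N' (fun k => cexp (- z) ^+ k) <= B) -> N' (fun=> 1) <= M * B) ->
  (LN mu q (tsum phi r c (@mnat n D)) <= M%:E * LN nu q G)%E.
Proof.
move=> hM; have Gf : LN nu q G \is a fin_num by rewrite ge0_fin_numE ?LN_ge0.
have := hM _ _ hermite_seminorm contraction.
rewrite -lee_fin EFinM !fineK// (_ : F _ = tsum phi r c (@mnat n D))//.
by apply/funext => w; apply: eq_bigr => j _; rewrite mulr1.
Qed.

End hypercontractivity.

(** * Bessel inequality for one complex Gaussian variable *)

Section bessel.
Context {R : realType}.
Local Open Scope complex_scope.
Local Notation MR := (measurableTypeR R).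
Implicit Types (p : {poly R[i]}) (b : R[i]) (w : MR * (MR * MR)).

Let Z w : R[i] := w.2.1 +i* w.2.2.

Let m1 : measurable_fun setT (fun w => w.2.1).
Proof. by apply: (measurableT_comp measurable_fst); exact: measurable_snd. Qed.

Let m2 : measurable_fun setT (fun w => w.2.2).
Proof. by apply: (measurableT_comp measurable_snd); exact: measurable_snd. Qed.

Let cZ : cmeas Z. Proof. by split. Qed.

Let boundZ f : cgrowth 2 f ->
  exists C N, 0 <= C /\ forall w, normc (f (Z w)) <= C * rho w ^+ N.
Proof.
move=> [C [N [C0 fC]]]; exists C, N; split=> // w; apply: fC; first exact: rho_ge1.
rewrite (le_trans (normc_le_reim _))//= mulr2n mulrDl mul1r.
by have [_ h1 h2] := rho_coord w; rewrite lerD.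
Qed.

Let intZ f : cgrowth 2 f -> cmeas (fun w => f (Z w)) ->
  gauss3.-integrable setT (fun w => (Re (f (Z w)))%:E).
Proof.
move=> /boundZ [C [N [_ fC]]] [mf _]; apply: (gauss3_integrable_dom mf (C := C) (N := N)) => w.
by rewrite (le_trans (ler_Re_normc _)).
Qed.

Let gp p b : cgrowth 2 (fun z => b * p.[z]).
Proof. by apply: cgrowthM; [exact: cgrowth_cst|apply: cgrowth_poly]. Qed.

Let gsq p : cgrowth 2 (fun z => (sqn p.[z])%:C).
Proof.
apply: (@cgrowth_le _ _ _ (fun z => p.[z] * (p.[z])^*)).
  by apply: cgrowthM; [apply: cgrowth_poly|apply: cgrowthJ; apply: cgrowth_poly].
by move=> z; rewrite normcM normcJ normcC -expr2 normc_sqr ger0_norm ?sqn_ge0.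
Qed.

Let mp p b : cmeas (fun w => b * p.[Z w]).
Proof. by apply: cmeasM; [exact: cmeas_cst|exact: cmeas_poly]. Qed.

Let L p b : R := \int[gauss3]_w Re (b * p.[Z w]).

Let line p b k (e : R[i]) t : is_cder k t e ->
  is_derive t (1 : R) (fun x => Re (b * p.[k x])) (Re (b * e * p^`().[k t])).
Proof.
move=> ke; have [+ _] := is_cderM (is_cder_cst b t) (is_cder_poly p ke).
by rewrite mul0r add0r [p^`().[_] * _]mulrC mulrA.
Qed.

Let cline p b (e : R[i]) k : (forall t, is_cder k t e) ->
  continuous (fun x => Re (b * p.[k x])).
Proof.
move=> ke t; have [hh _] := line p b (ke t).
by apply: differentiable_continuous; apply/derivable1_diffP.
Qed.

Let c2 (x y : R) t : is_cder (fun a : R => Z (x, (a, y))) t 1.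
Proof. by split; rewrite /Z /=; [exact: is_derive_id|exact: is_derive_cst]. Qed.

Let c3 (x a : R) t : is_cder (fun y : R => Z (x, (a, y))) t 'i.
Proof. by split; rewrite /Z /=; [exact: is_derive_cst|exact: is_derive_id]. Qed.

Let bounds p b (e : R[i]) : exists C N,
  (forall w, `|Re (b * p.[Z w])| <= C * rho w ^+ N) /\
  (forall w, `|Re (b * e * p^`().[Z w])| <= C * rho w ^+ N).
Proof.
have [C [N [C0 h1]]] := boundZ (gp p b).
have [C' [N' [C'0 h2]]] := boundZ (gp p^`() (b * e)).
have H w : C * rho w ^+ N <= (C + C') * rho w ^+ (N + N').
  by apply: ler_pM; rewrite ?exprn_ge0 ?(le_trans ler01 (rho_ge1 w)) ?lerDl// ler_weXn2l ?rho_ge1// leq_addr.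
have H' w : C' * rho w ^+ N' <= (C + C') * rho w ^+ (N + N').
  by apply: ler_pM; rewrite ?exprn_ge0 ?(le_trans ler01 (rho_ge1 w)) ?lerDr// ler_weXn2l ?rho_ge1// leq_addl.
exists (C + C'), (N + N')%N; split=> w; rewrite (le_trans (ler_Re_normc _))//.
  by rewrite (le_trans (h1 w)).
by rewrite (le_trans (h2 w)).
Qed.

Let ibp2 p b : \int[gauss3]_w (w.2.1 * Re (b * p.[Z w])) = L p^`() b.
Proof.
have [C [N [uC vC]]] := bounds p b 1; rewrite /L /Rintegral; congr fine.
rewrite -[b in RHS]mulr1.
apply: (gauss3_ibp2 (mp p b).1 (mp p^`() (b * 1)).1 uC vC) => [x a y|x y].
  exact: line.
by apply: (@cline p^`() (b * 1) 1 (fun a : R => Z (x, (a, y)))) => t; exact: c2.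
Qed.

Let ibp3 p b : \int[gauss3]_w (w.2.2 * Re (b * p.[Z w])) = L p^`() (b * 'i).
Proof.
have [C [N [uC vC]]] := bounds p b 'i; rewrite /L /Rintegral; congr fine.
apply: (gauss3_ibp3 (mp p b).1 (mp p^`() (b * 'i)).1 uC vC) => [x a y|x a].
  exact: line.
by apply: (@cline p^`() (b * 'i) 'i (fun y : R => Z (x, (a, y)))) => t; exact: c3.
Qed.

Let int1 p b : gauss3.-integrable setT (fun w => (w.2.1 * Re (b * p.[Z w]))%:E).
Proof.
rewrite (_ : (fun w => _) = (fun w => (Re ((Re (Z w))%:C * (b * p.[Z w])))%:E)); last first.
  by apply/funext => w; rewrite ReCM.
apply: (@intZ (fun z => (Re z)%:C * (b * p.[z]))).
  apply: cgrowthM; last exact: gp.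
  by apply: cgrowth_Re; have := gp 'X 1; under eq_fun do rewrite mul1r hornerX.
by apply: cmeasM; [exact: cmeas_real|exact: mp].
Qed.

Let int2 p b : gauss3.-integrable setT (fun w => (w.2.2 * Re (b * p.[Z w]))%:E).
Proof.
rewrite (_ : (fun w => _) = (fun w => (Re ((Re (- 'i * Z w))%:C * (b * p.[Z w])))%:E)); last first.
  by apply/funext => w; rewrite ReCM /=; congr (_ * _)%:E; ring.
apply: (@intZ (fun z => (Re (- 'i * z))%:C * (b * p.[z]))).
  apply: cgrowthM; last exact: gp.
  by apply: cgrowth_Re; have := gp 'X (- 'i); under eq_fun do rewrite hornerX.
apply: cmeasM; last exact: mp.
apply: cmeas_real; rewrite (_ : (fun w => _) = (fun w => w.2.2))//.
by apply/funext => w /=; ring.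
Qed.

Let intL p b : gauss3.-integrable setT (fun w => (Re (b * p.[Z w]))%:E).
Proof. by apply: (intZ (gp p b)); exact: mp. Qed.

Let L_mulX p b : L ('X * p) b = 0.
Proof.
rewrite /L (_ : (fun w => _) = (fun w => w.2.1 * Re (b * p.[Z w]) + w.2.2 * Re (b * 'i * p.[Z w]))); last first.
  by apply/funext => w; rewrite hornerM hornerX; case: b => b1 b2; case: (p.[_]) => x y /=; ring.
rewrite RintegralD//; [|exact: int1|exact: int2].
rewrite (ibp2 p b) (ibp3 p (b * 'i)) /L -RintegralD//; [|exact: intL|exact: intL].
rewrite (_ : (fun w => _) = (fun=> 0)) ?Rintegral0//.
  by rewrite Rintegral_cst// mul0r.
by apply/funext => w; case: b => b1 b2; case: (p^`().[_]) => x y /=; ring.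
Qed.

Let L_eval p b : L p b = Re (b * p.[0]).
Proof.
elim/poly_ind: p => [|p c _].
  rewrite /L; under eq_Rintegral do rewrite horner0 mulr0.
  by rewrite horner0 mulr0 Rintegral_cst// mul0r.
have -> : L (p * 'X + c%:P) b = L ('X * p) b + L c%:P b.
  rewrite /L -RintegralD//; [|exact: intL|exact: intL].
  by apply: eq_Rintegral => w _; rewrite hornerD mulrDr ReD ['X * p]mulrC.
rewrite L_mulX add0r hornerMXaddC mulr0 add0r /L.
under eq_Rintegral do rewrite hornerC.
by rewrite Rintegral_cst// [X in fine X](_ : _ = 1%E) ?mulr1//; exact: probability_setT.
Qed.

Let LJ_eval p b : \int[gauss3]_w Re (b * (p.[Z w] * (Z w)^*)) = 2 * Re (b * p^`().[0]).
Proof.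
rewrite (_ : (fun w => _) = (fun w => w.2.1 * Re (b * p.[Z w]) + w.2.2 * Re (b * - 'i * p.[Z w]))); last first.
  by apply/funext => w; case: b => b1 b2; case: (p.[_]) => x y /=; ring.
rewrite RintegralD//; [|exact: int1|exact: int2].
rewrite (ibp2 p b) (ibp3 p (b * - 'i)) !L_eval mulrDl mul1r; congr (_ + Re (_ * _)).
by rewrite mulrN mulNr -mulrA -expr2 sqr_i mulrN1 opprK.
Qed.

Let bessel3 p : ((sqn p.[0] + 2 * sqn p^`().[0])%:E <= \int[gauss3]_w (sqn p.[Z w])%:E)%E.
Proof.
pose a0 := p.[0]; pose a1 := p^`().[0].
(* |h|^2 >= 2 Re (h conj l) - |l|^2 = Re (conj l * g (zeta)), g = 2 h - l. *)
pose g := p + p - (a0%:P + a1%:P * 'X).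
have g0 : g.[0] = a0.
  by rewrite /g !hornerE /a0; ring.
have g1 : g^`().[0] = a1.
  by rewrite /g derivB !derivD derivC derivM derivC derivX !hornerE /a1; ring.
have J0 (b c : R[i]) w : Re (b * (c * (Z w)^*)) = w.2.1 * Re (b * c) + w.2.2 * Re (b * - 'i * c).
  by case: b c => b1 b2 [x y] /=; ring.
have J w := J0 (a1^*) g.[Z w] w.
have iJ : gauss3.-integrable setT (fun w => (Re (a1^* * (g.[Z w] * (Z w)^*)))%:E).
  by under eq_fun do rewrite J EFinD; exact: integrableD.
have iK : gauss3.-integrable setT
    (fun w => (Re (a0^* * g.[Z w]) + Re (a1^* * (g.[Z w] * (Z w)^*)))%:E).
  by under eq_fun do rewrite EFinD; exact: integrableD.
have -> : sqn a0 + 2 * sqn a1 = \int[gauss3]_w (Re (a0^* * g.[Z w]) + Re (a1^* * (g.[Z w] * (Z w)^*))).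
  rewrite RintegralD//; last exact: intL.
  rewrite (LJ_eval g (a1^*)) -/(L g a0^*) L_eval g0 g1.
  have e (x : R[i]) : sqn x = Re (x^* * x) by case: x => x y; rewrite /sqn /=; ring.
  by rewrite !e.
rewrite /Rintegral fineK; last exact: integrable_fin_num.
have isq : gauss3.-integrable setT (fun w => (sqn p.[Z w])%:E).
  apply: (@intZ (fun z => (sqn p.[z])%:C)); first exact: gsq.
  by apply: cmeas_real; apply: measurable_sqn; exact: cmeas_poly.
apply: le_integral => // w _; rewrite lee_fin.
have H (P z x y : R[i]) :
    Re (x^* * (P + P - (x + y * z))) + Re (y^* * ((P + P - (x + y * z)) * z^*)) <= sqn P.
  case: P z x y => h1 h2 [z1 z2] [x1 x2] [y1 y2]; rewrite /sqn /= -subr_ge0.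
  rewrite (_ : _ - _ = (h1 - x1 - (y1 * z1 - y2 * z2)) ^+ 2 +
    (h2 - x2 - (y1 * z2 + y2 * z1)) ^+ 2); last by ring.
  by rewrite addr_ge0 ?sqr_ge0.
have -> : g.[Z w] = p.[Z w] + p.[Z w] - (a0 + a1 * Z w) by rewrite /g !hornerE.
exact: H.
Qed.

Definition zeta (w : MR * MR) : R[i] := w.1 +i* w.2.

(** Compare |h|^2 with 2 Re (h conj l) - |l|^2, where l is the linear part of
h. Integration by parts gives E p(zeta) = p(0) and
E (p(zeta) conj zeta) = 2 p'(0) for every polynomial p, which
computes the expectation of the lower bound. *)
Lemma bessel1 p :
  ((sqn p.[0] + 2 * sqn p^`().[0])%:E <= \int[gauss2]_w (sqn p.[zeta w])%:E)%E.
Proof.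
apply: (le_trans (bessel3 p)); rewrite /gauss3 fubini_tonelli2//; last 2 first.
- apply/measurable_EFinP; apply: measurable_sqn; apply: cmeas_poly; exact: cZ.
- by move=> w; rewrite lee_fin sqn_ge0.
rewrite le_eqVlt; apply/orP; left; apply/eqP; apply: eq_integral => y _.
rewrite /fubini_G /Z /= -/(zeta y) integral_cst//=.
by rewrite [X in (_ * X)%E](_ : _ = 1%E) ?mule1//; exact: probability_setT.
Qed.

End bessel.

(** * Bessel inequality in several variables *)

Section bessel_tensor.
Context {R : realType}.
Local Open Scope complex_scope.
Local Notation MR := (measurableTypeR R).

Definition zpow (k : nat) (w : MR * MR) : R[i] := zeta w ^+ k.

Lemma cmeas_zpow k : cmeas (zpow k).
Proof.
rewrite (_ : zpow k = (fun w => 'X^k.[zeta w])).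
  by apply: cmeas_poly; split; [exact: measurable_fst|exact: measurable_snd].
by apply/funext => w; rewrite hornerXn.
Qed.

Section coefs.
Variables (I : eqType).
Implicit Types (r : seq I) (c : I -> R[i]) (al : I -> nat -> nat).

(** The coefficients of the monomials of degree 0 and 1 in a [tsum] of powers;
only the values al j i with i < n count. *)
Definition coef0 n r c al : R[i] := \sum_(j <- r | [forall i : 'I_n, al j i == 0%N]) c j.
Definition coef1 n r c al (l : 'I_n) : R[i] :=
  \sum_(j <- r | [forall i : 'I_n, al j i == (i == l) :> nat]) c j.

Lemma forall_ordS n (P : 'I_n.+1 -> bool) :
  [forall i, P i] = P ord0 && [forall i : 'I_n, P (lift ord0 i)].
Proof.
apply/forallP/andP => [h|[h0 /forallP h] i]; first by split => //; apply/forallP.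
by have [j ->|->] := unliftP ord0 i.
Qed.

Let tl al := fun j i => al j i.+1.
Let sl r al k := [seq j <- r | al j 0%N == k].

Let coef0S n r c al : coef0 n.+1 r c al = coef0 n (sl r al 0) c (tl al).
Proof.
rewrite /coef0 /sl big_filter_cond; apply: eq_bigl => j.
by rewrite forall_ordS.
Qed.

Let coef1S n r c al l : coef1 r c al (lift ord0 l : 'I_n.+1) = coef1 (sl r al 0) c (tl al) l.
Proof.
rewrite /coef1 /sl big_filter_cond; apply: eq_bigl => j.
by rewrite forall_ordS; congr (_ && _); apply: eq_forallb => i; rewrite (inj_eq lift_inj).
Qed.

Let coef10 n r c al : coef1 r c al (ord0 : 'I_n.+1) = coef0 n (sl r al 1) c (tl al).
Proof.
rewrite /coef1 /coef0 /sl big_filter_cond; apply: eq_bigl => j.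
by rewrite forall_ordS; congr (_ && _); apply: eq_forallb => i.
Qed.

(** Induction on n: [bessel1] in the first coordinate leaves the coefficients
of degree 0 and 1 in that coordinate, to which the induction hypothesis
applies. *)
Lemma bessel n r c al :
  ((sqn (coef0 n r c al) + 2 * \sum_(l < n) sqn (coef1 r c al l))%:E <=
   \int[power_prob gauss2 n]_y (sqn (tsum zpow r c al y))%:E)%E.
Proof.
have mt m r' c' al' : measurable_fun setT (fun y : m.-tuple _ => (sqn (tsum zpow r' c' al' y))%:E).
  by apply/measurable_EFinP; apply: measurable_sqn; apply: cmeas_tsum; exact: cmeas_zpow.
have s0 (y : R[i]) : (0 <= (sqn y)%:E)%E by rewrite lee_fin sqn_ge0.
elim: n r c al => [|n IH] r c al.
  rewrite big_ord0 mulr0 addr0 integral_power_prob0// /tsum /coef0 lee_fin.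
  rewrite le_eqVlt; apply/orP; left; apply/eqP; congr sqn.
  under [RHS]eq_bigr do rewrite big_ord0 mulr1.
  by apply: eq_bigl => j; apply/forallP => -[].
rewrite integral_power_probS//.
pose p y : {poly R[i]} :=
  \sum_(j <- r) (c j * \prod_(i < n) zpow (tl al j i) (tnth y i)) *: 'X^(al j 0%N).
have pE y w : tsum zpow r c al (tuple_cons (w, y)) = (p y).[zeta w].
  rewrite tsumS /p horner_sum; apply: eq_bigr => j _.
  by rewrite hornerZ hornerXn mulrAC.
have p0 y : (p y).[0] = tsum zpow (sl r al 0) c (tl al) y.
  rewrite /p horner_sum /tsum /sl big_filter [RHS]big_mkcond; apply: eq_bigr => j _.
  rewrite hornerZ hornerXn expr0n; case: eqP => _; by rewrite ?mulr1 ?mulr0.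
have p1 y : (p y)^`().[0] = tsum zpow (sl r al 1) c (tl al) y.
  rewrite /p deriv_sum horner_sum /tsum /sl big_filter [RHS]big_mkcond; apply: eq_bigr => j _.
  rewrite derivZ derivXn hornerZ hornerMn hornerXn expr0n.
  by case: (al j 0%N) => [|[|k]] /=; rewrite ?mulr0n ?mulr1n ?mul0rn ?mulr1 ?mulr0.
have mpz : measurable_fun setT (fun z : (MR * MR) * n.-tuple _ => (sqn (p z.2).[zeta z.1])%:E).
  rewrite (_ : (fun z => _) = (fun z => (sqn (tsum zpow r c al (tuple_cons z)))%:E)); last first.
    by apply/funext => -[w y]; rewrite pE.
  by apply: (measurableT_comp (mt _ _ _ _)); exact: measurable_tuple_cons.
rewrite (_ : (\int[_]_x \int[_]_y _)%E =
  (\int[power_prob gauss2 n]_y \int[gauss2]_w (sqn (p y).[zeta w])%:E)%E); last first.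
  under eq_integral do under eq_integral do rewrite pE.
  exact: (@fubini_tonelli _ _ _ _ _ gauss2 (power_prob gauss2 n) _ mpz).
apply: (@le_trans _ _ (\int[power_prob gauss2 n]_y
    ((sqn (tsum zpow (sl r al 0) c (tl al) y))%:E +
     2%:E * (sqn (tsum zpow (sl r al 1) c (tl al) y))%:E))%E); last first.
  apply: ge0_le_integral; first exact: measurableT.
  - by move=> y _; rewrite adde_ge0// mule_ge0.
  - by apply: emeasurable_funD; [exact: mt|apply: measurable_funeM; exact: mt].
  - by apply: (measurable_fun_fubini_tonelli_G (m1 := gauss2) _ mpz).
  - by move=> y _; rewrite -p0 -p1 -EFinM -EFinD; exact: bessel1.
pose g k (y : n.-tuple (MR * MR)) := (sqn (tsum zpow (sl r al k) c (tl al) y))%:E.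
have mg k : measurable_fun setT (g k) by exact: mt.
have mg2 : measurable_fun setT (fun y => (2%:E * g 1%N y)%E) by exact: measurable_funeM.
have g0 k y : (0 <= g k y)%E by exact: s0.
have g20 y : (0 <= 2%:E * g 1%N y)%E by exact: mule_ge0.
rewrite (ge0_integralD _ measurableT (fun y _ => g0 0%N y) (mg 0%N) (fun y _ => g20 y) mg2).
rewrite (ge0_integralZl _ measurableT (mg 1%N) (fun y _ => g0 1%N y))//.
apply: (@le_trans _ _ ((sqn (coef0 n (sl r al 0) c (tl al)) +
    2 * \sum_(l < n) sqn (coef1 (sl r al 0) c (tl al) l))%:E +
   2%:E * (sqn (coef0 n (sl r al 1) c (tl al)))%:E)%E); last first.
  apply: leeD; first exact: IH.
  rewrite lee_pmul2l//; apply: le_trans (IH _ _ _).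
  by rewrite lee_fin lerDl mulr_ge0// sumr_ge0// => l _; exact: sqn_ge0.
rewrite -EFinM -EFinD lee_fin coef0S big_ord_recl coef10.
under eq_bigr do rewrite coef1S.
by rewrite le_eqVlt; apply/orP; left; apply/eqP; ring.
Qed.

End coefs.
End bessel_tensor.

Section split_power.
Context {R : realType} d1 d2 (T1 : measurableType d1) (T2 : measurableType d2).
Variables (P : probability T1 R) (Q : probability T2 R).

Definition tzip n (x : n.-tuple T1) (y : n.-tuple T2) : n.-tuple (T1 * T2) :=
  [tuple (tnth x i, tnth y i) | i < n].

Lemma measurable_tzip n :
  measurable_fun setT (fun z : n.-tuple T1 * n.-tuple T2 => tzip z.1 z.2).
Proof.
apply/measurable_fun_tnthP => i /=.
rewrite (_ : _ \o _ = fun z => (tnth z.1 i, tnth z.2 i)); last first.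
  by apply/funext => z /=; rewrite tnth_mktuple.
apply/measurable_fun_pairP; split => /=.
  by apply: (measurableT_comp (measurable_tnth i)); exact: measurable_fst.
by apply: (measurableT_comp (measurable_tnth i)); exact: measurable_snd.
Qed.

Lemma tzip_cons n a (x : n.-tuple T1) b (y : n.-tuple T2) :
  tzip (tuple_cons (a, x)) (tuple_cons (b, y)) = tuple_cons ((a, b), tzip x y).
Proof.
apply: eq_from_tnth => i; rewrite tnth_mktuple.
by have [j ->|->] := unliftP ord0 i; rewrite ?tnthS ?tnth_mktuple.
Qed.

(** A power of a product measure is the product of the powers, up to the
order of the coordinates: Tonelli moves the first coordinate of the second
factor past the remaining ones of the first. *)
Lemma integral_power_split n (f : n.-tuple (T1 * T2) -> \bar R) :
  (forall z, 0 <= f z)%E -> measurable_fun setT f ->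
  (\int[power_prob (P \x Q)%E n]_z f z =
   \int[power_prob P n]_x \int[power_prob Q n]_y f (tzip x y))%E.
Proof.
elim: n f => [|n IH] f f0 mf.
  have mf2 : measurable_fun setT (fun z : 0.-tuple T1 * 0.-tuple T2 => f (tzip z.1 z.2)).
    by apply: (measurableT_comp mf); exact: measurable_tzip.
  rewrite integral_power_prob0//.
  rewrite (_ : (fun x => _) = (fun=> f [tuple])).
    by rewrite integral_power_prob0.
  apply/funext => x; rewrite integral_power_prob0//; first by congr f; rewrite !tuple0.
  exact: (measurableT_comp mf2 (pair1_measurable x)).
have mf2 : measurable_fun setT (fun z : n.+1.-tuple T1 * n.+1.-tuple T2 => f (tzip z.1 z.2)).
  by apply: (measurableT_comp mf); exact: measurable_tzip.
have mc : measurable_fun setT (fun z => f (tuple_cons z)).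
  by apply: (measurableT_comp mf); exact: measurable_tuple_cons.
have mF := measurable_fun_fubini_tonelli_F (m2 := power_prob (P \x Q)%E n) _ mc (fun _ => f0 _).
rewrite integral_power_probS// fubini_tonelli1//; last by move=> z; apply: integral_ge0.
rewrite integral_power_probS; first last.
- exact: (measurable_fun_fubini_tonelli_F (m2 := power_prob Q n.+1) _ mf2).
- by move=> x; apply: integral_ge0.
apply: eq_integral => a _; rewrite /fubini_F /=.
under eq_integral => b _.
  rewrite IH//; last exact: (measurableT_comp mc (pair1_measurable _)).
  over.
under [RHS]eq_integral => x _.
  rewrite integral_power_probS//; last exact: (measurableT_comp mf2 (pair1_measurable _)).
  under eq_integral => b _.
    under eq_integral => y _ do rewrite tzip_cons.
    over.
  over.
rewrite /=.
have m3 : measurable_fun setT (fun z : (T2 * n.-tuple T1) * n.-tuple T2 =>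
    f (tuple_cons ((a, z.1.1), tzip z.1.2 z.2))).
  have e11 : measurable_fun setT (fun z : (T2 * n.-tuple T1) * n.-tuple T2 => z.1.1).
    by apply: (measurableT_comp measurable_fst); exact: measurable_fst.
  have e12 : measurable_fun setT (fun z : (T2 * n.-tuple T1) * n.-tuple T2 => z.1.2).
    by apply: (measurableT_comp measurable_snd); exact: measurable_fst.
  apply: (measurableT_comp mc (g := fun z : (T2 * n.-tuple T1) * n.-tuple T2 => ((a, z.1.1), tzip z.1.2 z.2))).
  apply: measurable_fun_pair; first exact: measurable_fun_pair.
  apply: (measurableT_comp (@measurable_tzip n) (g := fun z : (T2 * n.-tuple T1) * n.-tuple T2 => (z.1.2, z.2))).
  exact: measurable_fun_pair.
apply: (@fubini_tonelli _ _ _ _ _ Q (power_prob P n) _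
  (measurable_fun_fubini_tonelli_F (m2 := power_prob Q n) _ m3 (fun _ => f0 _))) => z.
by apply: integral_ge0.
Qed.

End split_power.

(** * The gradient and complex Gaussian shifts *)

Section gradient.
Context {R : realType}.
Local Open Scope complex_scope.
Local Notation MR := (measurableTypeR R).
Local Notation gam := (@gauss_prob R).

(** Integrate the tangent line of x^a at x = L; the integrals may be
infinite. *)
Lemma jensen_powR d (T : measurableType d) (mu : probability T R) (g : T -> R) (a L : R) :
  1 <= a -> 0 <= L -> measurable_fun setT g -> (forall x, 0 <= g x) ->
  (L%:E <= \int[mu]_x (g x)%:E)%E -> ((L `^ a)%:E <= \int[mu]_x (g x `^ a)%:E)%E.
Proof.
move=> a1 L0 mg g0 Lg.
have mga : measurable_fun setT (fun x => (g x `^ a)%:E).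
  by apply/measurable_EFinP; apply: (measurableT_comp (measurable_powR a)).
have [->|Ln0] := eqVneq L 0.
  rewrite powR0; last by rewrite gt_eqF// (lt_le_trans ltr01).
  by apply: integral_ge0 => x _; rewrite lee_fin powR_ge0.
have Lp : 0 < L by rewrite lt_def Ln0.
have b0 : 0 <= a * L `^ (a - 1) by rewrite mulr_ge0 ?powR_ge0// (le_trans ler01).
pose c := a * L `^ (a - 1) * L.
have c0 : 0 <= c by exact: mulr_ge0.
have intc (r : R) : (\int[mu]_x (fun=> r%:E) x = r%:E)%E.
  by rewrite integral_cst//= [X in (_ * X)%E](_ : _ = 1%E) ?mule1//; exact: probability_setT.
have H : (\int[mu]_x ((L `^ a)%:E + (a * L `^ (a - 1))%:E * (g x)%:E) <=
          \int[mu]_x ((g x `^ a)%:E + (fun=> c%:E) x))%E.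
  apply: ge0_le_integral => //.
  - by move=> x _; rewrite -EFinM -EFinD lee_fin; apply: addr_ge0; [exact: powR_ge0|exact: mulr_ge0].
  - by apply: emeasurable_funD => //; apply: measurable_funeM; exact/measurable_EFinP.
  - exact: emeasurable_funD.
  - move=> x _; rewrite /= -EFinM -!EFinD lee_fin /c.
    by have := @powR_tangent _ (g x) L a (g0 x) Lp a1; rewrite mulrBr; lra.
rewrite ge0_integralD// in H; first last.
- by apply: measurable_funeM; exact/measurable_EFinP.
- by move=> x _; rewrite -EFinM lee_fin mulr_ge0.
- by move=> x _; rewrite lee_fin powR_ge0.
rewrite ge0_integralD// in H; first last.
- by move=> x _; rewrite lee_fin powR_ge0.
rewrite (ge0_integralZl _ measurableT _ (fun x _ => _))// in H; last 2 first.
- exact/measurable_EFinP.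
- by move=> x; rewrite lee_fin.
rewrite !intc in H.
rewrite -(leeD2rE (x := c%:E))//; apply: le_trans H.
rewrite leeD2l//.
by rewrite /c EFinM lee_wpmul2l// lee_fin.
Qed.

(** Binomial expansion around x: the linear coefficients are the partial
derivatives of f at x, multiplied by s. *)
Lemma shift_expansion n d (f : mpoly n R) (x : n.-tuple R) (s : R) :
  (0 < d)%N -> (msize f <= d.+1)%N ->
  exists c : mindex n d -> R[i],
    (forall z, complex_eval (fun i => (tnth x i)%:C + s%:C * z i) f = \sum_j c j * \prod_i z i ^+ j i) /\
    (forall l, coef1 (index_enum (mindex n d)) c (@mnat n d) l = (s * poly_eval (mderiv l f) x)%:C).
Proof.
move=> d0 fd.
pose e (i : 'I_n) (a k : nat) : R := tnth x i ^+ (a - k) * s ^+ k *+ 'C(a, k).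
have xe i a (z : R[i]) : (a <= d)%N ->
    ((tnth x i)%:C + s%:C * z) ^+ a = \sum_(k < d.+1) (e i a k)%:C * z ^+ k.
  move=> ad; rewrite exprDn (big_ord_widen d.+1 (fun k =>
    ((tnth x i)%:C ^+ (a - k) * (s%:C * z) ^+ k) *+ 'C(a, k)))//.
  rewrite [LHS]big_mkcond; apply: eq_bigr => k _; rewrite ltnS /e; case: leqP => [_|ak].
    by rewrite exprMn rmorphMn rmorphM !rmorphXn mulrA mulrnAl.
  by rewrite bin_small// mulr0n mul0r.
exists (fun j : mindex n d => \sum_(m <- msupp f) (mcoeff m f)%:C * \prod_i (e i (m i) (j i))%:C); split.
  move=> z; rewrite complex_evalE.
  under [RHS]eq_bigr do rewrite mulr_suml.
  rewrite exchange_big /= big_seq [RHS]big_seq; apply: eq_bigr => m mf.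
  under [RHS]eq_bigr do rewrite -mulrA -big_split.
  rewrite -mulr_sumr; congr (_ * _).
  rewrite -(bigA_distr_bigA (fun (i : 'I_n) (k : 'I_d.+1) => (e i (m i) k)%:C * z i ^+ k)).
  apply: eq_bigr => i _; apply: xe; apply: leq_trans (mmono_le fd mf).
  by rewrite (bigD1 i)//= leq_addr.
move=> l.
pose j0 : mindex n d := [ffun i => inord (i == l)].
have j0E i : j0 i = (i == l) :> nat.
  by rewrite ffunE inordK// ltnS (leq_trans (leq_b1 _)).
rewrite /coef1 (big_pred1 j0); last first.
  move=> j; apply/forallP/eqP => [h|-> i]; last by rewrite mnatE j0E.
  by apply/ffunP => i; apply: val_inj; rewrite /= j0E -(eqP (h i)) mnatE.
rewrite /poly_eval /mderiv raddf_sum mulr_sumr rmorph_sum; apply: eq_bigr => m _ /=.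
rewrite mevalZ mevalX -rmorph_prod -rmorphM; congr _%:C.
rewrite [RHS](_ : _ = mcoeff m f * (s * (m l)%:R * \prod_(i < n) tnth x i ^+ (mnm_sub m (mnm1 l)) i)); last by ring.
congr (_ * _).
under eq_bigr do rewrite j0E /e.
rewrite (bigD1 l)//= [in RHS](bigD1 l)//= eqxx mnmBE mnm1E eqxx bin1 expr1.
rewrite (_ : \prod_(i < n | i != l) _ = \prod_(i < n | i != l) tnth x i ^+ (mnm_sub m (mnm1 l)) i).
  by rewrite -mulr_natl; ring.
apply: eq_bigr => i il; rewrite (negbTE il) mnmBE mnm1E eq_sym (negbTE il).
by rewrite subn0 expr0 mulr1 bin0 mulr1n.
Qed.

Lemma measurable_poly_eval n (f : mpoly n R) :
  measurable_fun setT (fun x : n.-tuple MR => poly_eval f x).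
Proof.
rewrite (_ : (fun x => _) = (fun x => \sum_(m <- msupp f) mcoeff m f * \prod_(i < n) tnth x i ^+ m i)).
  apply: measurable_sum => m; apply: measurable_funM => //.
  apply: measurable_prod => i _; apply: measurable_funX; exact: measurable_tnth.
by apply/funext => x; rewrite /poly_eval mevalE.
Qed.

Lemma measurable_grad_norm n (f : mpoly n R) :
  measurable_fun setT (fun x : n.-tuple MR => grad_norm f x).
Proof.
apply: (measurableT_comp (continuous_measurable_fun (@sqrt_continuous R))).
by apply: measurable_sum => i; apply: measurable_funX; exact: measurable_poly_eval.
Qed.

(** Conditionally on the real point x, Jensen's inequality reduces the p-th
moment of f (x + s zeta) to the second one, and Bessel's inequality bounds that
one from below by the first-order terms. *)
Lemma gradient_le n d (f : mpoly n R) (p s : R) : 2 <= p -> (0 < d)%N -> (msize f <= d.+1)%N ->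
  (\int[power_prob gam n]_x ((2 * s ^+ 2 * grad_norm f x ^+ 2) `^ (p / 2))%:E <=
   \int[power_prob gauss3 n]_w (normc (complex_eval (fun i => Wz s (tnth w i)) f) `^ p)%:E)%E.
Proof.
move=> p2 d0 fd.
have a1 : 1 <= p / 2 by rewrite ler_pdivlMr// mul1r.
pose F (w : n.-tuple (MR * (MR * MR))) := complex_eval (fun i => Wz s (tnth w i)) f.
have cF : cmeas F.
  apply: cmeas_sum => m; apply: cmeasM; first exact: cmeas_cst.
  apply: cmeas_prod => i.
  rewrite (_ : (fun w => _) = (fun w : n.-tuple (MR * (MR * MR)) => ('X^(m i)).[Wz s (tnth w i)])).
    apply: cmeas_poly; have [h1 h2] := cmeas_Wz s.
    by split; [apply: (measurableT_comp h1)|apply: (measurableT_comp h2)]; exact: measurable_tnth.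
  by apply/funext => w; rewrite hornerXn.
rewrite /gauss3 integral_power_split; first last.
- exact: (measurable_normc_powR p cF).
- by move=> w; rewrite lee_fin powR_ge0.
have mF2 : measurable_fun setT (fun z : n.-tuple MR * n.-tuple (MR * MR) => (normc (F (tzip z.1 z.2)) `^ p)%:E).
  by apply: (measurableT_comp (measurable_normc_powR p cF)); exact: measurable_tzip.
apply: ge0_le_integral; first exact: measurableT.
- by move=> x _; rewrite lee_fin powR_ge0.
- apply/measurable_EFinP; apply: (measurableT_comp (measurable_powR _)).
  by apply: measurable_funM => //; apply: measurable_funX; exact: measurable_grad_norm.
- by apply: (measurable_fun_fubini_tonelli_F (m2 := power_prob gauss2 n) _ mF2) => z; rewrite lee_fin powR_ge0.
move=> x _.
have [c [cE c1]] := shift_expansion x s d0 fd.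
pose r := index_enum (mindex n d).
have FE y : F (tzip x y) = tsum zpow r c (@mnat n d) y.
  rewrite /F (_ : complex_eval _ f = complex_eval (fun i => (tnth x i)%:C + s%:C * zeta (tnth y i)) f).
    rewrite cE; apply: eq_bigr => j _; congr (_ * _).
    by apply: eq_bigr => i _; rewrite mnatE.
  apply: eq_bigr => m _; congr (_ * _); apply: eq_bigr => i _; congr (_ ^+ _).
  by rewrite tnth_mktuple /Wz /zeta; apply: reim_eq => /=; ring.
rewrite [leRHS](_ : _ = (\int[power_prob gauss2 n]_y (sqn (tsum zpow r c (@mnat n d) y) `^ (p / 2))%:E)%E); last first.
  by apply: eq_integral => y _; rewrite -/(F _) FE powR_sqn.
apply: jensen_powR => //.
- by rewrite mulr_ge0 ?sqr_ge0// mulr_ge0 ?sqr_ge0.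
- by apply: measurable_sqn; apply: cmeas_tsum; exact: cmeas_zpow.
- by move=> y; exact: sqn_ge0.
have B := bessel n r c (@mnat n d); apply: le_trans B; rewrite lee_fin.
rewrite (_ : 2 * s ^+ 2 * grad_norm f x ^+ 2 = 2 * \sum_(l < n) sqn (coef1 r c (@mnat n d) l)).
  by rewrite lerDr sqn_ge0.
rewrite /grad_norm sqr_sqrtr ?sumr_ge0//; last by move=> i _; exact: sqr_ge0.
rewrite -mulrA mulr_sumr; congr (_ * _); apply: eq_bigr => l _.
by rewrite c1 /sqn /= expr0n addr0 exprMn.
Qed.

End gradient.

(** * The exponent theta *)

Section theta_facts.
Context {R : realType}.
Implicit Types (x y p : R).

Lemma sin_atan x : sin (atan x) = x / Num.sqrt (1 + x ^+ 2).
Proof.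
have s0 : 0 < Num.sqrt (1 + x ^+ 2) by rewrite sqrtr_gt0 ltr_wpDr ?sqr_ge0.
have c0 : cos (atan x) != 0 by rewrite cos_atan invr_neq0// gt_eqF.
have := atanK x; rewrite /tan => h; rewrite -cos_atan -[X in X * cos _]h.
by rewrite divfK.
Qed.

(** Compare the mean slopes of sin on [0, x y] and [x y, y]. *)
Lemma sin_concave x y : 0 <= x <= 1 -> 0 <= y <= pi -> x * sin y <= sin (x * y).
Proof.
move=> /andP[x0 x1] /andP[y0 ypi].
have [->|xn0] := eqVneq x 0; first by rewrite !mul0r sin0.
have [->|xn1] := eqVneq x 1; first by rewrite !mul1r.
have [->|yn0] := eqVneq y 0; first by rewrite mulr0 sin0 mulr0.
have xp : 0 < x by rewrite lt_def xn0.
have yp : 0 < y by rewrite lt_def yn0.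
have x1' : x < 1 by rewrite lt_neqAle xn1.
have xy0 : 0 < x * y by exact: mulr_gt0.
have xy1 : x * y < y by rewrite gtr_pMl.
have cs : continuous (@sin R) by exact: continuous_sin.
have [a + ea] := MVT xy0 (fun z _ => is_derive_sin z) (continuous_subspaceT cs).
have [b + eb] := MVT xy1 (fun z _ => is_derive_sin z) (continuous_subspaceT cs).
rewrite !in_itv/= => /andP[b1 b2] /andP[a1 a2].
rewrite sin0 !subr0 in ea.
have cab : cos b <= cos a.
  apply/ltW; rewrite ltr_cos ?in_itv/=; first exact: lt_trans a2 b1.
  - by rewrite (ltW a1)/= (le_trans (ltW a2))// (le_trans (ltW xy1)).
  - by rewrite (le_trans (ltW xy0) (ltW b1))/= (le_trans (ltW b2)).
have -> : sin y = sin (x * y) + cos b * (y - x * y) by rewrite -eb addrC subrK.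
rewrite mulrDr.
have : x * (cos b * (y - x * y)) <= (1 - x) * sin (x * y).
  rewrite ea (_ : x * _ = cos b * (x * y * (1 - x))); last by ring.
  rewrite (_ : (1 - x) * _ = cos a * (x * y * (1 - x))); last by ring.
  by rewrite ler_wpM2r// !mulr_ge0// subr_ge0.
by lra.
Qed.

Lemma sin3 x : sin (3 * x) = 3 * sin x - 4 * sin x ^+ 3.
Proof.
have -> : 3 * x = x + x + x by ring.
rewrite !sinD !cosD; have := cos2Dsin2 x; move: (cos x) (sin x) => c s cs.
have -> : (s * c + c * s) * c = 2 * s * c ^+ 2 by ring.
by have -> : c ^+ 2 = 1 - s ^+ 2 by [rewrite -cs addrK]; rewrite mulrBl -expr2 (_ : c ^+ 2 = 1 - s ^+ 2); [ring|rewrite -cs addrK].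
Qed.

(** Triple-angle formula: s = sin (pi / 9) satisfies 3 s - 4 s^3 = sin (pi / 3),
whose square is 3 / 4, and 3 / 4 > (23 / 27)^2. *)
Lemma sin_pi9 : 3^-1 <= sin (pi / 9) :> R.
Proof.
have pp := @pi_gt0 R.
set s := sin _.
have s0 : 0 <= s by apply: sin_ge0_pi; apply/andP; split; lra.
have u0 : 0 < sin (pi / 3) :> R by apply: sin_gt0_pi; apply/andP; split; lra.
have us : sin (pi / 3) = 3 * s - 4 * s ^+ 3.
  by rewrite -sin3; congr sin; field.
have u2 : sin (pi / 3) ^+ 2 = 3 / 4 :> R.
  have := @sin3 (pi / 3); rewrite mulrCA divff// mulr1 sinpi.
  set u := sin _ in u0 *; move=> h.
  have : u * (3 - 4 * u ^+ 2) = 0 by rewrite h; ring.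
  by move/eqP; rewrite mulf_eq0 gt_eqF//= => /eqP; lra.
rewrite leNgt; apply/negP => s3.
have s3' : 3 * s - 4 * s ^+ 3 <= 23 / 27.
  have : 0 <= (3^-1 - s) * (3 - 4 * (9^-1 + s / 3 + s ^+ 2)).
    rewrite mulr_ge0 ?subr_ge0 ?(ltW s3)//.
    have : s ^+ 2 <= 3^-1 ^+ 2 by rewrite lerXn2r ?nnegrE ?(ltW s3).
    by lra.
  by move=> h; rewrite -subr_ge0 (_ : _ - _ = (3^-1 - s) * (3 - 4 * (9^-1 + s / 3 + s ^+ 2)))//; field.
have : sin (pi / 3) ^+ 2 <= (23 / 27) ^+ 2 :> R.
  by rewrite lerXn2r ?nnegrE ?(ltW u0)// us.
by rewrite u2; lra.
Qed.

Section fix_p.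
Variable p : R.
Hypothesis p4 : 4 <= p.

Let m : R := (Num.floor (p / 2))%:~R.

Lemma floor_half : [/\ 2 <= m, 2 * m <= p & p < 2 * m + 2].
Proof.
have h1 : m <= p / 2 by exact: floor_le.
have h2 : p / 2 < m + 1 by rewrite /m -intrD1 floorD1_gt.
have h3 : (2 <= Num.floor (p / 2))%R by rewrite floor_ge_int ler_pdivlMr//; move: p4; rewrite (_ : 4 = 2%:~R * 2 :> R)//; ring.
split; [by rewrite /m (_ : 2 = 2%:~R)// ler_int|lra|lra].
Qed.

Let x : R := (p - 2 * m) / (2 * Num.sqrt (m * (p - m))).

Let x0 : 0 <= x.
Proof. by have [*] := floor_half; rewrite divr_ge0 ?subr_ge0 ?mulr_ge0 ?sqrtr_ge0. Qed.

(** For q = p / m the right-hand side is (q - 2) / q: the angle pi * theta is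
the angle psi of [extrapolate_wedge]. *)
Lemma theta_sin : sin (pi * theta p) = (p - 2 * m) / p.
Proof.
have [h1 h2 h3] := floor_half.
rewrite /theta -/m mulrA divff ?gt_eqF ?pi_gt0// mul1r -/x sin_atan.
have mp : 0 < m * (p - m) by rewrite mulr_gt0//; lra.
have s0 : 0 < Num.sqrt (m * (p - m)) by rewrite sqrtr_gt0.
have p0 : 0 < p by lra.
have -> : 1 + x ^+ 2 = (p / (2 * Num.sqrt (m * (p - m)))) ^+ 2.
  rewrite /x !exprMn !exprVn !exprMn sqr_sqrtr ?(ltW mp)//.
  by field; apply/andP; split; lra.
rewrite sqrtr_sqr ger0_norm ?divr_ge0 ?mulr_ge0 ?(ltW s0) ?(ltW p0)// /x.
by field; rewrite !gt_eqF.
Qed.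

Lemma theta_lt_half : pi * theta p < pi / 2.
Proof.
rewrite /theta mulrA divff ?gt_eqF ?pi_gt0// mul1r.
by rewrite atan_ltpi2.
Qed.

Lemma theta_gt_half : - (pi / 2) < pi * theta p.
Proof.
rewrite /theta mulrA divff ?gt_eqF ?pi_gt0// mul1r.
by rewrite atan_gtNpi2.
Qed.

Lemma theta_ge0 : 0 <= theta p.
Proof.
have [h1 h2 h3] := floor_half; have p0 : 0 < p by lra.
have pp := @pi_gt0 R.
rewrite leNgt; apply/negP => a0.
have hl := theta_lt_half; have hg := theta_gt_half.
have : sin (pi * theta p) < sin 0.
  rewrite ltr_sin ?in_itv/=; first by rewrite pmulr_rlt0.
    by apply/andP; split; lra.
  by apply/andP; split; lra.
by rewrite theta_sin sin0 ltNge divr_ge0 ?subr_ge0 ?(ltW p0).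
Qed.

(** With r = p - 2 m in [0, 2), compare sines: the claim is
r / p <= sin (2 pi / (3 p)). For p >= 6 it follows from r < 2 and concavity
of sin between 0 and pi / 9. For p < 6 one has m = 2 and
r / p = 1 - 4 / p <= 1 / 3 <= sin (pi / 9). *)
Lemma theta_le : theta p <= 2 / (3 * p).
Proof.
have [h1 h2 h3] := floor_half.
have p0 : 0 < p by lra.
have pp := @pi_gt0 R.
pose t := pi * (2 / (3 * p)).
rewrite -(ler_pM2l pp) -/t leNgt; apply/negP => tt.
have t0 : 0 < t by rewrite mulr_gt0// divr_gt0// mulr_gt0.
have : sin t < sin (pi * theta p).
  have hh := theta_lt_half.
  by rewrite ltr_sin ?in_itv/=; [| apply/andP; split; lra| apply/andP; split; lra].
rewrite theta_sin ltNge => /negP; apply.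
have s9 := sin_pi9.
have [p6|p6] := leP 6 p.
  have -> : t = 6 / p * (pi / 9) by rewrite /t; field; lra.
  apply: le_trans (sin_concave _ _); last 2 first.
  - by rewrite divr_ge0 ?(ltW p0)//= ler_pdivrMr// mul1r.
  - by apply/andP; split; lra.
  rewrite -mulrA [p^-1 * _]mulrC mulrA ler_pM2r ?invr_gt0//.
  by lra.
have m2 : m = 2.
  have : m < 3 by lra.
  rewrite /m (_ : 3 = 3%:~R)// ltr_int => f3; move: h1; rewrite /m (_ : 2 = 2%:~R)// ler_int => f2.
  by congr (_%:~R); apply/eqP; rewrite eq_le f2 andbT -ltzD1.
rewrite m2.
apply: (@le_trans _ _ 3^-1); first by rewrite ler_pdivrMr//; lra.
apply: le_trans s9 _.
have [->//|n9] := eqVneq (pi / 9) t.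
have t9 : pi / 9 <= t.
  rewrite /t mulrC [leRHS]mulrC ler_pM2r// ler_pdivlMr ?mulr_gt0//; lra.
have t2 : t <= pi / 2.
  rewrite /t ler_pM2l// ler_pdivrMr ?mulr_gt0//; lra.
apply/ltW; rewrite ltr_sin ?in_itv/=; first by rewrite lt_neqAle n9.
- by apply/andP; split; lra.
- by apply/andP; split; lra.
Qed.

End fix_p.

Lemma theta_even (k : int) p : 4 <= p -> p = 2 * k%:~R -> theta p = 0.
Proof.
move=> p4 pk; rewrite /theta; have -> : Num.floor (p / 2) = k.
  by rewrite pk mulrAC divff// mul1r intrKfloor.
by rewrite pk subrr mul0r atan0 mulr0.
Qed.

End theta_facts.

(** * Bounds for the norm of the gradient *)

Section gradient_norm.
Context {R : realType}.
Local Open Scope complex_scope.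
Local Notation MR := (measurableTypeR R).
Local Notation gam := (@gauss_prob R).

Lemma gauss_norm_powR n (p : R) (g : n.-tuple R -> R) :
  gauss_norm p g = ((\int[power_prob gam n]_x (`|g x| `^ p)%:E) `^ p^-1)%E.
Proof.
rewrite /gauss_norm unlock; congr (_ `^ _)%E; exact: eq_integral.
Qed.

(** With p = k q, the p-th power of |f| is the q-th power of |f^k|, and f^k
has degree at most k d: this is how an exponent p is reached from a q for which
the contraction region is wide. *)
Lemma hypercontractive_poly n d k (f : mpoly n R) (p q s M : R) :
  2 <= q -> q <= 4 -> p = k%:R * q -> 0 < M -> (msize f <= d.+1)%N ->
  (forall N B, seminorm_on (k * d).+1 N ->
    (forall z, q * s ^+ 2 + (q - 2) * normc z <= q * Re z ->
      N (fun k => cexp (- z) ^+ k) <= B) -> N (fun=> 1) <= M * B) ->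
  (\int[power_prob gauss3 n]_w (normc (complex_eval (fun i => Wz s (tnth w i)) f) `^ p)%:E <=
   (M `^ q)%:E * \int[power_prob gam n]_x (`|poly_eval f x| `^ p)%:E)%E.
Proof.
move=> q2 q4 pq M0 fd hM.
have q0 : 0 < q by rewrite (lt_le_trans _ q2).
have q1 : 1 <= q by rewrite (le_trans _ q2)// ler1n.
set J := (\int[power_prob gam n]_x _)%E.
have [Jy|Jfin] := eqVneq J +oo%E.
  by rewrite Jy gt0_muley ?leey// lte_fin powR_gt0.
have [c [hc cE]] := hermite_expansion (msize_exp k fd).
have powE (y : R) : 0 <= y -> (y ^+ k) `^ q = y `^ p :> R.
  by move=> y0; rewrite -powR_mulrn// -powRrM pq.
pose r := index_enum (mindex n (k * d)).
pose phi k w : R[i] := (He k).[Wz s w].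
pose chi k (x : MR) := (He k : {poly R[i]}).[x%:C].
have GE x : normc (tsum chi r c (@mnat n (k * d)) x) `^ q = `|poly_eval f x| `^ p.
  rewrite -powE//; congr (_ `^ q).
  rewrite -normcC -normc_X -complex_eval_real -complex_evalX cE; congr normc.
  by apply: eq_bigr => j _; congr (_ * _); apply: eq_bigr => i _; rewrite mnatE.
have FE w : normc (tsum phi r c (@mnat n (k * d)) w) `^ q
    = normc (complex_eval (fun i => Wz s (tnth w i)) f) `^ p.
  rewrite -powE ?normc_ge0//; congr (_ `^ q).
  rewrite -normc_X -complex_evalX cE; congr normc.
  by apply: eq_bigr => j _; congr (_ * _); apply: eq_bigr => i _; rewrite mnatE.
pose B := LN (power_prob gam n) q (tsum chi r c (@mnat n (k * d))).
pose A := LN (power_prob gauss3 n) q (tsum phi r c (@mnat n (k * d))).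
have BE : (B `^ q = J)%E by rewrite /B (LN_powq _ q1); apply: eq_integral => x _; rewrite GE.
have AE : (A `^ q = \int[power_prob gauss3 n]_w
    (normc (complex_eval (fun i => Wz s (tnth w i)) f) `^ p)%:E)%E.
  by rewrite /A (LN_powq _ q1); apply: eq_integral => w _; rewrite FE.
have Bfin : (B < +oo)%E.
  by apply: (lty_poweRy (lt0r_neq0 q0)); rewrite BE ltey.
have AB := hypercontractivity q2 q4 hc Bfin hM.
have A0 : (0 <= A)%E by exact: LN_ge0.
have B0 : (0 <= B)%E by exact: LN_ge0.
have MB0 : (0 <= M%:E * B)%E by rewrite mule_ge0// lee_fin ltW.
rewrite -AE -BE -poweR_EFin -poweRM ?lee_fin ?(ltW M0)//.
by apply: gt0_ler_poweR => //; rewrite ?(ltW q0)// in_itv/= leey andbT.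
Qed.

Lemma gauss_norm_le n (p A B C : R) (g h : n.-tuple R -> R) : 0 < p -> 0 < A -> 0 <= C ->
  B <= A * C `^ p ->
  (A%:E * \int[power_prob gam n]_x (`|g x| `^ p)%:E <=
   B%:E * \int[power_prob gam n]_x (`|h x| `^ p)%:E)%E ->
  (gauss_norm p g <= C%:E * gauss_norm p h)%E.
Proof.
move=> p0 A0 C0 BA H.
have ge0 (k : n.-tuple R -> R) : (0 <= \int[power_prob gam n]_x (`|k x| `^ p)%:E)%E.
  by apply: integral_ge0 => x _; rewrite lee_fin powR_ge0.
rewrite !gauss_norm_powR.
have -> : C%:E = ((C `^ p)%:E `^ p^-1)%E.
  by rewrite poweR_EFin -powRrM divff ?gt_eqF// powRr1.
rewrite -poweRM ?lee_fin ?powR_ge0//; apply: gt0_ler_poweR.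
- by rewrite invr_ge0 ltW.
- by rewrite in_itv/= leey andbT.
- by rewrite in_itv/= leey andbT mule_ge0// lee_fin powR_ge0.
rewrite -(@lee_pmul2l _ A%:E)// muleA -EFinM; apply: (le_trans H).
by rewrite lee_wpmul2r// lee_fin.
Qed.

Lemma gradient_norm n d k (f : mpoly n R) (p q s M C : R) :
  2 <= q -> q <= 4 -> (0 < k)%N -> p = k%:R * q -> 0 < s -> 0 < M -> 0 <= C ->
  (0 < d)%N -> (msize f <= d.+1)%N ->
  (forall N B, seminorm_on (k * d).+1 N ->
    (forall z, q * s ^+ 2 + (q - 2) * normc z <= q * Re z ->
      N (fun k => cexp (- z) ^+ k) <= B) -> N (fun=> 1) <= M * B) ->
  M `^ q <= (2 * s ^+ 2) `^ (p / 2) * C `^ p ->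
  (gauss_norm p (grad_norm f) <= C%:E * gauss_norm p (poly_eval f))%E.
Proof.
move=> q2 q4 k0 pq s0 M0 C0 d0 fd hM hC.
have p2 : 2 <= p.
  by rewrite pq (le_trans q2)// ler_peMl ?(le_trans _ q2)// ler1n.
have p0 : 0 < p by rewrite (lt_le_trans _ p2).
have A0 : 0 < (2 * s ^+ 2) `^ (p / 2) by rewrite powR_gt0// mulr_gt0// exprn_gt0.
apply: (gauss_norm_le p0 A0 C0 hC).
apply: le_trans (hypercontractive_poly q2 q4 pq M0 fd hM).
apply: le_trans (gradient_le s p2 d0 fd).
have mg : measurable_fun setT (fun x : n.-tuple MR => (`|grad_norm f x| `^ p)%:E).
  apply/measurable_EFinP; apply: (measurableT_comp (measurable_powR _)).
  by apply: measurableT_comp => //; exact: measurable_grad_norm.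
rewrite -ge0_integralZl//; last by rewrite lee_fin powR_ge0.
rewrite le_eqVlt; apply/orP; left; apply/eqP; apply: eq_integral => x _.
have g0 : 0 <= grad_norm f x by exact: sqrtr_ge0.
rewrite -EFinM; congr EFin.
rewrite [RHS]powRM ?sqr_ge0 ?mulr_ge0 ?(ltW s0)//.
rewrite (ger0_norm g0) -(powR_mulrn _ g0) -[in RHS]powRrM; congr (_ * _ `^ _).
by field.
Qed.

End gradient_norm.

(** * Choice of the parameters *)

Section constants.
Context {R : realType}.
Local Open Scope complex_scope.

Let kapE (q s : R) (z : R[i]) : 0 < q ->
  s ^+ 2 + (q - 2) / q * normc z <= Re z -> q * s ^+ 2 + (q - 2) * normc z <= q * Re z.
Proof.
move=> q0; rewrite -(ler_pM2l q0) mulrDr.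
have -> // : q * ((q - 2) / q * normc z) = (q - 2) * normc z by field; rewrite gt_eqF.
Qed.

(** Here q = 2 and the extrapolation is from a half-plane. The choice
s^2 = 1 / (2 d) balances the loss e^(s^2 k d) against the factor s^-1. *)
Lemma gradient_norm_even n d k (f : mpoly n R) (p : R) : (2 <= k)%N -> p = k%:R * 2 ->
  (0 < d)%N -> (msize f <= d.+1)%N ->
  (gauss_norm p (grad_norm f) <= (3 * Num.sqrt p * d%:R `^ 2^-1)%:E * gauss_norm p (poly_eval f))%E.
Proof.
move=> k2 pE d0 fd.
have dp : 0 < d%:R :> R by rewrite ltr0n.
have kp : 2 <= k%:R :> R by rewrite ler_nat.
have p4 : 4 <= p by rewrite pE; lra.
pose s : R := Num.sqrt (2 * d%:R)^-1.
have s2 : s ^+ 2 = (2 * d%:R)^-1 by rewrite sqr_sqrtr// invr_ge0 mulr_ge0.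
have s0 : 0 < s by rewrite sqrtr_gt0 invr_gt0 mulr_gt0.
have sp : 2 <= Num.sqrt p.
  by rewrite -[leLHS]ger0_norm// -sqrtr_sqr ler_wsqrtr// -natrX.
apply: (@gradient_norm _ n d k f p 2 s (expR (s ^+ 2) ^+ (k * d))) => //.
- by rewrite ler_nat.
- by rewrite (leq_trans _ k2).
- by rewrite exprn_gt0// expR_gt0.
- move=> N B hN hc; apply: (@extrapolate_disc _ _ _ s ((2 - 2) / 2) B hN); last by rewrite subrr mul0r.
  by move=> z hz; apply: hc; apply: kapE.
have -> : 2 * s ^+ 2 = d%:R^-1 by rewrite s2; field; rewrite gt_eqF.
have -> : expR (s ^+ 2) ^+ (k * d) = expR (p / 4).
  rewrite -expRM_natr; congr expR; rewrite s2 pE natrM; field; rewrite gt_eqF//.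
have -> : (d%:R^-1 : R) `^ (p / 2) * (3 * Num.sqrt p * d%:R `^ 2^-1) `^ p = (3 * Num.sqrt p) `^ p.
  rewrite powRM ?powR_ge0 ?mulr_ge0 ?sqrtr_ge0// -powRrM mulrCA.
  rewrite -powR_inv1 ?(ltW dp)// -powRrM -powRD; last by rewrite (gt_eqF dp) implybT.
  by rewrite (_ : _ + _ = 0) ?powRr0 ?mulr1//; field.
have -> : expR (p / 4) `^ 2 = expR (2^-1) `^ p.
  by rewrite -!expRM; congr expR; field.
apply: ge0_ler_powR; rewrite ?nnegrE ?expR_ge0 ?mulr_ge0 ?sqrtr_ge0//; first by lra.
have : expR (- 2^-1) >= 2^-1 :> R.
  by have := @expR_ge1Dx R (- 2^-1); lra.
rewrite expRN => h.
have : expR 2^-1 <= 2 :> R.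
  by rewrite -(invrK (expR _)) -[leRHS]invrK lef_pV2 ?posrE ?invr_gt0 ?expR_gt0.
by lra.
Qed.

(** Here q = p / k lies in [2, 3]. With dl = (k d)^-(1 + 2 theta) the loss
exp (10 k d dl^al) of the extrapolation is e^10, and the factor s^-1 is of order
(k d)^(1/2 + theta). *)
Lemma gradient_norm_gen (p : R) : 4 <= p ->
  exists2 C : R, 0 < C & forall n d (f : mpoly n R), (0 < d)%N -> (msize f <= d.+1)%N ->
  (gauss_norm p (grad_norm f) <= (C * d%:R `^ (2^-1 + theta p))%:E * gauss_norm p (poly_eval f))%E.
Proof.
move=> p4.
have [h1 h2 h3] := floor_half p4; have st := theta_sin p4.
have th0 := theta_ge0 p4; have thl := @theta_lt_half R p; have pp := @pi_gt0 R.
set m : R := (Num.floor (p / 2))%:~R in h1 h2 h3 st.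
have [k mk] : exists k : nat, m = k%:R.
  exists `|Num.floor (p / 2)|%N.
  rewrite /m -[LHS]ger0_norm; last by rewrite -/m; lra.
  by rewrite natr_absz intr_norm.
have k0 : (0 < k)%N by rewrite -(ltr_nat R) -mk; lra.
have p0 : 0 < p by lra.
have m0 : 0 < m by lra.
pose q := p / m.
have q0 : 0 < q by rewrite divr_gt0.
have q2 : 2 <= q by rewrite ler_pdivlMr.
have q3 : q <= 3 by rewrite ler_pdivrMr//; lra.
pose kap := (q - 2) / q.
have kE : sin (pi * theta p) = kap.
  by rewrite st /kap /q; field; rewrite !gt_eqF.
have k3 : kap <= 3^-1 by rewrite ler_pdivrMr//; lra.
have k1 : 1 - kap = 2 / q by rewrite /kap; field; rewrite gt_eqF.
set th := theta p in th0 thl kE *.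
pose C := expR (10 / m) * (Num.sqrt q / 2) * m `^ (2^-1 + th).
have sq0 : 0 < Num.sqrt q by rewrite sqrtr_gt0.
have C0 : 0 < C by rewrite !mulr_gt0 ?expR_gt0 ?powR_gt0 ?invr_gt0.
exists C => // n d f d0 fd.
have dp : 0 < d%:R :> R by rewrite ltr0n.
pose D : R := (k * d)%:R.
have Dm : D = m * d%:R by rewrite /D natrM mk.
have D0 : 0 < D by rewrite Dm mulr_gt0.
have D1 : 1 <= D by rewrite /D ler1n muln_gt0 k0.
pose dl := D `^ (- (1 + 2 * th)).
have dl0 : 0 < dl by rewrite powR_gt0.
have dl1 : dl <= 1.
  by rewrite /dl -[leRHS](powRr0 D) ler_powR//; lra.
pose s := Num.sqrt (2 / q * dl).
have s2 : s ^+ 2 = 2 / q * dl by rewrite sqr_sqrtr//; apply: mulr_ge0; [exact: divr_ge0 (ltW q0)|exact: ltW].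
have s0 : 0 < s by rewrite sqrtr_gt0 mulr_gt0// divr_gt0.
apply: (@gradient_norm _ n d k f p q s (expR 10)) => //.
- by lra.
- by rewrite -mk /q; field; rewrite gt_eqF.
- by rewrite mulr_ge0 ?powR_ge0 ?(ltW C0).
- move=> N B hN hc.
  have := @extrapolate_wedge _ _ _ s kap B hN _ (pi * th) dl.
  rewrite -/D (_ : 10 * D * _ = 10); first apply.
  + by move=> z hz; apply: hc; apply: kapE.
  + by rewrite mulr_ge0 ?(ltW pp).
  + exact: thl.
  + exact: kE.
  + exact: k3.
  + exact: dl0.
  + exact: dl1.
  + by rewrite s2 k1.
  rewrite /dl -powRrM (_ : _ * (_ / _) = -1).
    by rewrite powR_inv1 ?(ltW D0)// mulfK// gt_eqF.
  have t1 : 0 < 1 + 2 * th by lra.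
  rewrite (_ : pi / 2 + pi * th = (1 + 2 * th) * (pi / 2)); last by field.
  have h (a c : R) : 0 < a -> 0 < c -> - a * (c / (a * c)) = -1.
    by move=> a0 c0; field; rewrite !gt_eqF.
  by apply: h => //; exact: divr_gt0.
have -> : 2 * s ^+ 2 = (2 / Num.sqrt q * D `^ (- (2^-1 + th))) ^+ 2.
  have e : (D `^ (- (2^-1 + th))) ^+ 2 = dl.
    by rewrite -powR_mulrn ?powR_ge0// -powRrM /dl; congr (_ `^ _); field.
  have e' : (2 / Num.sqrt q) ^+ 2 = 4 / q.
    by rewrite exprMn exprVn sqr_sqrtr ?(ltW q0)// -natrX.
  by rewrite s2 exprMn e e'; ring.
set X := _ * D `^ _; have X0 : 0 <= X by rewrite mulr_ge0 ?powR_ge0 ?divr_ge0 ?(ltW sq0).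
rewrite -powR_mulrn// -powRrM (_ : 2 * (p / 2) = p); last by field.
rewrite -powRM//; last by rewrite mulr_ge0 ?powR_ge0 ?(ltW C0).
rewrite (_ : X * _ = expR (10 / m)).
  rewrite -!expRM le_eqVlt (_ : 10 * q = 10 / m * p) ?eqxx//.
  by rewrite /q; field; rewrite gt_eqF.
rewrite /X /C Dm [in LHS]powRM ?(ltW m0) ?(ltW dp)// !powRN.
by field; rewrite !gt_eqF ?powR_gt0.
Qed.

End constants.

Theorem theorem1p2 (R : realType) (p : R) (hp : 4 <= p) :
  [/\ theta p <= 2 / (3 * p),
      exists2 C : R, 0 < C &
        forall (n d : nat) (f : mpoly n R),
          (0 < n)%N -> (0 < d)%N -> total_degree_le d f ->
          (gauss_norm p (grad_norm f) <=
             (C * d%:R `^ (2^-1 + theta p))%:E * gauss_norm p (poly_eval f))%E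
    & forall k : int, p = 2 * k%:~R ->
        theta p = 0 /\
        forall (n d : nat) (f : mpoly n R),
          (0 < n)%N -> (0 < d)%N -> total_degree_le d f ->
          (gauss_norm p (grad_norm f) <=
             (3 * Num.sqrt p * d%:R `^ (2^-1 + theta p))%:E *
             gauss_norm p (poly_eval f))%E].
Proof.
split.
- exact: theta_le.
- have [C C0 H] := gradient_norm_gen hp.
  by exists C => // n d f _ d0 fd; exact: H.
move=> k pk; have th0 := theta_even hp pk; split=> // n d f _ d0 fd.
rewrite th0 addr0.
have k2 : (2 <= k)%R.
  by rewrite -(ler_int R) -[leLHS]/(2 : R); move: hp; rewrite pk; lra.
case: k k2 pk => [k|//] k2 pk.
apply: (@gradient_norm_even _ n d k) => //.
by rewrite pk mulrC.
Qed.
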